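(* Let $d\ge1$, $T>0$, $\lambda\in(0,2)$, let $f=(f_1,\dots,f_d):\mathbb{R}\to\mathbb{R}^d$ and $A:\mathbb{R}\to\mathbb{R}$ be Lipschitz continuous with $A$ non-decreasing and $A(0)=0$, and let $u_0\in L^\infty(\mathbb{R}^d)\cap L^1(\mathbb{R}^d)$. Let $\{\bar u\}$ be a sequence of (interpolated) solutions of the explicit numerical scheme described in the context, with initial datum $u_0$, indexed by grid sizes $\Delta x\to0$ and time steps $\Delta t$ satisfying the CFL condition stated in the context. Suppose $\{\bar u\}$ is uniformly bounded in $L^\infty(Q_T)$ and there exists $u\in L^\infty(Q_T)\cap C([0,T];L^1(\mathbb{R}^d))$ such that $\bar u\to u$ in $C([0,T];L^1(\mathbb{R}^d))$ (i.e. $\sup_{t\in[0,T]}\|\bar u(\cdot,t)-u(\cdot,t)\|_{L^1(\mathbb{R}^d)}\to0$) as $\Delta x\to0$. Then $u$ is an entropy solution of $$\partial_t u+\nabla\cdot f(u)=-(-\Delta)^{\lambda/2}A(u)\ \text{ in } Q_T=\mathbb{R}^d\times(0,T),\qquad u(\cdot,0)=u_0 \text{ in }\mathbb{R}^d .$$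
   Context: Nonlocal operator. Fix $c_\lambda>0$; $-(-\Delta)^{\lambda/2}\phi(x)=g[\phi](x)=c_\lambda\,\mathrm{P.V.}\int_{|z|>0}\frac{\phi(x+z)-\phi(x)}{|z|^{d+\lambda}}\,dz$ (in the space variable), with $\mathrm{P.V.}\int_{|z|>0}=\lim_{b\to0^+}\int_{|z|>b}$. For $r>0$: $g_r[\varphi](x)=c_\lambda\,\mathrm{P.V.}\int_{|z|<r}\frac{\varphi(x+z)-\varphi(x)}{|z|^{d+\lambda}}\,dz$ and $g^r[\varphi](x)=c_\lambda\int_{|z|>r}\frac{\varphi(x+z)-\varphi(x)}{|z|^{d+\lambda}}\,dz$. Entropy solution. With $\eta_k(u)=|u-k|$, $\eta_k'(u)=\mathrm{sgn}(u-k)$ ($\mathrm{sgn}(0)=0$), $q_k(u)=\eta_k'(u)(f(u)-f(k))$, a function $u$ is an entropy solution with initial datum $u_0$ if (i) $u\in L^\infty(Q_T)\cap C([0,T];L^1(\mathbb{R}^d))$; (ii) for all $k\in\mathbb{R}$, $r>0$ and nonnegative $\varphi\in C_c^\infty(Q_T)$, $\iint_{Q_T}\eta_k(u)\partial_t\varphi+q_k(u)\cdot\nabla\varphi+\eta_{A(k)}(A(u))g_r[\varphi]+\eta_k'(u)g^r[A(u)]\varphi\,dx\,dt\ge0$; (iii) $u(\cdot,0)=u_0$ a.e. Numerical scheme. For $\Delta x,\Delta t>0$ with $N\Delta t=T$, $N\in\mathbb{N}$, let $x_\alpha=\Delta x\,\alpha$ ($\alpha\in\mathbb{Z}^d$),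 $t_n=n\Delta t$, $R=\Delta x[0,1)^d$, $R_0=\frac{\Delta x}{2}[-1,1)^d$, $e_l$ the $l$-th unit vector, $D_l^-V_\alpha=\frac1{\Delta x}(V_\alpha-V_{\alpha-e_l})$, and $G_\beta=c_\lambda\int_{x_\beta+R_0}\frac{dz}{|z|^{d+\lambda}}$ for $\beta\ne0$. The scheme is $$U_\alpha^{n+1}=U_\alpha^n-\Delta t\sum_{l=1}^dD_l^-F_l(U_\alpha^n,U_{\alpha+e_l}^n)+\Delta t\sum_{\beta\ne0}G_\beta\big(A(U_{\alpha+\beta}^n)-A(U_\alpha^n)\big),\qquad U_\alpha^0=\frac1{\Delta x^d}\int_{x_\alpha+R}u_0\,dx,$$ where each numerical flux $F_l:\mathbb{R}^2\to\mathbb{R}$ (fixed, independent of the grid) is Lipschitz continuous with constant $L_F$, consistent ($F_l(u,u)=f_l(u)$ for all $u$), non-decreasing in its first and non-increasing in its second argument. The interpolation is $\bar u(x,t)=U_\alpha^n$ for $(x,t)\in(x_\alpha+R)\times[t_n,t_{n+1})$. CFL condition. With $L_A$ the Lipschitz constant of $A$, $$2dL_F\frac{\Delta t}{\Delta x}+\Big(c_\lambda2^\lambda L_A\int_{|z|>1}\frac{dz}{|z|^{d+\lambda}}\Big)\frac{\Delta t}{\Delta x^\lambda}\le1 .$$ *)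

(* Defs.v *)
From HB Require Import structures.
From mathcomp Require Import all_boot all_order all_algebra.
From mathcomp Require Import all_classical all_reals all_analysis.

Set Implicit Arguments.
Unset Strict Implicit.
Unset Printing Implicit Defensive.
Import Order.TTheory GRing.Theory Num.Theory.
Import numFieldNormedType.Exports.
Local Open Scope classical_set_scope.
Local Open Scope ring_scope.

(* 'rV[R]_n carries the sigma-algebra generated by the coordinates, that is its
   Borel sigma-algebra. *)
Definition rV_display : measure_display. Proof. exact. Qed.

Section measurable_rV.
Context {R : realType} {n : nat}.

Definition rV_coord (i : 'I_n) (x : 'rV[R]_n) : R := x ord0 i.

HB.instance Definition _ := @isMeasurable.Build rV_display
  'rV[R]_n (g_sigma_preimage rV_coord) (@sigma_algebra0 _ setT _)
  (@sigma_algebraC 'rV[R]_n _) (@sigma_algebra_bigcup _ setT _).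

Lemma measurable_rV_coord (i : 'I_n) : measurable_fun setT (rV_coord i).
Proof.
move=> _ Y mY; rewrite setTI; apply: sub_sigma_algebra => /=.
rewrite -bigcup_seq/=; exists i => /=; first by rewrite mem_index_enum.
by exists Y => //; rewrite setTI.
Qed.

Lemma measurable_fun_rVP d (T : measurableType d) (f : T -> 'rV[R]_n) :
  measurable_fun setT f <-> forall i, measurable_fun setT (rV_coord i \o f).
Proof.
split=> [mf i|mf]; first by apply: measurableT_comp => //; exact: measurable_rV_coord.
move=> _ A mA; rewrite setTI.
pose G := image_set_system setT f measurable.
have : measurable `<=` G; last first.
  by move=> /(_ _ mA); rewrite /G /image_set_system /= setTI.
apply: smallest_sub.
  exact/sigma_algebra_image/sigma_algebra_measurable.
rewrite -bigcup_seq/= => B' [i _ [B mB]] <-.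
rewrite /G /image_set_system /= !setTI.
by have := mf i measurableT B mB; rewrite setTI.
Qed.

End measurable_rV.

Section rV_cons.
Context {R : realType} {n : nat}.

Definition rV_cons (p : measurableTypeR R * 'rV[R]_n) : 'rV[R]_n.+1 :=
  row_mx (const_mx p.1 : 'rV_1) p.2.

Definition rV_uncons (x : 'rV[R]_n.+1) : measurableTypeR R * 'rV[R]_n :=
  (x ord0 ord0, rsubmx (x : 'rV_(1 + n))).

Lemma rV_cons0 p : rV_cons p ord0 ord0 = p.1.
Proof. by rewrite /rV_cons mxE; case: splitP => // j _; rewrite mxE. Qed.

Lemma rV_consS p i : rV_cons p ord0 (lift ord0 i) = p.2 ord0 i.
Proof.
rewrite /rV_cons mxE; case: splitP => [j|j /= /eq_add_S ij].
  by rewrite ord1.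
by congr (p.2 _ _); apply/val_inj.
Qed.

Lemma rV_consK : cancel rV_cons rV_uncons.
Proof.
move=> [a v]; rewrite /rV_cons /rV_uncons row_mxKr; congr (_, _).
exact: (rV_cons0 (a, v)).
Qed.

Lemma measurable_rV_cons : measurable_fun setT rV_cons.
Proof.
apply/measurable_fun_rVP => i; have [j ->|->] := unliftP ord0 i; last first.
  rewrite [X in measurable_fun _ X](_ : _ = fst)//.
  by apply/funext => p /=; rewrite /rV_coord rV_cons0.
rewrite [X in measurable_fun _ X](_ : _ = rV_coord j \o snd).
  by apply: measurableT_comp => //; exact: measurable_rV_coord.
by apply/funext => p /=; rewrite /rV_coord rV_consS.
Qed.

Lemma measurable_rV_uncons : measurable_fun setT rV_uncons.
Proof.
apply/measurable_fun_pairP; split.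
  exact: (@measurable_rV_coord R n.+1 ord0).
apply/measurable_fun_rVP => i.
rewrite [X in measurable_fun _ X](_ : _ =
  rV_coord (rshift 1 i : 'I_n.+1)).
  exact: measurable_rV_coord.
by apply/funext => x; rewrite /rV_coord/= mxE.
Qed.

End rV_cons.


Section lebesgue_rV_succ.
Context {R : realType} {n : nat}.
Variable m : {sigma_finite_measure set 'rV[R]_n -> \bar R}.
Local Open Scope ereal_scope.

Definition lebesgue_rV_succ : set 'rV[R]_n.+1 -> \bar R :=
  pushforward (lebesgue_measure \x m) (@rV_cons R n).

Let preim A : measurable A -> measurable (@rV_cons R n @^-1` A).
Proof.
by move=> mA; rewrite -[X in measurable X]setTI; exact: measurable_rV_cons.
Qed.

Let mu0 : lebesgue_rV_succ set0 = 0.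
Proof. by rewrite /lebesgue_rV_succ /pushforward preimage_set0 measure0. Qed.

Let mu_ge0 A : 0 <= lebesgue_rV_succ A.
Proof. exact: (measure_ge0 (lebesgue_measure \x m)). Qed.

Let mu_sigma_additive : semi_sigma_additive lebesgue_rV_succ.
Proof.
move=> F mF tF mUF; rewrite /lebesgue_rV_succ /pushforward preimage_bigcup.
apply: measure_semi_sigma_additive.
- by move=> k; exact: preim.
- apply/trivIsetP => /= i j _ _ ij; rewrite -preimage_setI.
  by move/trivIsetP : tF => /(_ _ _ _ _ ij) ->//; rewrite preimage_set0.
- by rewrite -preimage_bigcup; exact: preim.
Qed.

HB.instance Definition _ :=
  isMeasure.Build _ _ _ lebesgue_rV_succ mu0 mu_ge0 mu_sigma_additive.

Let mu_sigma_finite : sigma_finite setT lebesgue_rV_succ.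
Proof.
have /sigma_finiteP[F [TF ndF Foo]] := sigma_finiteT (@lebesgue_measure R).
have /sigma_finiteP[G [TG ndG Goo]] := sigma_finiteT m.
exists (fun k => @rV_uncons R n @^-1` (F k `*` G k)).
  rewrite -preimage_bigcup (_ : \bigcup_k _ = setT) ?preimage_setT//.
  rewrite -setXTT TF TG; apply/seteqP; split=> -[x y].
    by move=> [k _ []/= ? ?]; split; exists k.
  move=> [/= [i _ Fix_] [j _ Gjy]]; exists (maxn i j) => //; split.
  - by move: x Fix_; exact/subsetPset/ndF/leq_maxl.
  - by move: y Gjy; exact/subsetPset/ndG/leq_maxr.
move=> k; have [mF Fk] := Foo k; have [mG Gk] := Goo k.
have mFG : measurable (F k `*` G k) by exact: measurableX.
split.
  by rewrite -[X in measurable X]setTI; exact: measurable_rV_uncons.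
rewrite /lebesgue_rV_succ /pushforward -comp_preimage.
rewrite (_ : @rV_uncons R n \o rV_cons = id); last exact/funext/rV_consK.
by rewrite preimage_id product_measure1E// lte_mul_pinfty// ge0_fin_numE.
Qed.

HB.instance Definition _ :=
  Measure_isSigmaFinite.Build _ _ _ lebesgue_rV_succ mu_sigma_finite.

End lebesgue_rV_succ.

(* Lebesgue measure on R^n (on Borel sets), as an iterated product of the
   one-dimensional one; [lebesgue_rV_box] gives its value on boxes. *)
Fixpoint lebesgue_rV {R : realType} (n : nat) :
    {sigma_finite_measure set 'rV[R]_n -> \bar R} :=
  if n is n'.+1 then lebesgue_rV_succ (lebesgue_rV n') else \d_(0 : 'rV[R]_0).

Lemma lebesgue_rV_box (R : realType) n (A : 'I_n -> set R) :
  (forall i, measurable (A i)) ->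
  lebesgue_rV n [set x : 'rV[R]_n | forall i, A i (x ord0 i)] =
  (\prod_(i < n) lebesgue_measure (A i))%E.
Proof.
elim: n A => [|n IH] A mA.
  by rewrite big_ord0 /= diracE mem_set// => -[].
rewrite big_ord_recl -IH//= -product_measure1E//.
- rewrite /lebesgue_rV_succ /pushforward; congr (_ _).
  apply/seteqP; split=> [[a v] /= H|[a v] /= [H0 H] i].
    by split=> [|i]; [have := H ord0; rewrite rV_cons0|
                      have := H (lift ord0 i); rewrite rV_consS].
  by have [j ->|->] := unliftP ord0 i; rewrite ?rV_consS ?rV_cons0.
- exact: (mA ord0).
- rewrite [X in measurable X](_ : _ = \bigcap_(i in [set: 'I_n])
      rV_coord i @^-1` A (lift ord0 i)).
    apply: fin_bigcap_measurable => //= i _.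
    by rewrite -[X in measurable X]setTI; exact: measurable_rV_coord.
  by apply/seteqP; split=> x /= H i; [move=> _|]; exact: H.
Qed.

(* dx dt on R^d x R *)
Notation lebesgue_xt d := (lebesgue_rV d \x lebesgue_measure)%E.

Section spaces.
Context {R : realType}.

(* L^oo(D): the value of f outside D is irrelevant. *)
Definition Linfty dd (X : measurableType dd) (mu : {measure set X -> \bar R})
    (D : set X) (f : X -> R) : Prop :=
  measurable_fun D f /\
  exists M : R, {ae mu, forall x, D x -> `|f x| <= M}.

Definition QT d (T : R) : set ('rV[R]_d * R) := [set: 'rV[R]_d] `*` `]0, T[.

(* C([0,T]; L^1(R^d)); only the slices at times t in [0,T] matter. *)
Definition CL1 d (T : R) (u : 'rV[R]_d * R -> R) : Prop :=
  (forall t, t \in `[0, T] ->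
    (lebesgue_rV d).-integrable setT (fun x => (u (x, t))%:E)) /\
  (forall t, t \in `[0, T] ->
    (\int[lebesgue_rV d]_x `|u (x, s) - u (x, t)|%:E)%E
      @[s --> within `[0, T] (nbhs t)] --> 0%E).

Fixpoint Ck (V : normedModType R) (k : nat) (phi : V -> R) : Prop :=
  if k is k'.+1 then
    continuous phi /\
    forall v, (forall p, derivable phi p v) /\ Ck k' ('D_v phi)
  else continuous phi.

(* C_c^oo(Q_T), functions being extended by 0 outside the open set Q_T. *)
Definition test_fun d (T : R) (phi : 'rV[R]_d * R -> R) : Prop :=
  (forall k, Ck k phi) /\
  exists K : set ('rV[R]_d * R),
    [/\ compact K, K `<=` QT T & forall p, ~ K p -> phi p = 0].

End spaces.

Section nonlocal_operator.
Context {R : realType} {d : nat}.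

Definition enorm (z : 'rV[R]_d) : R := Num.sqrt (\sum_(i < d) z ord0 i ^+ 2).

(* c is the constant c_lambda *)
Variables (c lambda : R).

Definition kernel (z : 'rV[R]_d) : R := (enorm z `^ (d%:R + lambda))^-1.

Definition g_on (D : set 'rV[R]_d) (phi : 'rV[R]_d -> R) (x : 'rV[R]_d) : R :=
  c * \int[lebesgue_rV d]_(z in D) ((phi (x + z) - phi x) * kernel z).

(* g_r, with its principal value *)
Definition g_inner (r : R) (phi : 'rV[R]_d -> R) (x : 'rV[R]_d) : R :=
  lim (g_on [set z | b < enorm z < r] phi x @[b --> 0^'+]).

(* g^r *)
Definition g_outer (r : R) (phi : 'rV[R]_d -> R) (x : 'rV[R]_d) : R :=
  g_on [set z | r < enorm z] phi x.

End nonlocal_operator.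

Section entropy_solution.
Context {R : realType} {d : nat}.
Variables (c lambda T : R) (f : R -> 'rV[R]_d) (A : R -> R).

Definition eta (k u : R) : R := `|u - k|.

Definition deta (k u : R) : R := Num.sg (u - k).

Definition qflux (k u : R) (l : 'I_d) : R :=
  deta k u * (f u ord0 l - f k ord0 l).

Definition partial_t (phi : 'rV[R]_d * R -> R) := 'D_((0, 1) : 'rV[R]_d * R) phi.

Definition partial_x (l : 'I_d) (phi : 'rV[R]_d * R -> R) :=
  'D_(('e_l, 0) : 'rV[R]_d * R) phi.

Definition entropy_integrand (u : 'rV[R]_d * R -> R) (k r : R)
    (phi : 'rV[R]_d * R -> R) (p : 'rV[R]_d * R) : R :=
  eta k (u p) * partial_t phi p
  + \sum_(l < d) qflux k (u p) l * partial_x l phi p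
  + eta (A k) (A (u p)) * g_inner c lambda r (fun x => phi (x, p.2)) p.1
  + deta k (u p) * g_outer c lambda r (fun x => A (u (x, p.2))) p.1 * phi p.

Definition entropy_solution (u0 : 'rV[R]_d -> R) (u : 'rV[R]_d * R -> R) :
    Prop :=
  [/\ Linfty (lebesgue_xt d) (QT T) u /\ CL1 T u,
      forall (k r : R) (phi : 'rV[R]_d * R -> R),
        0 < r -> test_fun T phi -> (forall p, 0 <= phi p) ->
        (0 <= \int[lebesgue_xt d]_(p in QT T)
                (entropy_integrand u k r phi p)%:E)%E
    & {ae lebesgue_rV d, forall x, u (x, 0) = u0 x}].

End entropy_solution.

Section scheme.
Context {R : realType} {d : nat}.

(* Sum of an absolutely summable family of reals. In the scheme the family is
   always summable, u0 being bounded and A Lipschitz. *)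
Definition sum_over (I : choiceType) (D : set I) (a : I -> R) : R :=
  fine (\esum_(i in D) (EFin \o a)^\+ i - \esum_(i in D) (EFin \o a)^\- i)%E.

(* The Lipschitz condition is for the l^1 norm on R^2, the weakest choice: it
   follows from the one for the Euclidean or sup norm with the same constant. *)
Definition numerical_flux (f : R -> 'rV[R]_d) (LF : R)
    (F : 'I_d -> R -> R -> R) : Prop :=
  forall l : 'I_d,
  [/\ forall a b a' b', `|F l a b - F l a' b'| <= LF * (`|a - a'| + `|b - b'|),
      forall a, F l a a = f a ord0 l,
      forall b, {homo (fun a => F l a b) : a a' / a <= a'}
    & forall a, {homo F l a : b b' / b <= b' >-> b' <= b}].

Variable Dx : R.

Definition grid (a : 'rV[int]_d) : 'rV[R]_d := \row_i (Dx * (a ord0 i)%:~R).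

(* x_a + R *)
Definition cell (a : 'rV[int]_d) : set 'rV[R]_d :=
  [set x | forall i, 0 <= (x - grid a) ord0 i < Dx].

(* x_a + R_0 *)
Definition centered_cell (a : 'rV[int]_d) : set 'rV[R]_d :=
  [set x | forall i, - (Dx / 2) <= (x - grid a) ord0 i < Dx / 2].

Definition Dminus (l : 'I_d) (V : 'rV[int]_d -> R) (a : 'rV[int]_d) : R :=
  (V a - V (a - 'e_l)) / Dx.

Definition weight (c lambda : R) (b : 'rV[int]_d) : R :=
  c * \int[lebesgue_rV d]_(z in centered_cell b) kernel lambda z.

Definition scheme_solution (c lambda Dt : R) (N : nat) (A : R -> R)
    (F : 'I_d -> R -> R -> R) (u0 : 'rV[R]_d -> R)
    (U : nat -> 'rV[int]_d -> R) : Prop :=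
  (forall a, U 0%N a = (Dx ^+ d)^-1 * \int[lebesgue_rV d]_(x in cell a) u0 x) /\
  (forall n a, (n < N)%N ->
    U n.+1 a = U n a
      - Dt * \sum_(l < d) Dminus l (fun b => F l (U n b) (U n (b + 'e_l))) a
      + Dt * sum_over [set b | b != 0]
               (fun b => weight c lambda b * (A (U n (a + b)) - A (U n a)))).

(* the value U n a on cell a x [t_n, t_(n+1)), see [interpolationE] *)
Definition interpolation (Dt : R) (U : nat -> 'rV[int]_d -> R)
    (p : 'rV[R]_d * R) : R :=
  U (Num.truncn (p.2 / Dt)) (\row_i Num.floor (p.1 ord0 i / Dx)).

Lemma interpolationE (Dt : R) U n a x t : 0 < Dx -> 0 < Dt ->
  cell a x -> n%:R * Dt <= t < n.+1%:R * Dt ->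
  interpolation Dt U (x, t) = U n a.
Proof.
move=> Dx0 Dt0 ax nt; rewrite /interpolation/=; congr (U _ _).
  by apply/truncn_def; rewrite ler_pdivlMr// ltr_pdivrMr.
apply/rowP => i; rewrite mxE; apply/floor_def.
have := ax i; rewrite !mxE subr_ge0 ltrBlDr => /andP[h1 h2].
rewrite ler_pdivlMr// ltr_pdivrMr// mulrC h1/=.
by rewrite intrD mulrDl mul1r addrC [X in _ + X]mulrC.
Qed.

(* LA is any Lipschitz constant of A. *)
Definition CFL (c lambda LF LA Dt : R) : Prop :=
  2 * d%:R * LF * (Dt / Dx)
  + c * 2 `^ lambda * LA
    * (\int[lebesgue_rV d]_(z in [set z | 1 < enorm z]) kernel lambda z)
    * (Dt / Dx `^ lambda) <= 1.

End scheme.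
Arguments CFL {R} d Dx c lambda LF LA Dt.

(* Main.v *)
Require Import Defs.
From HB Require Import structures.
From mathcomp Require Import all_boot all_order all_algebra.
From mathcomp Require Import all_classical all_reals all_analysis.
From mathcomp Require Import measurable_realfun ring lra.

(** The value at [(x, t)] of the interpolated solution [v] is related by the
    scheme, pointwise in the continuous variables, to its values at the
    translates of [x] by multiples of the grid size: the nonlocal sum is the
    integral of [A (v (x + rho z)) - A (v x)] against the kernel, where [rho]
    rounds [z] to the grid. Under the CFL condition one step of the scheme is
    monotone, which gives a discrete entropy inequality for [|v - k|], where the
    nonlocal term over [|z| > r] carries the sign of [v - k] at the next time
    level. Tested against [phi], with all translations moved to [phi], every
    term passes to the limit as a product of an L^1-convergent factor and a
    boundedly pointwise convergent one. Translates of [v j] are controlled by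
    those of [v J] for one fixed large [J], which is locally constant almost
    everywhere. The sign converges only away from the level set [u = k]; the
    inequality at [k] is the mean of those at [k - 2 delta] and [k + 2 delta],
    [delta --> 0], because [sgn 0 = 0]. If the Lipschitz constants of [A] and of
    the fluxes both vanish, the CFL condition does not force the time steps to
    0, but then [v] is constant in time and any time step will do. For the
    initial datum, the cell averages of [u0] are integrated over boxes. *)

Set Implicit Arguments.
Unset Strict Implicit.
Unset Printing Implicit Defensive.
Import Order.TTheory GRing.Theory Num.Theory.
Import numFieldNormedType.Exports.
Local Open Scope classical_set_scope.
Local Open Scope ring_scope.

(** The two halves of the nonlocal operator call for opposite treatments. Near the origin the kernel
    is not integrable, so the operator must fall on [phi], where averaging over z and - z produces
    second differences of order |z|^2; for majorants uniform in the grid size, rounding has to be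
    odd almost everywhere and to satisfy |round h z| <= 2 |z|. Far from the origin the entropy
    condition asks for sgn(u - k) g^r[A(u)], a smaller quantity than the g^r[|A(u) - A(k)|] that a
    comparison of max(u, k) with min(u, k) would give. Hence only the inner part enters the monotone
    step, and the outer part is kept exact through |w - k| = sgn(w - k) (w - k), w being the new
    value. A second obstacle is that the limit lemmas work with functions measurable and bounded
    everywhere, whereas [u] is known on Q_T up to null sets. They are applied to a truncation of
    [u], which has to agree with [u] not only almost everywhere in space-time but on almost all of
    every time slice, because the outer operator reads a whole slice. *)

Definition pushm d1 d2 (T1 : measurableType d1) (T2 : measurableType d2)
    (R : realType) (m : {measure set T1 -> \bar R}) (f : T1 -> T2)
    (mf : measurable_fun setT f) : {measure set T2 -> \bar R} :=
  @measure_function_pushforward__canonical__measure_function_Measure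
    _ _ _ _ _ m f mf.

(** * Lebesgue measure and real-valued integrals *)

Section lebesgue_rV_maps.
Context {R : realType}.
Local Notation leb := (@lebesgue_measure R).

Lemma measurable_box n (A : 'I_n -> set R) : (forall i, measurable (A i)) ->
  measurable [set x : 'rV[R]_n | forall i, A i (x ord0 i)].
Proof.
move=> mA; rewrite [X in measurable X](_ : _ = \bigcap_(i in [set: 'I_n])
    rV_coord i @^-1` A i).
  apply: fin_bigcap_measurable => //= i _.
  by rewrite -[X in measurable X]setTI; exact: measurable_rV_coord.
by apply/seteqP; split=> x /= H i; [move=> _|]; exact: H.
Qed.

(** Boxes with measurable sides are stable under intersection, they generate the sigma-algebra since
    a constraint on one coordinate is such a box, and the cubes [-k, k]^n exhaust the space with
    finite measure. *)
Lemma lebesgue_rV_unique n (m : {measure set 'rV[R]_n -> \bar R}) :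
  (forall A : 'I_n -> set R, (forall i, measurable (A i)) ->
    m [set x : 'rV[R]_n | forall i, A i (x ord0 i)] =
    (\prod_(i < n) leb (A i))%E) ->
  forall B, measurable B -> lebesgue_rV n B = m B.
Proof.
move=> mE B mB.
pose box (A : 'I_n -> set R) := [set x : 'rV[R]_n | forall i, A i (x ord0 i)].
pose G := [set C | exists2 A, (forall i, measurable (A i)) & C = box A].
have mG C : G C -> measurable C by move=> [A mA ->]; exact: measurable_box.
apply: (measure_unique G (fun k => box (fun=> `[- k%:R, k%:R]%classic))) => //.
- apply/seteqP; split => [C|]; last first.
    apply: smallest_sub; first exact: sigma_algebra_measurable.
    exact: mG.
  apply: smallest_sub; first exact: smallest_sigma_algebra.
  rewrite -bigcup_seq/= => C' [i _ [D mD <-]].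
  apply: sub_sigma_algebra; exists (fun j => if j == i then D else setT).
    by move=> j; case: ifP.
  rewrite setTI; apply/seteqP; split=> x /= => [Dx j|/(_ i)]; last by rewrite eqxx.
  by case: eqP => // ->.
- move=> _ _ [A mA ->] [A' mA' ->]; exists (fun i => A i `&` A' i).
    by move=> i; exact: measurableI.
  apply/seteqP; split=> x /= => [[h h'] i|h]; first by split.
  by split=> i; case: (h i).
- by move=> k; exists (fun=> `[- k%:R, k%:R]%classic).
- apply/seteqP; split=> // x _.
  exists (Num.truncn (\sum_i `|x ord0 i|)).+1 => // i.
  suff: `|x ord0 i| <= (Num.truncn (\sum_i `|x ord0 i|)).+1%:R.
    by rewrite ler_norml.
  apply: le_trans (ltW (truncnS_gt _)).
  by rewrite (bigD1 i)//= lerDl sumr_ge0.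
- by move=> _ [A mA ->]; rewrite /= (lebesgue_rV_box mA) mE.
- move=> k; rewrite /= lebesgue_rV_box//.
  pose I : set R := `[- k%:R, k%:R]%classic.
  suff : (\prod_(i < n) leb I)%E \is a fin_num.
    by rewrite fin_numE => /andP[_]; rewrite ltey.
  apply: (big_ind (fun x : \bar R => x \is a fin_num)) => // [x y|i _].
    exact: fin_numM.
  by rewrite /I lebesgue_measure_itv/=; case: ifP.
Qed.

Definition rV_map n (g : 'I_n -> R -> R) (x : 'rV[R]_n) : 'rV[R]_n :=
  \row_i g i (x ord0 i).

Lemma measurable_rV_map n (g : 'I_n -> R -> R) :
  (forall i, measurable_fun setT (g i)) -> measurable_fun setT (rV_map g).
Proof.
move=> mg; apply/measurable_fun_rVP => i.
rewrite (_ : _ \o _ = g i \o rV_coord i); last first.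
  by apply/funext => x; rewrite /= /rV_coord mxE.
by apply: measurableT_comp => //; exact: measurable_rV_coord.
Qed.

(** A map acting coordinate by coordinate pulls boxes back to boxes, so that a factor [k] per
    coordinate becomes [k ^+ n]. Translation, reflection and dilation are the instances used. *)
Lemma lebesgue_rV_map n (g : 'I_n -> R -> R) (k : R) : 0 <= k ->
  (forall i, measurable_fun setT (g i)) ->
  (forall i B, measurable B -> (k%:E * leb (g i @^-1` B) = leb B)%E) ->
  forall B, measurable B ->
    ((k ^+ n)%:E * lebesgue_rV n (rV_map g @^-1` B) = lebesgue_rV n B)%E.
Proof.
move=> k0 mg gk B mB.
have mT := measurable_rV_map mg.
have kn0 : 0 <= k ^+ n by rewrite exprn_ge0.
pose m := mscale (NngNum kn0) (pushm (lebesgue_rV n) mT).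
rewrite [RHS](@lebesgue_rV_unique _ m)// => A mA.
rewrite -[LHS]/((k ^+ n)%:E * lebesgue_rV n (rV_map g @^-1` _))%E.
rewrite (_ : _ @^-1` _ =
    [set x : 'rV[R]_n | forall i, (g i @^-1` A i) (x ord0 i)]); last first.
  apply/seteqP; split=> x /= => h i.
    by have := h i; rewrite mxE.
  by rewrite mxE; exact: h.
rewrite (@lebesgue_rV_box _ _ (fun i => g i @^-1` A i)); last first.
  by move=> i; rewrite -[X in measurable X]setTI; exact: mg.
rewrite [RHS](eq_bigr (fun i => k%:E * leb (g i @^-1` A i))%E); last first.
  by move=> i _; rewrite gk.
rewrite big_split/=; congr (_ * _)%E.
by rewrite -[in LHS](card_ord n) -prodr_const -prodEFin.
Qed.

Lemma lebesgue_measure_scale_shift (s y : R) : 0 < s -> forall B, measurable B ->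
  (s%:E * leb ((fun x : R => s * x + y)%R @^-1` B) = leb B)%E.
Proof.
move=> s0 B mB.
pose g (x : measurableTypeR R) : measurableTypeR R := s * x + y.
have mg : measurable_fun setT g.
  by apply: measurable_funD => //; exact: mulrl_measurable.
pose m := mscale (NngNum (ltW s0)) (pushm leb mg).
rewrite [RHS](@lebesgue_measure_unique _ m)// => _ [[a b] _ <-].
rewrite -[RHS]/(s%:E * leb (g @^-1` _))%E.
rewrite (_ : g @^-1` _ = `](a - y) / s, (b - y) / s]%classic); last first.
  apply/seteqP; split => x /=; rewrite !in_itv/= /g ltr_pdivrMr// ler_pdivlMr//;
  by rewrite ltrBlDr lerBrDr (mulrC x).
rewrite !lebesgue_measure_itv/= !lte_fin ltr_pM2r ?invr_gt0// ltrD2r.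
case: ifPn => ab; last by rewrite mule0.
rewrite -!EFinD -EFinM; congr EFin.
by rewrite -mulrBl mulrC mulrVK ?unitfE ?gt_eqF// opprB addrA subrK.
Qed.

Lemma measurable_affine (s y : R) : measurable_fun setT (fun x : R => s * x + y).
Proof. by apply: measurable_funD => //; exact: mulrl_measurable. Qed.

Lemma rV_map_shift n (y : 'rV[R]_n) :
  rV_map (fun i a => 1 * a + y ord0 i) = (fun x => x + y).
Proof. by apply/funext => x; apply/rowP => i; rewrite !mxE mul1r. Qed.

Lemma rV_map_opp n : rV_map (fun i : 'I_n => @GRing.opp R) = -%R.
Proof. by apply/funext => x; apply/rowP => i; rewrite !mxE. Qed.

Lemma rV_map_scale n (s : R) :
  rV_map (fun (i : 'I_n) a => s * a + 0) = (fun x => s *: x).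
Proof. by apply/funext => x; apply/rowP => i; rewrite !mxE addr0. Qed.

Lemma measurable_rV_shift n (y : 'rV[R]_n) :
  measurable_fun setT (fun x : 'rV[R]_n => x + y).
Proof.
rewrite -rV_map_shift; apply: measurable_rV_map => i; exact: measurable_affine.
Qed.

Lemma lebesgue_rV_shift n (y : 'rV[R]_n) B : measurable B ->
  lebesgue_rV n ((fun x => x + y)%R @^-1` B) = lebesgue_rV n B.
Proof.
move=> mB; rewrite -rV_map_shift.
rewrite -[RHS](@lebesgue_rV_map n (fun i a => 1 * a + y ord0 i) 1)//.
- by rewrite expr1n mul1e.
- by move=> i; exact: measurable_affine.
- by move=> i C mC; rewrite lebesgue_measure_scale_shift.
Qed.

Lemma measurable_rV_opp n : measurable_fun setT (@GRing.opp 'rV[R]_n).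
Proof.
rewrite -rV_map_opp; apply: measurable_rV_map => i.
exact: (@measurable_funN _ _ _ _ id).
Qed.

Lemma lebesgue_rV_opp n B : measurable B ->
  lebesgue_rV n ((@GRing.opp 'rV[R]_n) @^-1` B) = lebesgue_rV n B.
Proof.
move=> mB; rewrite -rV_map_opp.
rewrite -[RHS](@lebesgue_rV_map n (fun i : 'I_n => @GRing.opp R) 1)//.
- by rewrite expr1n mul1e.
- by move=> i C mC; rewrite mul1e; exact: lebesgue_measureN.
Qed.

Lemma measurable_rV_scale n (s : R) :
  measurable_fun setT (fun x : 'rV[R]_n => s *: x).
Proof.
rewrite -rV_map_scale; apply: measurable_rV_map => i; exact: measurable_affine.
Qed.

Lemma lebesgue_rV_scale n (s : R) (B : set 'rV[R]_n) : 0 < s -> measurable B ->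
  ((s ^+ n)%:E * lebesgue_rV n ((fun x => s *: x)%R @^-1` B) = lebesgue_rV n B)%E.
Proof.
move=> s0 mB; rewrite -rV_map_scale.
apply: lebesgue_rV_map => //; first exact: ltW.
- by move=> i; exact: measurable_affine.
- by move=> i C mC; rewrite lebesgue_measure_scale_shift.
Qed.

End lebesgue_rV_maps.

Section Rintegral_layer.
Context d (X : measurableType d) {R : realType} (mu : {measure set X -> \bar R}).
Implicit Types f g : X -> R.
Local Notation intg f := (mu.-integrable setT (EFin \o f)).

Lemma intg_le f g : measurable_fun setT f -> intg g ->
  (forall x, `|f x| <= g x) -> intg f.
Proof.
move=> mf ig fg; apply: (le_integrable measurableT _ _ ig).
  exact/measurable_EFinP.
by move=> x _ /=; rewrite lee_fin (le_trans (fg x))// ler_norm.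
Qed.

Lemma intg_measurable f : intg f -> measurable_fun setT f.
Proof. by move/measurable_int/measurable_EFinP. Qed.

Lemma intgD f g : intg f -> intg g -> intg (fun x => f x + g x).
Proof. by move=> fi gi; exact: (integrableD measurableT fi gi). Qed.

Lemma intgB f g : intg f -> intg g -> intg (fun x => f x - g x).
Proof. by move=> fi gi; exact: (integrableB measurableT fi gi). Qed.

Lemma intgZ f (k : R) : intg f -> intg (fun x => k * f x).
Proof. by move=> fi; exact: (integrableZl measurableT k fi). Qed.

Lemma intg_sum n (f : 'I_n -> X -> R) : (forall i, intg (f i)) ->
  intg (fun x => \sum_(i < n) f i x).
Proof.
move=> fi.
rewrite (_ : _ \o _ = fun x => (\sum_(i < n) (EFin \o f i) x)%E).
  exact: integrable_sum.
by apply/funext => x /=; rewrite sumEFin.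
Qed.

Lemma intg_norm f : intg f -> intg (fun x => `|f x|).
Proof. exact: integrable_norm. Qed.

Lemma RintD f g : intg f -> intg g ->
  \int[mu]_x (f x + g x) = \int[mu]_x f x + \int[mu]_x g x.
Proof. exact: RintegralD. Qed.

Lemma RintB f g : intg f -> intg g ->
  \int[mu]_x (f x - g x) = \int[mu]_x f x - \int[mu]_x g x.
Proof. exact: RintegralB. Qed.

Lemma RintZ f (k : R) : intg f -> \int[mu]_x (k * f x) = k * \int[mu]_x f x.
Proof. exact: RintegralZl. Qed.

Lemma Rint_sum n (f : 'I_n -> X -> R) : (forall i, intg (f i)) ->
  \int[mu]_x (\sum_(i < n) f i x) = \sum_(i < n) \int[mu]_x f i x.
Proof.
elim: n f => [|n IH] f fi.
  rewrite big_ord0; under eq_Rintegral do rewrite big_ord0.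
  by rewrite Rintegral_cst// mul0r.
rewrite big_ord_recl -IH// -RintD//; last exact: intg_sum.
by apply: eq_Rintegral => x _; rewrite big_ord_recl.
Qed.

Lemma le_Rint f g : intg f -> intg g -> (forall x, f x <= g x) ->
  \int[mu]_x f x <= \int[mu]_x g x.
Proof. by move=> fi gi fg; apply: le_Rintegral. Qed.

Lemma ler_norm_Rint f g : intg f -> intg g -> (forall x, `|f x| <= g x) ->
  `|\int[mu]_x f x| <= \int[mu]_x g x.
Proof.
move=> fi gi fg; apply: le_trans (le_normr_Rintegral _ fi) _ => //.
by apply: le_Rint => //; exact: intg_norm.
Qed.

Lemma eq_Rint_ae f g : measurable_fun setT f -> measurable_fun setT g ->
  {ae mu, forall x, f x = g x} -> \int[mu]_x f x = \int[mu]_x g x.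
Proof.
move=> mf mg fg; congr fine; apply: ae_eq_integral => //;
  [exact/measurable_EFinP..|].
by apply: filterS fg => x -> _.
Qed.

Lemma cvg_Rint (f_ : nat -> X -> R) f g :
  (forall n, measurable_fun setT (f_ n)) -> measurable_fun setT f ->
  {ae mu, forall x, f_ n x @[n --> \oo] --> f x} -> intg g ->
  (forall n x, `|f_ n x| <= g x) ->
  \int[mu]_x f_ n x @[n --> \oo] --> \int[mu]_x f x.
Proof.
move=> mf_ mf f_f gi fg.
have [|||||fi _ h] := @dominated_convergence _ _ _ mu _ measurableT
  (fun n => EFin \o f_ n) (EFin \o f) (EFin \o g) => //.
- by move=> n; exact/measurable_EFinP.
- exact/measurable_EFinP.
- by apply: filterS f_f => x h _; apply: cvg_EFin => //; exact: nearW.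
- by apply: aeW => x n _ /=; rewrite lee_fin.
- apply: fine_cvg; rewrite fineK; first exact: h.
  exact: integrable_fin_num.
Qed.

Lemma intg_indic (D : set X) : measurable D -> (mu D < +oo)%E ->
  intg (\1_D : X -> R).
Proof.
move=> mD muD; apply/integrableP; split; first exact/measurable_EFinP.
rewrite (eq_integral (fun x => (\1_D x)%:E)); last first.
  by move=> t _; rewrite gee0_abs// lee_fin.
by rewrite integral_indic// setIT.
Qed.

Lemma intg_bounded_support f (D : set X) (C : R) : measurable D ->
  (mu D < +oo)%E -> measurable_fun setT f -> (forall x, `|f x| <= C) ->
  (forall x, ~ D x -> f x = 0) -> intg f.
Proof.
move=> mD muD mf fC f0.
apply: (@intg_le _ (fun x => C * \1_D x)) => //.
  apply: (@intgZ (\1_D)).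
  exact: intg_indic.
move=> x; have [Dx|nDx] := pselect (D x).
  by rewrite indicE mem_set// mulr1.
by rewrite f0// normr0 indicE memNset// mulr0.
Qed.

(** Positive and negative parts are transported separately, so that the identity holds in the
    extended reals. *)
Lemma integral_map (T : X -> X) (f : X -> \bar R) : measurable_fun setT T ->
  (forall B, measurable B -> mu (T @^-1` B) = mu B) ->
  measurable_fun setT f -> (\int[mu]_x f (T x) = \int[mu]_x f x)%E.
Proof.
move=> mT Tmu mf.
have h (g : X -> \bar R) : measurable_fun setT g -> (forall x, 0 <= g x)%E ->
    (\int[mu]_x g (T x) = \int[mu]_x g x)%E.
  move=> mg g0.
  have := @ge0_integral_pushforward _ _ X X _ T mT mu setT g measurableT mg.
  rewrite preimage_setT => <- //.
  by apply: eq_measure_integral => B mB _; exact: Tmu.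
rewrite integralE [in RHS]integralE; congr (_ - _)%E.
  rewrite -(h f^\+%E) //; last exact: measurable_funepos.
  by apply: eq_integral => x _; rewrite (funepos_comp f T).
rewrite -(h f^\-%E) //; last exact: measurable_funeneg.
by apply: eq_integral => x _; rewrite (funeneg_comp f T).
Qed.

Lemma Rint_map (T : X -> X) f : measurable_fun setT T ->
  (forall B, measurable B -> mu (T @^-1` B) = mu B) ->
  measurable_fun setT f -> \int[mu]_x f (T x) = \int[mu]_x f x.
Proof.
move=> mT Tmu mf; congr fine; apply: (integral_map mT Tmu (f := EFin \o f)).
exact/measurable_EFinP.
Qed.

Lemma intg_map (T : X -> X) f : measurable_fun setT T ->
  (forall B, measurable B -> mu (T @^-1` B) = mu B) ->
  intg f -> intg (fun x => f (T x)).
Proof.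
move=> mT Tmu /integrableP[mf fi]; apply/integrableP; split.
  exact: (measurableT_comp mf mT).
rewrite (integral_map mT Tmu (f := fun x => `|(f x)%:E|%E))//.
exact: measurableT_comp.
Qed.

End Rintegral_layer.

Section Rintegral_product.
Context d1 d2 (X : measurableType d1) (Y : measurableType d2) {R : realType}.
Variables (m1 : {sigma_finite_measure set X -> \bar R})
  (m2 : {sigma_finite_measure set Y -> \bar R}).
Implicit Types f : X * Y -> R.

Lemma measurable_Rint f : measurable_fun setT f ->
  measurable_fun setT (fun x => \int[m2]_y f (x, y)).
Proof.
move=> mf; apply: measurableT_comp => //.
have mEf : measurable_fun setT (EFin \o f) by exact/measurable_EFinP.
rewrite (_ : (fun _ => _) = (fun x => \int[m2]_y (EFin \o f)^\+ (x, y) -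
   \int[m2]_y (EFin \o f)^\- (x, y))%E); last first.
  apply/funext => x; rewrite integralE; congr (_ - _)%E;
    by apply: eq_integral => y _; rewrite ?funeposE ?funenegE.
apply: emeasurable_funB.
  apply: (measurable_fun_fubini_tonelli_F (EFin \o f)^\+%E) => //.
  exact: measurable_funepos.
apply: (measurable_fun_fubini_tonelli_F (EFin \o f)^\-%E) => //.
exact: measurable_funeneg.
Qed.

Lemma Rint_fubini1 f : (m1 \x m2)%E.-integrable setT (EFin \o f) ->
  \int[m1]_x \int[m2]_y f (x, y) = \int[(m1 \x m2)%E]_p f p.
Proof.
move=> fi; have mf := intg_measurable fi.
congr fine; rewrite -(integral12_prod_meas1 fi).
(* A real-valued inner integral is [fine] of the extended one; the two agree where the section is
   integrable, that is almost everywhere. *)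
apply: ae_eq_integral => //.
- by apply/measurable_EFinP; exact: measurable_Rint.
- exact: (measurable_fubini_F fi).
- apply: filterS (ae_integrable1 fi) => x h _ /=.
  rewrite /Rintegral fineK//; exact: integrable_fin_num.
Qed.

Lemma measurable_Rint2 f : measurable_fun setT f ->
  measurable_fun setT (fun y => \int[m1]_x f (x, y)).
Proof.
move=> mf; apply: measurableT_comp => //.
have mEf : measurable_fun setT (EFin \o f) by exact/measurable_EFinP.
rewrite (_ : (fun _ => _) = (fun y => \int[m1]_x (EFin \o f)^\+ (x, y) -
   \int[m1]_x (EFin \o f)^\- (x, y))%E); last first.
  apply/funext => x; rewrite integralE; congr (_ - _)%E;
    by apply: eq_integral => y _; rewrite ?funeposE ?funenegE.
apply: emeasurable_funB.
  apply: (measurable_fun_fubini_tonelli_G (EFin \o f)^\+%E) => //.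
  exact: measurable_funepos.
apply: (measurable_fun_fubini_tonelli_G (EFin \o f)^\-%E) => //.
exact: measurable_funeneg.
Qed.

Lemma Rint_fubini2 f : (m1 \x m2)%E.-integrable setT (EFin \o f) ->
  \int[m2]_y \int[m1]_x f (x, y) = \int[(m1 \x m2)%E]_p f p.
Proof.
move=> fi; have mf := intg_measurable fi.
congr fine; rewrite -(integral21_prod_meas1 fi).
apply: ae_eq_integral => //.
- by apply/measurable_EFinP; exact: measurable_Rint2.
- exact: (measurable_fubini_G fi).
- apply: filterS (ae_integrable2 fi) => x h _ /=.
  rewrite /Rintegral fineK//; exact: integrable_fin_num.
Qed.

Lemma Rint_fubini f : (m1 \x m2)%E.-integrable setT (EFin \o f) ->
  \int[m1]_x \int[m2]_y f (x, y) = \int[m2]_y \int[m1]_x f (x, y).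
Proof. by move=> fi; rewrite Rint_fubini1// Rint_fubini2. Qed.

Lemma intg_prod1 f : (m1 \x m2)%E.-integrable setT (EFin \o f) ->
  m1.-integrable setT (EFin \o (fun x => \int[m2]_y f (x, y))).
Proof.
move=> fi; have mf := intg_measurable fi.
have [N [mN N0 hN]] := ae_integrable1 fi.
have := integrable_fubini_F fi; move=> /integrableP[mF Fi].
apply/integrableP; split; first by apply/measurable_EFinP; exact: measurable_Rint.
apply: le_lt_trans Fi; apply: ge0_le_integral => //.
- by apply: measurableT_comp => //; apply/measurable_EFinP; exact: measurable_Rint.
- exact: measurableT_comp.
(* Where the extended inner integral is infinite its real-valued version is 0, so the domination
   holds at every point. *)
- move=> x _ /=; rewrite /fubini_F /Rintegral; case: (integral _ _ _) => //= *;
    by rewrite normr0 leey.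
Qed.

(* Tonelli's criterion, with the inner integral bounded by an integrable
   function. *)
Lemma intg_prod_dom f (g : Y -> R) : measurable_fun setT f ->
  (forall y, m1.-integrable setT (EFin \o (fun x => f (x, y)))) ->
  m2.-integrable setT (EFin \o g) ->
  (forall y, \int[m1]_x `|f (x, y)| <= g y) ->
  (m1 \x m2)%E.-integrable setT (EFin \o f).
Proof.
move=> mf fi gi fg.
have mEf : measurable_fun setT (EFin \o f) by exact/measurable_EFinP.
apply/(integrable21ltyP _ _ mEf).
case/integrableP : gi => mg; apply: le_lt_trans.
apply: ge0_le_integral => //.
- by move=> y _; exact: integral_ge0.
- apply: (measurable_fun_fubini_tonelli_G (abse \o (EFin \o f))).
    exact: measurableT_comp.
  by move=> x; exact: abse_ge0.
- exact: measurableT_comp.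
- move=> y _ /=; apply: (@le_trans _ _ (g y)%:E).
    have := fg y; rewrite -lee_fin; apply: le_trans.
    rewrite /Rintegral fineK//.
    apply: integrable_fin_num => //; exact: (intg_norm (fi y)).
  by rewrite lee_fin ler_norm.
Qed.

Lemma intg_prod_mul (a : X -> R) (b : Y -> R) f : measurable_fun setT f ->
  m1.-integrable setT (EFin \o a) -> m2.-integrable setT (EFin \o b) ->
  (forall x y, `|f (x, y)| <= a x * b y) ->
  (m1 \x m2)%E.-integrable setT (EFin \o f).
Proof.
move=> mf ai bi fab.
have mfy y : measurable_fun setT (fun x => f (x, y)).
  by apply: (measurableT_comp mf); exact: measurable_pair2.
have fi y : m1.-integrable setT (EFin \o (fun x => f (x, y))).
  apply: (@intg_le _ _ _ _ _ (fun x => b y * a x)) => //; first exact: intgZ.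
  by move=> x; rewrite mulrC.
apply: (@intg_prod_dom _ (fun y => (\int[m1]_x a x) * b y)) => //.
  exact: intgZ.
move=> y; rewrite mulrC -RintZ//; apply: le_Rint.
- exact: intg_norm.
- exact: intgZ.
- by move=> x; rewrite mulrC.
Qed.

End Rintegral_product.

Lemma measurable_boolR d (X : measurableType d) (R : realType) (b : X -> bool) :
  measurable_fun setT b -> measurable_fun setT (fun x => (b x)%:R : R).
Proof.
move=> mb; rewrite (_ : (fun _ => _) = fun x => if b x then 1 else 0).
  exact: measurable_fun_ifT.
by apply/funext => x; case: (b x).
Qed.

Lemma gt1_ltr_powR (R : realType) (a x y : R) : 1 < a -> x < y ->
  a `^ x < a `^ y.
Proof.
move=> a1 xy; have a0 : a != 0 by rewrite gt_eqF// (lt_trans _ a1).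
by rewrite /powR (negbTE a0) ltr_expR ltr_pM2r// ln_gt0.
Qed.

Section euclidean_norm.
Context {R : realType} {d : nat}.
Implicit Types z : 'rV[R]_d.

Lemma enorm_ge0 z : 0 <= enorm z. Proof. exact: sqrtr_ge0. Qed.

Lemma sum_sqr_ge0 z : 0 <= \sum_(i < d) z ord0 i ^+ 2.
Proof. by apply: sumr_ge0 => i _; exact: sqr_ge0. Qed.

Lemma sqr_enorm z : enorm z ^+ 2 = \sum_(i < d) z ord0 i ^+ 2.
Proof. by rewrite sqr_sqrtr// sum_sqr_ge0. Qed.

Lemma enormZ (s : R) z : enorm (s *: z) = `|s| * enorm z.
Proof.
rewrite /enorm -sqrtr_sqr -sqrtrM ?sqr_ge0//; congr Num.sqrt.
by rewrite mulr_sumr; apply: eq_bigr => i _; rewrite mxE exprMn.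
Qed.

Lemma enormN z : enorm (- z) = enorm z.
Proof. by rewrite -scaleN1r enormZ normrN1 mul1r. Qed.

Lemma coord_le_enorm z i : `|z ord0 i| <= enorm z.
Proof.
rewrite -sqrtr_sqr ler_wsqrtr// (bigD1 i)//= lerDl.
by apply: sumr_ge0 => j _; exact: sqr_ge0.
Qed.

Lemma le_enorm (c : R) (x y : 'rV[R]_d) : 0 <= c ->
  (forall i, `|x ord0 i| <= c * `|y ord0 i|) -> enorm x <= c * enorm y.
Proof.
move=> c0 xy; rewrite -[c in _ <= c * _]ger0_norm// -enormZ.
apply: ler_wsqrtr; apply: ler_sum => i _.
rewrite mxE -[leLHS](real_normK (num_real _)) -[leRHS](real_normK (num_real _)).
by rewrite lerXn2r ?nnegrE// normrM (ger0_norm c0).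
Qed.

Lemma enorm_eq0 z : enorm z = 0 -> z = 0.
Proof.
move=> z0; apply/rowP => i; rewrite mxE; apply/eqP.
by rewrite -normr_le0 -z0 coord_le_enorm.
Qed.

Lemma enorm_le_sum z : enorm z <= \sum_(i < d) `|z ord0 i|.
Proof.
have s0 : 0 <= \sum_(i < d) `|z ord0 i| by apply: sumr_ge0.
rewrite -(ger0_norm s0) -sqrtr_sqr; apply: ler_wsqrtr.
rewrite expr2 mulr_suml; apply: ler_sum => i _.
rewrite -[leLHS]ger0_norm ?sqr_ge0// normrX expr2 ler_wpM2l//.
by rewrite (bigD1 i)//= lerDl sumr_ge0.
Qed.

Lemma measurable_enorm : measurable_fun setT (@enorm R d).
Proof.
rewrite (_ : enorm = fun z => (\sum_(i < d) z ord0 i ^+ 2) `^ (2^-1)); last first.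
  by apply/funext => z; rewrite powR12_sqrt// sum_sqr_ge0.
apply: (measurableT_comp (measurable_powR _)).
apply: measurable_sum => i; apply: measurable_funX.
exact: measurable_rV_coord.
Qed.

End euclidean_norm.

(** * The kernel *)

Section kernel_integrals.
Context {R : realType} {d : nat} (lambda : R).
Hypotheses (hlambda : 0 < lambda < 2).
Implicit Types z : 'rV[R]_d.
Local Notation mu := (@lebesgue_rV R d).
Local Notation K := (@Defs.kernel R d lambda).
Local Notation p := (d%:R + lambda).

Let l0 : 0 < lambda. Proof. by case/andP : hlambda. Qed.
Let p0 : 0 < p. Proof. by rewrite ltr_wpDl. Qed.

Lemma kernel_ge0 z : 0 <= K z.
Proof. by rewrite invr_ge0 powR_ge0. Qed.

Lemma kernelN z : K (- z) = K z.
Proof. by rewrite /Defs.kernel enormN. Qed.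

Lemma kernelZ (s : R) z : 0 < s -> K (s *: z) = (s `^ p)^-1 * K z.
Proof.
move=> s0; rewrite /Defs.kernel enormZ gtr0_norm// powRM ?enorm_ge0 ?(ltW s0)//.
by rewrite invfM.
Qed.

Lemma measurable_kernel : measurable_fun setT K.
Proof.
rewrite (_ : K = fun z => enorm z `^ (- p)).
  exact: (measurableT_comp (measurable_powR _) measurable_enorm).
by apply/funext => z; rewrite powRN.
Qed.

Lemma kernel_le (a : R) z : 0 < a -> a <= enorm z -> K z <= (a `^ p)^-1.
Proof.
move=> a0 az; rewrite lef_pV2 ?posrE ?powR_gt0//; last exact: lt_le_trans az.
apply: ge0_ler_powR => //; [exact: ltW|rewrite nnegrE ltW//|].
by rewrite nnegrE enorm_ge0.
Qed.

Lemma measurable_ball_enorm (r : R) : measurable [set z : 'rV[R]_d | enorm z <= r].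
Proof.
rewrite -[X in measurable X]setTI.
by apply: measurable_fun_ler => //; exact: measurable_enorm.
Qed.

Lemma lebesgue_ball_enorm (r : R) : 0 <= r ->
  (mu [set z : 'rV[R]_d | (enorm z <= r)%R] <= ((2 * r) ^+ d)%:E)%E.
Proof.
move=> r0; pose I : set R := `[- r, r]%classic.
apply: (@le_trans _ _ (mu [set z | forall i, I (z ord0 i)])).
  apply: le_measure; rewrite ?inE.
  - exact: measurable_ball_enorm.
  - apply: (@measurable_box _ _ (fun=> I)) => i; exact: measurable_itv.
  - move=> z /= zr i; rewrite /I/= in_itv/= -ler_norml.
    apply: le_trans zr; exact: coord_le_enorm.
rewrite (@lebesgue_rV_box _ _ (fun=> I)); last by move=> i; exact: measurable_itv.
rewrite -[in leRHS](card_ord d) -prodr_const -prodEFin.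
rewrite (eq_bigr (fun=> (2 * r)%:E))// => i _.
rewrite /I lebesgue_measure_itv/= lte_fin; case: ltP => rr.
  by rewrite -EFinD opprK mulr_natl mulr2n.
suff -> : r = 0 by rewrite mulr0.
by apply/eqP; rewrite eq_le r0 andbT -(ler_pMn2r (n := 2))// mul0rn mulr2n -lerBrDr sub0r.
Qed.

(** [g] is at most the sum over m of [a m] times the indicator of the ball of radius [rho m], and a
    ball lies in a cube of volume (2 rho)^d; a geometric series then bounds the integral. The radii
    may grow or shrink, which serves both ends of the kernel. *)
Lemma intg_shells (g : 'rV[R]_d -> R) (a rho : nat -> R) (C q : R) :
  measurable_fun setT g -> (forall z, 0 <= g z) ->
  (forall m, 0 <= a m) -> (forall m, 0 <= rho m) ->
  (forall z, g z != 0 -> exists2 m, enorm z <= rho m & g z <= a m) ->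
  0 <= C -> 0 < q < 1 ->
  (forall m, a m * (2 * rho m) ^+ d <= C * q ^+ m) ->
  mu.-integrable setT (EFin \o g).
Proof.
move=> mg g0 a0 rho0 ga C0 /andP[q0 q1] aq.
apply/integrableP; split; first exact/measurable_EFinP.
pose B m := [set z : 'rV[R]_d | enorm z <= rho m].
have mB m : measurable (B m) by exact: measurable_ball_enorm.
pose f m z : \bar R := (a m * \1_(B m) z)%:E.
have f0 m z : (0 <= f m z)%E by rewrite lee_fin mulr_ge0.
have mf m : measurable_fun setT (f m).
  by apply/measurable_EFinP; apply: measurable_funM => //; exact: measurable_indic.
apply: (@le_lt_trans _ _ (\int[mu]_z (\sum_(m <oo) f m z))%E).
  apply: ge0_le_integral => //=.
  - apply/measurable_EFinP; exact: measurableT_comp.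
  - exact: (@ge0_emeasurable_sum _ _ _ _ f xpredT).
  - move=> z _; rewrite ger0_norm//.
    have [->|/ga [m zm gm]] := eqVneq (g z) 0; first exact: nneseries_ge0.
    rewrite (nneseriesD1 (n := m))//.
    apply: (@le_trans _ _ (f m z)); last by rewrite leeDl// nneseries_ge0.
    by rewrite /f lee_fin indicE mem_set// mulr1.
rewrite integral_nneseries//.
apply: (@le_lt_trans _ _ (\sum_(m <oo) (geometric C q m)%:E)%E).
  apply: lee_nneseries => [m _ _|m _]; first exact: integral_ge0.
  rewrite /f (eq_integral (fun z => (a m)%:E * (\1_(B m) z)%:E)%E); last first.
    by move=> z _; rewrite EFinM.
  rewrite ge0_integralZl_EFin//; last first.
    by apply/measurable_EFinP; exact: measurable_indic.
  rewrite integral_indic// setIT.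
  apply: (@le_trans _ _ ((a m)%:E * ((2 * rho m) ^+ d)%:E)%E).
    by apply: lee_wpmul2l; [rewrite lee_fin|exact: lebesgue_ball_enorm].
  by rewrite -EFinM lee_fin; exact: aq.
apply: (@le_lt_trans _ _ (C / (1 - q))%:E); last by rewrite ltry.
apply: lime_le.
  apply: is_cvg_nneseries => m _ _; rewrite lee_fin mulr_ge0//.
  by rewrite exprn_ge0// ltW.
apply: nearW => n; rewrite sumEFin lee_fin.
by apply: geometric_le_lim => //; rewrite gtr0_norm.
Qed.

Lemma powR_exprn (x s : R) m : 0 <= x -> (x ^+ m) `^ s = (x `^ s) ^+ m.
Proof.
move=> x0; rewrite -(powR_mulrn m x0) -(powR_mulrn m (powR_ge0 x s)).
by rewrite -!powRrM mulrC.
Qed.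

Let theta : R := 2 `^ p.
Let theta0 : 0 < theta. Proof. by rewrite powR_gt0. Qed.
Let thetaE : theta = 2 ^+ d * 2 `^ lambda.
Proof. by rewrite /theta powRD ?pnatr_eq0 ?implybT// powR_mulrn. Qed.

(** On the shell 2^m <= |z| <= 2^(m+1) the kernel is at most 2^(-m(d+lambda)) and the volume at most
    4^d 2^(dm); the ratio 2^(-lambda) is below 1 because lambda > 0. *)
Lemma intg_kernel_outer :
  mu.-integrable setT (EFin \o (fun z => (1 <= enorm z)%R%:R * K z)).
Proof.
pose q : R := (2 `^ lambda)^-1.
apply: (@intg_shells _ (fun m => (theta ^+ m)^-1) (fun m => 2 ^+ m.+1) (4 ^+ d) q).
- apply: measurable_funM; last exact: measurable_kernel.
  apply: measurable_boolR; apply: measurable_fun_ler => //.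
  exact: measurable_enorm.
- by move=> z; rewrite mulr_ge0 ?kernel_ge0.
- by move=> m; rewrite invr_ge0 exprn_ge0// ltW.
- by move=> m; rewrite exprn_ge0.
- move=> z.
  have [z1|] := lerP 1 (enorm z); last by rewrite mul0r eqxx.
  move=> _.
  have ex : exists m, (enorm z <= 2 ^+ m)%R.
    exists (Num.truncn (enorm z)).+1; apply: (le_trans (ltW (truncnS_gt _))).
    by rewrite -natrX ler_nat ltnW// ltn_expl.
  (* Minimality of the exponent gives the lower bound on |z| that [kernel_le] needs. Exponent 0
     means |z| = 1, which is put into the first shell. *)
  case: (ex_minnP ex) => -[|m] zm mmin.
    exists 0%N; first by rewrite (le_trans zm)// expr0 expr1 ler1n.
    rewrite expr0 invr1 mul1r (le_trans (kernel_le _ z1))//.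
    by rewrite powR1 invr1.
  exists m => //; rewrite mul1r /theta -powR_exprn//.
  apply: kernel_le; first by rewrite exprn_gt0.
  rewrite leNgt; apply/negP => /ltW /mmin; by rewrite ltnn.
- by rewrite exprn_ge0.
- rewrite invr_gt0 powR_gt0//= invf_lt1 ?powR_gt0//.
  by rewrite -[ltLHS](powRr0 2) gt1_ltr_powR ?ltr1n.
- move=> m; rewrite le_eqVlt; apply/orP; left; apply/eqP.
  have -> : (2 * 2 ^+ m.+1) ^+ d = 4 ^+ d * 2 ^+ (d * m) :> R.
    by rewrite exprS mulrA exprMn -exprM mulnC -natrM.
  rewrite thetaE exprMn -exprM /q exprVn.
  have h2 : (2 : R) ^+ (d * m) != 0 by rewrite expf_neq0 ?pnatr_eq0.
  have hl : ((2 : R) `^ lambda) ^+ m != 0 by rewrite expf_neq0// gt_eqF// powR_gt0.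
  by field; rewrite h2 hl.
Qed.

(** On the shell 2^(-m-1) < |z| <= 2^(-m) the integrand is at most 4^(-m) 2^((m+1)(d+lambda)) and
    the volume at most 2^d 2^(-dm); the ratio 2^lambda / 4 is below 1 because lambda < 2. *)
Lemma intg_kernel_inner : mu.-integrable setT
  (EFin \o (fun z => (enorm z <= 1)%R%:R * (enorm z ^+ 2 * K z))).
Proof.
pose q : R := 2 `^ lambda / 4.
apply: (@intg_shells _ (fun m => (4 ^+ m)^-1 * theta ^+ m.+1)
  (fun m => (2 ^+ m)^-1) (theta * 2 ^+ d) q).
- apply: measurable_funM.
    apply: measurable_boolR; apply: measurable_fun_ler => //.
    exact: measurable_enorm.
  apply: measurable_funM; last exact: measurable_kernel.
  by apply: measurable_funX; exact: measurable_enorm.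
- by move=> z; rewrite mulr_ge0 ?mulr_ge0 ?kernel_ge0 ?exprn_ge0 ?enorm_ge0.
- by move=> m; rewrite mulr_ge0// ?invr_ge0 exprn_ge0// ltW.
- by move=> m; rewrite invr_ge0 exprn_ge0.
- move=> z.
  have [z1|] := lerP (enorm z) 1; last by rewrite mul0r eqxx.
  rewrite mul1r => gz.
  have z0 : 0 < enorm z.
    rewrite lt0r enorm_ge0 andbT; apply: contra_neq gz => ->.
    by rewrite expr0n mul0r.
  have ex : exists m, ((2 ^+ m)^-1 < enorm z)%R.
    exists (Num.truncn (enorm z)^-1).+1.
    rewrite -[ltRHS]invrK ltf_pV2 ?posrE ?invr_gt0 ?exprn_gt0//.
    apply: (lt_le_trans (truncnS_gt _)).
    by rewrite -natrX ler_nat ltnW// ltn_expl.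
  case: (ex_minnP ex) => -[|m] zm mmin.
    by move: zm; rewrite expr0 invr1 ltNge z1.
  have zm' : enorm z <= (2 ^+ m)^-1.
    by rewrite leNgt; apply/negP => /mmin; rewrite ltnn.
  exists m => //; apply: ler_pM.
  + by rewrite exprn_ge0 ?enorm_ge0.
  + exact: kernel_ge0.
  + apply: (@le_trans _ _ ((2 ^+ m)^-1 ^+ 2)).
      by rewrite lerXn2r ?nnegrE ?enorm_ge0// invr_ge0 exprn_ge0.
    by rewrite exprVn -exprM mulnC exprM -natrX.
  + have -> : theta ^+ m.+1 = ((2 ^+ m.+1)^-1 `^ p)^-1.
      rewrite -[(2 ^+ m.+1)^-1]powR_inv1 ?exprn_ge0// -powRrM mulN1r powRN invrK.
      by rewrite powR_exprn.
    by apply: kernel_le; [rewrite invr_gt0 exprn_gt0|exact: ltW].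
- by rewrite mulr_ge0 ?exprn_ge0// ltW.
- rewrite divr_gt0 ?powR_gt0//= ltr_pdivrMr// mul1r.
  have -> : 4 = 2 `^ 2%:R :> R by rewrite powR_mulrn// -natrX.
  by rewrite gt1_ltr_powR ?ltr1n//; case/andP : hlambda.
- move=> m; rewrite le_eqVlt; apply/orP; left; apply/eqP.
  have -> : (2 * (2 ^+ m)^-1) ^+ d = 2 ^+ d * (2 ^+ (d * m))^-1 :> R.
    by rewrite exprMn exprVn -exprM mulnC.
  have -> : theta ^+ m.+1 = theta * (2 ^+ (d * m) * (2 `^ lambda) ^+ m).
    by rewrite exprS {2}thetaE exprMn -exprM.
  rewrite /q exprMn exprVn.
  have h2 : (2 : R) ^+ (d * m) != 0 by rewrite expf_neq0 ?pnatr_eq0.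
  have h4 : (4 : R) ^+ m != 0 by rewrite expf_neq0 ?pnatr_eq0.
  by field; rewrite h4 h2.
Qed.

(** The density of the Lévy measure with its usual cutoff. It bounds the kernel away from 0 and
    |z|^2 times the kernel on bounded sets, up to constants, and the integrability of all kernels
    below is deduced from it. *)
Definition levy z : R := Num.min 1 (enorm z ^+ 2) * K z.

Lemma levy_ge0 z : 0 <= levy z.
Proof.
by rewrite mulr_ge0 ?kernel_ge0// le_min ler01 exprn_ge0 ?enorm_ge0.
Qed.

Lemma intg_levy : mu.-integrable setT (EFin \o levy).
Proof.
apply: (intg_le _ (intgD intg_kernel_outer intg_kernel_inner)).
  apply: measurable_funM; last exact: measurable_kernel.
  apply: measurable_minr => //; apply: measurable_funX.
  exact: measurable_enorm.
move=> z; rewrite ger0_norm ?levy_ge0// /levy.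
have [z1|z1] := lerP 1 (enorm z).
  rewrite mul1r; apply: (@le_trans _ _ (K z)).
    by rewrite ler_piMl ?kernel_ge0// ge_min lexx.
  by rewrite lerDl mulr_ge0// mulr_ge0 ?kernel_ge0 ?exprn_ge0 ?enorm_ge0.
rewrite mul0r add0r (ltW z1) mul1r ler_wpM2r ?kernel_ge0//.
by rewrite ge_min lexx orbT.
Qed.

Lemma kernel_le_levy (rho : R) z : 0 < rho -> rho <= enorm z ->
  K z <= (Num.min 1 (rho ^+ 2))^-1 * levy z.
Proof.
move=> rho0 rz.
have m0 : 0 < Num.min 1 (rho ^+ 2) by rewrite lt_min ltr01 exprn_gt0.
rewrite ler_pdivlMl// /levy ler_wpM2r ?kernel_ge0//.
rewrite le_min !ge_min lexx/=; apply/orP; right.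
by rewrite lerXn2r ?nnegrE ?enorm_ge0// ltW.
Qed.

Lemma sqr_kernel_le_levy (r : R) z : enorm z <= r ->
  enorm z ^+ 2 * K z <= (1 + r ^+ 2) * levy z.
Proof.
move=> zr; rewrite /levy mulrA ler_wpM2r ?kernel_ge0//.
have z0 := enorm_ge0 z; have r0 := le_trans z0 zr.
have zr2 : enorm z ^+ 2 <= r ^+ 2 by rewrite lerXn2r ?nnegrE.
rewrite /Num.min; case: ifPn => _.
  by rewrite mulr1 (le_trans zr2)// lerDr.
by rewrite ler_peMl ?exprn_ge0// lerDl exprn_ge0.
Qed.

End kernel_integrals.

Section kernel_scaling.
Context {R : realType} {d : nat} (lambda : R).
Hypotheses (hlambda : 0 < lambda < 2).
Implicit Types z : 'rV[R]_d.
Local Notation mu := (@lebesgue_rV R d).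
Local Notation K := (@Defs.kernel R d lambda).
Local Notation p := (d%:R + lambda).

Let l0 : 0 < lambda. Proof. by case/andP : hlambda. Qed.

Lemma Rint_scale (s : R) (f : 'rV[R]_d -> R) : 0 < s ->
  measurable_fun setT f -> (forall z, 0 <= f z) ->
  s ^+ d * \int[mu]_z f (s *: z) = \int[mu]_z f z.
Proof.
move=> s0 mf f0; have mT := @measurable_rV_scale R d s.
have sd0 : 0 <= s ^+ d by rewrite exprn_ge0// ltW.
have mEf : measurable_fun setT (EFin \o f) by exact/measurable_EFinP.
have E : (\int[mu]_z (f z)%:E = (s ^+ d)%:E * \int[mu]_z (f (s *: z))%:E)%E.
  transitivity (\int[mscale (NngNum sd0) (pushm mu mT)]_z (f z)%:E)%E.
    apply: eq_measure_integral => B mB _.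
    exact: (esym (lebesgue_rV_scale s0 mB)).
  rewrite (ge0_integral_mscale _ measurableT (NngNum sd0) mEf); last first.
    by move=> z _; rewrite lee_fin.
  rewrite (ge0_integral_pushforward mT mu measurableT mEf)// => z _.
  by rewrite lee_fin.
rewrite /Rintegral E; have : (0 <= \int[mu]_z (f (s *: z))%:E)%E.
  by apply: integral_ge0 => z _; rewrite lee_fin.
(* If the integral is infinite, [fine] makes both sides 0. *)
case: (integral _ _ _) => [x _||]//= _.
by rewrite mulr0 gt0_muley// lte_fin exprn_gt0.
Qed.

Lemma measurable_fun_ltr_enorm (r : R) :
  measurable_fun setT (fun z : 'rV[R]_d => r < enorm z).
Proof. by apply: measurable_fun_ltr => //; exact: measurable_enorm. Qed.

Lemma measurable_bool_kernel (b : 'rV[R]_d -> bool) : measurable_fun setT b ->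
  measurable_fun setT (fun z => (b z)%:R * K z).
Proof.
move=> mb; apply: measurable_funM; last exact: measurable_kernel.
exact: measurable_boolR.
Qed.

Lemma intg_bool_kernel (b : 'rV[R]_d -> bool) (rho : R) : 0 < rho ->
  measurable_fun setT b -> (forall z, b z -> rho <= enorm z) ->
  mu.-integrable setT (EFin \o (fun z => (b z)%:R * K z)).
Proof.
move=> rho0 mb brho.
apply: (intg_le _ (intgZ (Num.min 1 (rho ^+ 2))^-1 (intg_levy hlambda))).
  exact: measurable_bool_kernel.
move=> z; rewrite ger0_norm ?mulr_ge0 ?kernel_ge0//.
have m0 : 0 < Num.min 1 (rho ^+ 2) by rewrite lt_min ltr01 exprn_gt0.
have [bz|_] := boolP (b z).
  by rewrite mul1r; exact: (kernel_le_levy _ rho0 (brho _ bz)).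
by rewrite mul0r mulr_ge0 ?levy_ge0// invr_ge0 ltW.
Qed.

Definition kernel_mass : R := \int[mu]_(z in [set z | 1 < enorm z]) K z.

Lemma kernel_massE : kernel_mass = \int[mu]_z ((1 < enorm z)%R%:R * K z).
Proof.
rewrite /kernel_mass Rintegral_mkcond; apply: eq_Rintegral => z _.
rewrite patchE; case: ifPn; first by rewrite inE/= => ->; rewrite mul1r.
by rewrite notin_setE/= => /negP/negbTE ->; rewrite mul0r.
Qed.

Lemma kernel_mass_ge0 : 0 <= kernel_mass.
Proof. by apply: Rintegral_ge0 => z _; exact: kernel_ge0. Qed.

(** Dilation by [rho]: the kernel is homogeneous of degree -(d+lambda), and volume of degree d. *)
Lemma kernel_tail (rho : R) : 0 < rho ->
  \int[mu]_z ((rho < enorm z)%R%:R * K z) = (rho `^ lambda)^-1 * kernel_mass.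
Proof.
move=> rho0; rewrite -(Rint_scale rho0); last 2 first.
- by apply: measurable_bool_kernel; exact: measurable_fun_ltr_enorm.
- by move=> z; rewrite mulr_ge0 ?kernel_ge0.
rewrite (@eq_Rintegral _ _ _ mu setT (fun z => (rho `^ p)^-1 * ((1 < enorm z)%R%:R * K z))); last first.
  move=> z _; rewrite kernelZ// enormZ (gtr0_norm rho0).
  by rewrite -[X in X < _]mulr1 ltr_pM2l// mulrCA.
rewrite RintZ -?kernel_massE; last first.
  apply: (intg_bool_kernel ltr01); first exact: measurable_fun_ltr_enorm.
  by move=> z; exact: ltW.
rewrite mulrA; congr (_ * _).
rewrite powRD; last by rewrite (gt_eqF rho0) implybT.
rewrite powR_mulrn ?(ltW rho0)// invfM mulrA mulfV ?mul1r//.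
by rewrite expf_neq0// gt_eqF.
Qed.

(** The region may include the sphere |z| = rho, which the strict inequality in [kernel_tail]
    misses. It lies in |z| > s rho for every s < 1; this costs a factor s^(-lambda), which tends to
    1 with s. *)
Lemma kernel_tail_le (b : 'rV[R]_d -> bool) (rho : R) : 0 < rho ->
  measurable_fun setT b -> (forall z, b z -> rho <= enorm z) ->
  \int[mu]_z ((b z)%:R * K z) <= (rho `^ lambda)^-1 * kernel_mass.
Proof.
move=> rho0 mb brho; set x := leLHS; set c := leRHS.
have c0 : 0 <= c by rewrite mulr_ge0 ?kernel_mass_ge0// invr_ge0 powR_ge0.
have xs (s : R) : 0 < s < 1 -> x * s `^ lambda <= c.
  move=> /andP[s0 s1]; rewrite -ler_pdivlMr ?powR_gt0//.
  have srho0 : 0 < s * rho by rewrite mulr_gt0.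
  rewrite /c mulrAC -invfM mulrC -powRM ?(ltW s0) ?(ltW rho0)//.
  rewrite (mulrC rho) mulrC -kernel_tail//; apply: le_Rint.
  - exact: (intg_bool_kernel rho0).
  - apply: (intg_bool_kernel srho0); first exact: measurable_fun_ltr_enorm.
    by move=> z; exact: ltW.
  - move=> z; rewrite ler_wpM2r ?kernel_ge0// ler_nat.
    case: (boolP (b z)) => // /brho rz; rewrite (lt_le_trans _ rz)//.
    by rewrite gtr_pMl.
rewrite leNgt; apply/negP => cx; have x0 := le_lt_trans c0 cx.
(* If [x] exceeded [c], taking s^lambda = [y] would contradict [xs], because [x * y] is the midpoint
   of [c] and [x]. *)
pose y := (c + x) / (2 * x).
have y0 : 0 < y by rewrite divr_gt0 ?ltr_wpDl ?mulr_gt0.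
have y1 : y < 1 by rewrite ltr_pdivrMr ?mulr_gt0// mul1r mulr_natl mulr2n ltrD2r.
have : x * (y `^ lambda^-1) `^ lambda <= c.
  apply: xs; rewrite powR_gt0//= /powR (gt_eqF y0) expR_lt1.
  by rewrite pmulr_rlt0 ?invr_gt0// ln_lt0// y0.
rewrite -powRrM mulVf ?gt_eqF// powRr1 ?(ltW y0)//.
rewrite /y leNgt => /negP; apply.
have -> : x * ((c + x) / (2 * x)) = (c + x) / 2 by field; rewrite gt_eqF.
by lra.
Qed.

End kernel_scaling.

(** * Null sets and functions with countably many fibres *)

Section null_sets.
Context {R : realType}.
Local Notation leb := (@lebesgue_measure R).

Lemma ae_coord_notin d (C : set R) : countable C ->
  {ae lebesgue_rV d, forall x : 'rV[R]_d, forall i, ~ C (x ord0 i)}.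
Proof.
move=> cC; apply: filter_forall => i.
have mC : measurable C by exact: countable_measurable.
pose A j : set R := if j == i then C else setT.
have mA j : measurable (A j) by rewrite /A; case: ifP.
exists [set x : 'rV[R]_d | forall j, A j (x ord0 j)]; split.
- exact: measurable_box.
- rewrite lebesgue_rV_box// (bigD1 i)//= [X in leb X](_ : _ = C).
    by rewrite countable_lebesgue_measure0// mul0e.
  by rewrite /A eqxx.
- move=> x /= /contrapT Cx j; rewrite /A; case: eqP => // ->//.
Qed.

(** Tonelli in the first coordinate: the other coordinates being fixed, the sphere leaves it at most
    two values. This is what allows |z| < r to be exchanged for |z| <= r in the principal value. *)
Lemma ae_enorm_neq d (r : R) : (0 < d)%N ->
  {ae lebesgue_rV d, forall x : 'rV[R]_d, enorm x != r}.
Proof.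
case: d => // n _.
pose S := [set x : 'rV[R]_n.+1 | enorm x = r].
have mS : measurable S.
  rewrite -[X in measurable X]setTI.
  apply: (measurable_enorm _ (measurable_set1 r)) => //.
exists S; split=> //; last by move=> x /= /negP; rewrite negbK => /eqP.
pose P := @rV_cons R n @^-1` S.
have mP : measurable P.
  by rewrite -[X in measurable X]setTI; exact: measurable_rV_cons.
change ((leb \x lebesgue_rV n)%E P = 0%E).
rewrite -[P]setIT -integral_indic//.
have mf : measurable_fun setT (EFin \o (\1_P : _ -> R)).
  by apply/measurable_EFinP; exact: measurable_indic.
have f0 x : (0 <= (EFin \o (\1_P : _ -> R)) x)%E by rewrite lee_fin.
rewrite (fubini_tonelli2 _ mf f0).
apply: integral0_eq => y _ /=; rewrite /fubini_G.
rewrite (eq_integral (fun a => (\1_(ysection P y) a)%:E)); last first.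
  by move=> a _ /=; rewrite !indicE mem_ysection.
rewrite integral_indic ?setIT//; last exact: measurable_ysection.
apply: countable_lebesgue_measure0; apply: finite_set_countable.
pose q := \sum_(i < n) y ord0 i ^+ 2.
apply: (@sub_finite_set _ _ [set Num.sqrt (r ^+ 2 - q); - Num.sqrt (r ^+ 2 - q)]).
  move=> a; rewrite /ysection/= inE /P /S /= => ar.
  have : a ^+ 2 = r ^+ 2 - q.
    rewrite -ar sqr_enorm big_ord_recl rV_cons0/= (eq_bigr (fun i => y ord0 i ^+ 2)).
      by rewrite addrK.
    by move=> i _; rewrite rV_consS.
  move=> aq; rewrite -aq sqrtr_sqr; have [a0|a0] := ger0P a; first by left.
  by right; rewrite opprK.
exact: finite_set2.
Qed.

Lemma lebesgue_measure_shift (s : R) (B : set R) : measurable B ->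
  leb ((fun x => x + s)%R @^-1` B) = leb B.
Proof.
move=> mB; have := lebesgue_measure_scale_shift s ltr01 mB; rewrite mul1e.
by under eq_fun do rewrite mul1r.
Qed.

Local Notation XT d := ('rV[R]_d * measurableTypeR R)%type.

Definition xt_shift d (q p : XT d) : XT d :=
  (p.1 + q.1, (p.2 : R) + (q.2 : R)).

Lemma measurable_xt_shift d (q : XT d) : measurable_fun setT (xt_shift q).
Proof.
apply/measurable_fun_pairP; split.
  exact: (measurableT_comp (measurable_rV_shift q.1) measurable_fst).
rewrite (_ : _ \o _ = (fun x : measurableTypeR R => (x : R) + (q.2 : R)) \o snd)//.
apply: measurableT_comp; last exact: measurable_snd.
exact: (@measurable_funD _ _ _ _ id (cst (q.2 : R))).
Qed.

Lemma lebesgue_xt_shift d (q : XT d) B : measurable B ->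
  (lebesgue_xt d) (xt_shift q @^-1` B) = (lebesgue_xt d) B.
Proof.
move=> mB; apply/esym; apply: (@product_measure_unique _ _ _ _ _ (lebesgue_rV d)
  leb (pushm (lebesgue_xt d) (measurable_xt_shift q))) => //.
move=> A1 A2 mA1 mA2.
change ((lebesgue_xt d) (xt_shift q @^-1` (A1 `*` A2)) =
  (lebesgue_rV d A1 * lebesgue_measure A2)%E).
rewrite -(lebesgue_rV_shift q.1 mA1) -(lebesgue_measure_shift q.2 mA2).
rewrite -product_measure1E//.
  by rewrite -[X in measurable X]setTI; exact: measurable_rV_shift.
rewrite -[X in measurable X]setTI.
exact: (@measurable_funD _ _ _ _ id (cst (q.2 : R))).
Qed.

End null_sets.

Section countable_fibers.
Context d (X : measurableType d) (I : countType).

(** Functions built on the grid factor through an index with countably many values, so their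
    measurability reduces to that of the fibres. *)
Lemma measurable_countable_fibers (q : X -> I) d' (Y : measurableType d')
    (g : I -> Y) :
  (forall i, measurable (q @^-1` [set i])) -> measurable_fun setT (g \o q).
Proof.
move=> mq _ B mB; rewrite setTI.
rewrite (_ : _ @^-1` B = \bigcup_(i in [set i | B (g i)]) q @^-1` [set i]).
  rewrite bigcup_mkcond; apply: countable_bigcupT_measurable.
    exact: countableP.
  by move=> i; case: ifP.
by apply/seteqP; split=> x /= => [Bx|[i Bi ->]//]; exists (q x).
Qed.

(** Injecting the index type into [nat] by [pickle] turns the sum over fibres into a series, to
    which monotone convergence applies; naturals outside the image contribute 0. *)
Lemma esum_fibers (R : realType) (mu : {measure set X -> \bar R}) (q : X -> I)
    (g : X -> R) : (forall i, measurable (q @^-1` [set i])) ->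
  measurable_fun setT g -> (forall x, 0 <= g x) ->
  (\esum_(i in setT) \int[mu]_x ((q x == i)%:R * g x)%:E
   = \int[mu]_x (g x)%:E)%E.
Proof.
move=> mq mg g0.
pose u n : \bar R := (\int[mu]_x ((pickle (q x) == n)%:R * g x)%:E)%E.
have u0 n : (0 <= u n)%E.
  by apply: integral_ge0 => x _; rewrite lee_fin mulr_ge0.
have mf n : measurable_fun setT (fun x => (pickle (q x) == n)%:R * g x).
  apply: measurable_funM => //.
  pose G (i : I) : R := (pickle i == n)%:R.
  exact: (@measurable_countable_fibers q _ _ G).
transitivity (\esum_(i in [set: I]) u (pickle i))%E.
  apply: eq_esum => i _; apply: eq_integral => x _.
  by rewrite (inj_eq (pcan_inj pickleK)).
rewrite -(@esum_image _ _ _ _ pickle u); last by move=> i j _ _; exact: (pcan_inj pickleK).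
transitivity (\esum_(n in setT) u n)%E.
  rewrite esum_mkcond; apply: eq_esum => n _; case: ifPn => //.
  rewrite notin_setE/= => nn; rewrite /u integral0_eq// => x _.
  by case: eqP => [xn|_]; [case: nn; exists (q x)|rewrite mul0r].
rewrite -nneseries_esumT// /u -integral_nneseries//.
- apply: eq_integral => x _; rewrite (nneseriesD1 (n := pickle (q x)))//.
    rewrite eqxx mul1r eseries0 ?adde0// => n _ /= nx.
    by rewrite eq_sym (negbTE nx) mul0r.
  by move=> k _; rewrite lee_fin mulr_ge0.
- by move=> n; exact/measurable_EFinP.
- by move=> n x _; rewrite lee_fin mulr_ge0.
Qed.

End countable_fibers.

(** * Rounding to the grid *)

Section rounding.
Context {R : realType} {d : nat}.
Implicit Types (h : R) (x z : 'rV[R]_d).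

Definition cell_index h x : 'rV[int]_d := \row_i Num.floor (x ord0 i / h).

(** Adding one half yields the index of the cell x_beta + R_0 that contains [z], see
    [centered_cellE]; [round] then sends [z] to the node at the centre of that cell. *)
Definition round_index h z : 'rV[int]_d :=
  \row_i Num.floor (z ord0 i / h + 2^-1).

Definition round h z : 'rV[R]_d := grid h (round_index h z).

Lemma grid0 h : grid h (0 : 'rV[int]_d) = 0.
Proof. by apply/rowP => i; rewrite !mxE mulr0. Qed.

Lemma measurable_floor (a b : R) (n : int) : 0 < a ->
  measurable [set x : R | Num.floor (x / a + b) = n].
Proof.
move=> a0.
have mf : measurable_fun setT (fun x : R => (Num.floor (x / a + b))%:~R : R).
  apply: nondecreasing_measurable => // x y xy.
  by rewrite ler_int le_floor// lerD2r ler_pM2r ?invr_gt0.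
rewrite (_ : [set _ | _] = setT `&`
    (fun x : R => (Num.floor (x / a + b))%:~R : R) @^-1` [set n%:~R]).
  by apply: mf => //; exact: measurable_set1.
by apply/seteqP; split=> x /= => [->//|[_ /intr_inj]].
Qed.

Lemma measurable_truncn (a : R) (n : nat) : 0 < a ->
  measurable [set x : R | Num.truncn (x / a) = n].
Proof.
move=> a0.
have mf : measurable_fun setT (fun x : R => (Num.truncn (x / a))%:R : R).
  apply: nondecreasing_measurable => // x y xy.
  by rewrite ler_nat le_truncn// ler_pM2r ?invr_gt0.
rewrite (_ : [set _ | _] = setT `&`
    (fun x : R => (Num.truncn (x / a))%:R : R) @^-1` [set n%:R]).
  by apply: mf => //; exact: measurable_set1.
apply/seteqP; split=> x /= => [->//|[_ /eqP]].
by rewrite eqr_nat => /eqP.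
Qed.

Lemma measurable_cell_index h a : 0 < h ->
  measurable (cell_index h @^-1` [set a]).
Proof.
move=> h0; rewrite (_ : _ @^-1` _ = [set x : 'rV[R]_d | forall i,
    [set y : R | Num.floor (y / h + 0) = a ord0 i] (x ord0 i)]).
  apply: (@measurable_box _ _ (fun i =>
    [set y : R | Num.floor (y / h + 0) = a ord0 i])) => i; exact: measurable_floor.
apply/seteqP; split=> x /= => [<- i|hx]; first by rewrite !mxE addr0.
by apply/rowP => i; rewrite mxE -(hx i) addr0.
Qed.

Lemma measurable_round_index h a : 0 < h ->
  measurable (round_index h @^-1` [set a]).
Proof.
move=> h0; rewrite (_ : _ @^-1` _ = [set x : 'rV[R]_d | forall i,
    [set y : R | Num.floor (y / h + 2^-1) = a ord0 i] (x ord0 i)]).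
  apply: (@measurable_box _ _ (fun i =>
    [set y : R | Num.floor (y / h + 2^-1) = a ord0 i])) => i; exact: measurable_floor.
apply/seteqP; split=> x /= => [<- i|hx]; first by rewrite !mxE.
by apply/rowP => i; rewrite mxE -(hx i).
Qed.

Lemma measurable_round h : 0 < h -> measurable_fun setT (round h).
Proof.
move=> h0; apply: (@measurable_countable_fibers _ _ _ _ _ _ (grid h)) => a.
exact: measurable_round_index.
Qed.

Lemma round_itv h z i : 0 < h ->
  h * ((round_index h z) ord0 i)%:~R - h / 2 <= z ord0 i
    < h * ((round_index h z) ord0 i)%:~R + h / 2.
Proof.
move=> h0; rewrite mxE; have /andP[] := floor_itv (z ord0 i / h + 2^-1).
set n := Num.floor _; rewrite intrD => n1 n2.
have hz : h * (z ord0 i / h + 2^-1) = z ord0 i + h / 2.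
  by field; rewrite gt_eqF.
have {n1} n1 : h * n%:~R <= z ord0 i + h / 2 by rewrite -hz ler_pM2l.
have {n2} n2 : z ord0 i + h / 2 < h * n%:~R + h.
  have -> : h * n%:~R + h = h * (n%:~R + 1) by ring.
  by rewrite -hz ltr_pM2l.
by apply/andP; split; lra.
Qed.

Lemma dist_round h z i : 0 < h -> `|round h z ord0 i - z ord0 i| <= h / 2.
Proof.
move=> h0; have := round_itv z i h0.
have -> : round h z ord0 i = h * ((round_index h z) ord0 i)%:~R by rewrite mxE.
move: (_%:~R) => n /andP[n1 n2].
by rewrite ler_norml; apply/andP; split; lra.
Qed.

(** A nonzero rounded coordinate is at least h in absolute value, and the rounding error h / 2 is at
    most half of that. A bound relative to |z| keeps the quadratic estimates uniform in h. *)
Lemma round_le h z i : 0 < h -> `|round h z ord0 i| <= 2 * `|z ord0 i|.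
Proof.
move=> h0; have [n0|n0] := eqVneq ((round_index h z) ord0 i) 0.
  by rewrite mxE n0 mulr0 normr0 mulr_ge0.
have : h <= `|round h z ord0 i|.
  rewrite mxE normrM (gtr0_norm h0) ler_peMr ?(ltW h0)//.
  by rewrite -intr_norm ler1z -gtz0_ge1 normr_gt0.
have := dist_round z i h0; move: (round h z ord0 i) (z ord0 i) => a b.
move=> h1 h2; have := ler_distD b a 0; rewrite !subr0 => h3.
by lra.
Qed.

Lemma enorm_round h z : 0 < h -> enorm (round h z) <= 2 * enorm z.
Proof. by move=> h0; apply: le_enorm => // i; exact: round_le. Qed.

Lemma round_index_neq0 h z : 0 < h -> round_index h z != 0 ->
  h / 2 <= enorm z.
Proof.
move=> h0; apply: contra_neqT; rewrite -ltNge => zh; apply/rowP => i.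
rewrite !mxE; apply/floor_def; rewrite mulr0z add0r.
have := le_lt_trans (coord_le_enorm z i) zh; rewrite ltr_norml => /andP[z1 z2].
have {z1} : - 2^-1 < z ord0 i / h by rewrite ltr_pdivlMr//; lra.
have {z2} : z ord0 i / h < 2^-1 by rewrite ltr_pdivrMr//; lra.
by rewrite mulr1z => ? ?; apply/andP; split; lra.
Qed.

Lemma cvg_round (h : nat -> R) z i : (forall j, 0 < h j) ->
  h j @[j --> \oo] --> 0 -> round (h j) z ord0 i @[j --> \oo] --> z ord0 i.
Proof.
move=> h0 hcvg; apply/cvgrPdist_le => e e0.
have : \forall j \near \oo, `|0 - h j| <= e by move/cvgrPdist_le : hcvg; exact.
apply: filterS => j; rewrite sub0r normrN (gtr0_norm (h0 j)) => he.
rewrite distrC (le_trans (dist_round _ _ (h0 j)))// (le_trans _ he)//.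
by rewrite ler_pdivrMr// ler_peMr ?ler1n// ltW.
Qed.

(** With half-open cells, rounding is odd except where a coordinate is of the form h (n - 1/2), on
    cell boundaries. Oddness is what turns first differences of [phi] into second differences. *)
Lemma ae_roundN h : 0 < h ->
  {ae lebesgue_rV d, forall z, round_index h (- z) = - round_index h z}.
Proof.
move=> h0; pose C : set R := [set h * (n%:~R - 2^-1) | n in [set: int]].
have cC : countable C by apply: card_le_trans (card_image_le _ _) _; exact: countableP.
apply: filterS (ae_coord_notin d cC) => z zC.
apply/rowP => i; rewrite !mxE.
set a := z ord0 i / h; have za : z ord0 i = h * a.
  by rewrite /a mulrCA divff ?mulr1// gt_eqF.
have aC (n : int) : a + 2^-1 <> n%:~R.
  by move=> an; apply: (zC i); exists n => //; rewrite -an addrK.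
have /andP[n1 n2] := floor_itv (a + 2^-1).
apply/floor_def; rewrite mulNr -/a; move: n1 n2 (aC (Num.floor (a + 2^-1))).
move: (Num.floor _) => n; rewrite !intrD !intrN mulr1z => n1 n2 n3.
have {n1} n1 : n%:~R < a + 2^-1 by rewrite lt_neqAle n1 andbT; apply/eqP => /esym.
by apply/andP; split; lra.
Qed.

End rounding.

Section weighted_integrals.
Context d (X : measurableType d) {R : realType} (mu : {measure set X -> \bar R}).

Lemma intg_bddM (f K : X -> R) (C : R) : measurable_fun setT f ->
  (forall x, `|f x| <= C) -> (forall x, 0 <= K x) ->
  mu.-integrable setT (EFin \o K) ->
  mu.-integrable setT (EFin \o (fun x => f x * K x)).
Proof.
move=> mf fC K0 iK; apply: (intg_le _ (intgZ C iK)).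
  exact: (measurable_funM mf (intg_measurable iK)).
by move=> x; rewrite normrM (ger0_norm (K0 x)) ler_wpM2r.
Qed.

End weighted_integrals.

(** * The discrete entropy inequality *)

Section monotone_step.
Context {R : realType} {d : nat}.
Variables (c LA LF tau h : R) (A : R -> R) (F : 'I_d -> R -> R -> R).
Variable K : 'rV[R]_d -> R.
Hypotheses (c0 : 0 <= c) (LA0 : 0 <= LA) (tau0 : 0 < tau) (h0 : 0 < h).
Hypothesis lipA : forall a b, `|A a - A b| <= LA * `|a - b|.
Hypothesis homoA : {homo A : a b / a <= b}.
Hypothesis lipF : forall l a b a' b',
  `|F l a b - F l a' b'| <= LF * (`|a - a'| + `|b - b'|).
Hypothesis homoF1 : forall l b, {homo (fun a => F l a b) : a a' / a <= a'}.
Hypothesis homoF2 : forall l a, {homo F l a : b b' / b <= b' >-> b' <= b}.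
Hypothesis K0 : forall z, 0 <= K z.
Hypothesis iK : (lebesgue_rV d).-integrable setT (EFin \o K).
Local Notation mu := (lebesgue_rV d).
Hypothesis cfl : 2 * d%:R * LF * (tau / h) + c * LA * tau * \int[mu]_z K z <= 1.

Lemma lipschitz_continuous : continuous A.
Proof.
move=> x; apply/cvgrPdist_le => e e0.
near=> y; apply: (le_trans (lipA _ _)).
have : `|x - y| <= e / (LA + 1).
  by near: y; apply: cvgr_dist_le => //; rewrite divr_gt0// ltr_wpDl.
rewrite ler_pdivlMr ?ltr_wpDl// mulrC; apply: le_trans.
by rewrite ler_wpM2r// lerDl.
Unshelve. all: by end_near. Qed.

Lemma measurable_lipschitz : measurable_fun setT A.
Proof. exact: continuous_measurable_fun lipschitz_continuous. Qed.

Definition bdd_meas (om : 'rV[R]_d -> R) :=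
  measurable_fun setT om /\ exists M, forall z, `|om z| <= M.

Lemma bdd_meas_comp (om : 'rV[R]_d -> R) : bdd_meas om -> bdd_meas (A \o om).
Proof.
move=> [mom [M omM]]; split; first exact: measurableT_comp measurable_lipschitz mom.
exists (`|A 0| + LA * M) => z /=.
rewrite -[A (om z)](subrK (A 0)) addrC (le_trans (ler_normD _ _))// lerD2l.
rewrite (le_trans (lipA _ _))// subr0 ler_wpM2l//.
Qed.

Lemma bdd_measB (f g : 'rV[R]_d -> R) : bdd_meas f -> bdd_meas g ->
  bdd_meas (fun z => f z - g z).
Proof.
move=> [mf [Mf fM]] [mg [Mg gM]]; split; first exact: measurable_funB.
by exists (Mf + Mg) => z; rewrite (le_trans (ler_normB _ _))// lerD.
Qed.

Lemma bdd_meas_cst (a : R) : bdd_meas (fun=> a).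
Proof. by split => //; exists `|a|. Qed.

Lemma intg_bdd_meas (b : 'rV[R]_d -> bool) (om : 'rV[R]_d -> R) :
  measurable_fun setT b -> bdd_meas om ->
  mu.-integrable setT (EFin \o (fun z => (b z)%:R * om z * K z)).
Proof.
move=> mb [mom [M omM]]; apply: (@intg_bddM _ _ _ _ _ _ M) => //.
  by apply: measurable_funM => //; exact: measurable_boolR.
move=> z; rewrite normrM; have := omM z; have := normr_ge0 (om z).
by case: (b z); rewrite ?normr1 ?normr0 ?mul1r ?mul0r// => *; exact: le_trans (omM z).
Qed.

Variable b : 'rV[R]_d -> bool.
Hypothesis mb : measurable_fun setT b.

(** [w0], [wp] and [wm] stand for the values in a cell and in its forward and backward neighbours,
    [om z] for the value at the translate by [round h z]. Only the part of the nonlocal term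
    selected by [b] is kept. *)
Let step (w0 : R) (wp wm : 'I_d -> R) (om : 'rV[R]_d -> R) : R :=
  w0 - tau * (\sum_(l < d) (F l w0 (wp l) - F l (wm l) w0) / h)
  + tau * (c * \int[mu]_z ((b z)%:R * (A (om z) - A w0) * K z)).

Let step_cst k : step k (fun=> k) (fun=> k) (fun=> k) = k.
Proof.
rewrite /step big1 ?mulr0 ?subr0; last by move=> l _; rewrite subrr mul0r.
rewrite (@eq_Rintegral _ _ _ mu setT (fun=> 0)); last first.
  by move=> z _; rewrite subrr mulr0 mul0r.
by rewrite Rintegral_cst// mul0r !mulr0 addr0.
Qed.

(** Neighbouring values enter monotonically through [F] and [A]. Raising the own value by e adds e
    and loses at most tau d 2 LF e / h in the fluxes and tau c LA e times the mass of [K] in the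
    nonlocal term; the CFL condition says that the loss does not exceed e. *)
Let step_mono w0 wp wm om w0' wp' wm' om' : bdd_meas om -> bdd_meas om' ->
  w0 <= w0' -> (forall l, wp l <= wp' l) -> (forall l, wm l <= wm' l) ->
  (forall z, om z <= om' z) -> step w0 wp wm om <= step w0' wp' wm' om'.
Proof.
move=> bom bom' le0 lep lem leom.
pose e := w0' - w0; have e0 : 0 <= e by rewrite subr_ge0.
have ne' : `|w0 - w0'| = e by rewrite distrC ger0_norm.
have flux : \sum_(l < d) (F l w0' (wp' l) - F l (wm' l) w0') / h
    - \sum_(l < d) (F l w0 (wp l) - F l (wm l) w0) / h
    <= d%:R * (2 * LF * e / h).
  rewrite -sumrB (le_trans (ler_sum _ (G := fun=> 2 * LF * e / h) _))//.
    move=> l _; rewrite -mulrBl ler_wpM2r ?invr_ge0 ?(ltW h0)//.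
    have h1 : F l w0' (wp' l) <= F l w0' (wp l) by apply: homoF2.
    have h2 : F l (wm l) w0' <= F l (wm' l) w0' by apply: homoF1.
    have := lipF l w0' (wp l) w0 (wp l); rewrite subrr normr0 addr0.
    rewrite -/e (ger0_norm e0) => /(le_trans (ler_norm _)) h3.
    have := lipF l (wm l) w0 (wm l) w0'; rewrite subrr normr0 add0r.
    rewrite ne' => /(le_trans (ler_norm _)) h4.
    have {}h3 := lerD h3 h4; rewrite (le_trans _ (_ : LF * e + LF * e <= _)) //.
      by apply: le_trans h3; lra.
    by rewrite -mulrA mulr_natl mulr2n.
  by rewrite sumr_const card_ord -[leLHS]mulr_natl lexx.
have nonloc : - (LA * e * \int[mu]_z K z) <=
    \int[mu]_z ((b z)%:R * (A (om' z) - A w0') * K z)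
    - \int[mu]_z ((b z)%:R * (A (om z) - A w0) * K z).
  rewrite -RintB; last 2 first.
  - by apply: intg_bdd_meas => //; apply: bdd_measB;
      [exact: bdd_meas_comp|exact: bdd_meas_cst].
  - by apply: intg_bdd_meas => //; apply: bdd_measB;
      [exact: bdd_meas_comp|exact: bdd_meas_cst].
  rewrite -mulNr -RintZ//; apply: le_Rint.
  - exact: intgZ.
  - by apply: intgB; apply: intg_bdd_meas => //; apply: bdd_measB;
      [exact: bdd_meas_comp|exact: bdd_meas_cst|
       exact: bdd_meas_comp|exact: bdd_meas_cst].
  - move=> z; rewrite -mulrBl ler_wpM2r// -mulrBr.
    have Ae : A w0' - A w0 <= LA * e.
      by rewrite (le_trans (ler_norm _))// (le_trans (lipA _ _))// (ger0_norm e0).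
    have Aom := homoA (leom z).
    have LAe : 0 <= LA * e by rewrite mulr_ge0.
    by case: (b z); rewrite ?mul1r ?mul0r; lra.
rewrite -subr_ge0.
have -> : step w0' wp' wm' om' - step w0 wp wm om =
  e - tau * (\sum_(l < d) (F l w0' (wp' l) - F l (wm' l) w0') / h
    - \sum_(l < d) (F l w0 (wp l) - F l (wm l) w0) / h)
  + tau * c * (\int[mu]_z ((b z)%:R * (A (om' z) - A w0') * K z)
    - \int[mu]_z ((b z)%:R * (A (om z) - A w0) * K z)).
  by rewrite /step /e; ring.
have taut := ltW tau0.
apply: (@le_trans _ _ (e - tau * (d%:R * (2 * LF * e / h))
    + tau * c * - (LA * e * \int[mu]_z K z))).
  have -> : e - tau * (d%:R * (2 * LF * e / h)) +
     tau * c * - (LA * e * \int[mu]_z K z) =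
    e * (1 - (2 * d%:R * LF * (tau / h) + c * LA * tau * \int[mu]_z K z)).
    by ring.
  by rewrite mulr_ge0// subr_ge0.
apply: lerD; last by rewrite ler_wpM2l// mulr_ge0.
by rewrite lerD2l lerN2 ler_wpM2l.
Qed.

Lemma bdd_meas_max k om : bdd_meas om -> bdd_meas (fun z => Num.max (om z) k).
Proof.
move=> [mom [M omM]]; split; first exact: measurable_maxr.
exists (M + `|k|) => z; have := omM z; have := normr_ge0 k.
have := normr_ge0 (om z).
by case: (leP (om z) k) => *; lra.
Qed.

Lemma bdd_meas_min k om : bdd_meas om -> bdd_meas (fun z => Num.min (om z) k).
Proof.
move=> [mom [M omM]]; split; first exact: measurable_minr.
exists (M + `|k|) => z; have := omM z; have := normr_ge0 k.
have := normr_ge0 (om z).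
by case: (leP (om z) k) => *; lra.
Qed.

(** The numerical entropy flux of Crandall and Majda for the entropy |u - k|. *)
Definition num_entropy_flux (k : R) (l : 'I_d) (x y : R) : R :=
  F l (Num.max x k) (Num.max y k) - F l (Num.min x k) (Num.min y k).

Lemma subr_max_min (k a : R) : Num.max a k - Num.min a k = `|a - k|.
Proof. by case: lerP. Qed.

Lemma A_max_min (k a : R) : A (Num.max a k) - A (Num.min a k) = `|A a - A k|.
Proof.
case: (lerP a k) => [ak|/ltW ak]; [rewrite distrC|];
  by rewrite ger0_norm ?subr_ge0// homoA.
Qed.

(* The scheme is monotone under the CFL condition, hence so is its flux part
   together with the part [b] of its nonlocal term; constants are fixed points.
   The remaining nonlocal part is linear and only costs a sign. *)
Lemma cell_entropy_inequality (k w0 w1 : R) (wp wm : 'I_d -> R)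
    (om : 'rV[R]_d -> R) : bdd_meas om ->
  w1 = w0 - tau * (\sum_(l < d) (F l w0 (wp l) - F l (wm l) w0) / h)
    + tau * (c * \int[mu]_z ((A (om z) - A w0) * K z)) ->
  `|w1 - k| <= `|w0 - k|
    - tau * (\sum_(l < d) (num_entropy_flux k l w0 (wp l)
                          - num_entropy_flux k l (wm l) w0) / h)
    + tau * (c * \int[mu]_z ((b z)%:R * (`|A (om z) - A k| - `|A w0 - A k|) * K z))
    + tau * (c * (Num.sg (w1 - k)
        * \int[mu]_z ((~~ b z)%:R * (A (om z) - A w0) * K z))).
Proof.
move=> bom w1E.
have bA : bdd_meas (fun z => A (om z) - A w0).
  by apply: bdd_measB; [exact: bdd_meas_comp|exact: bdd_meas_cst].
have mnb : measurable_fun setT (fun z => ~~ b z) by exact: measurable_neg.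
pose V := step w0 wp wm om.
pose O := c * \int[mu]_z ((~~ b z)%:R * (A (om z) - A w0) * K z).
have w1V : w1 = V + tau * O.
  have E : \int[mu]_z ((A (om z) - A w0) * K z) =
     \int[mu]_z ((b z)%:R * (A (om z) - A w0) * K z) +
     \int[mu]_z ((~~ b z)%:R * (A (om z) - A w0) * K z).
    rewrite -RintD//; last 2 first.
    - exact: intg_bdd_meas.
    - exact: intg_bdd_meas.
    apply: eq_Rintegral => z _.
    by case: (b z); rewrite /= ?mul1r ?mul0r ?addr0 ?add0r.
  by rewrite w1E E /V /step /O; ring.
(* The states max(., k) and min(., k) enclose both the actual state and the constant state [k], so
   that monotonicity puts [V] and [k] between [V2] and [V1]. *)
pose V1 := step (Num.max w0 k) (fun l => Num.max (wp l) k)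
  (fun l => Num.max (wm l) k) (fun z => Num.max (om z) k).
pose V2 := step (Num.min w0 k) (fun l => Num.min (wp l) k)
  (fun l => Num.min (wm l) k) (fun z => Num.min (om z) k).
have bmax := bdd_meas_max k bom; have bmin := bdd_meas_min k bom.
have bk := bdd_meas_cst k.
have VV1 : V <= V1 by apply: step_mono => // *; rewrite le_max lexx.
have V2V : V2 <= V by apply: step_mono => // *; rewrite ge_min lexx.
have kV1 : k <= V1.
  by rewrite -[leLHS]step_cst; apply: step_mono => // *; rewrite le_max lexx orbT.
have V2k : V2 <= k.
  by rewrite -[leRHS]step_cst; apply: step_mono => // *; rewrite ge_min lexx orbT.
have Vk : `|V - k| <= V1 - V2 by rewrite ler_norml; apply/andP; split; lra.
apply: (@le_trans _ _ (V1 - V2 + tau * (Num.sg (w1 - k) * O))).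
  have sg1 : `|Num.sg (w1 - k)| <= 1 by rewrite normr_sg; case: (_ != 0).
  have w1k : w1 - k = V - k + tau * O by rewrite {1}w1V; ring.
  (* Since |y| = sgn(y) y, using the sign at the new level leaves the outer part exact, and only the
     product with [V - k] has to be estimated. *)
  have -> : `|w1 - k| = Num.sg (w1 - k) * (V - k) + tau * (Num.sg (w1 - k) * O).
    by rewrite normrEsg mulrCA -mulrDr -w1k.
  rewrite lerD2r (le_trans (ler_norm _))// (le_trans _ Vk)// normrM.
  by rewrite ler_piMl.
rewrite [leRHS](_ : _ = `|w0 - k|
    - tau * (\sum_(l < d) (num_entropy_flux k l w0 (wp l)
                          - num_entropy_flux k l (wm l) w0) / h)
    + tau * (c * \int[mu]_z ((b z)%:R * (`|A (om z) - A k| - `|A w0 - A k|) * K z))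
    + tau * (Num.sg (w1 - k) * O)); last by rewrite /O; ring.
rewrite lerD2r le_eqVlt; apply/orP; left; apply/eqP.
have -> : \int[mu]_z ((b z)%:R * (`|A (om z) - A k| - `|A w0 - A k|) * K z) =
    \int[mu]_z ((b z)%:R * (A (Num.max (om z) k) - A (Num.max w0 k)) * K z)
    - \int[mu]_z ((b z)%:R * (A (Num.min (om z) k) - A (Num.min w0 k)) * K z).
  rewrite -RintB; last 2 first.
  - by apply: intg_bdd_meas => //; apply: bdd_measB;
      [exact: bdd_meas_comp|exact: bdd_meas_cst].
  - by apply: intg_bdd_meas => //; apply: bdd_measB;
      [exact: bdd_meas_comp|exact: bdd_meas_cst].
  by apply: eq_Rintegral => z _; rewrite -!A_max_min; ring.
have -> : \sum_(l < d) (num_entropy_flux k l w0 (wp l)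
      - num_entropy_flux k l (wm l) w0) / h =
   \sum_(l < d) (F l (Num.max w0 k) (Num.max (wp l) k)
      - F l (Num.max (wm l) k) (Num.max w0 k)) / h
   - \sum_(l < d) (F l (Num.min w0 k) (Num.min (wp l) k)
      - F l (Num.min (wm l) k) (Num.min w0 k)) / h.
  by rewrite -sumrB; apply: eq_bigr => l _; rewrite /num_entropy_flux; ring.
by rewrite /V1 /V2 /step -subr_max_min; ring.
Qed.

End monotone_step.

(** * The nonlocal sum as an integral *)

Section discrete_sums.
Context {R : realType} {d : nat}.
Variables (h c lambda : R).
Hypotheses (h0 : 0 < h) (c0 : 0 <= c) (hlambda : 0 < lambda < 2).
Local Notation mu := (@lebesgue_rV R d).

(** The sum of the scheme excludes beta = 0, which corresponds to removing the central cell and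
    leaves an integrable kernel. *)
Definition cut_kernel (z : 'rV[R]_d) : R :=
  (round_index h z != 0)%:R * Defs.kernel lambda z.

Lemma cut_kernel_ge0 z : 0 <= cut_kernel z.
Proof. by rewrite mulr_ge0// kernel_ge0. Qed.

Lemma measurable_fun_round_index (g : 'rV[int]_d -> R) :
  measurable_fun setT (fun z => g (round_index h z)).
Proof.
apply: (@measurable_countable_fibers _ _ _ (round_index h) _ _ g) => a.
exact: measurable_round_index.
Qed.

Lemma measurable_round_index_neq0 :
  measurable_fun setT (fun z : 'rV[R]_d => round_index h z != 0).
Proof.
apply: (@measurable_countable_fibers _ _ _ (round_index h) _ _ (fun a => a != 0)) => a.
exact: measurable_round_index.
Qed.

Lemma measurable_cut_kernel : measurable_fun setT cut_kernel.
Proof. exact: measurable_bool_kernel measurable_round_index_neq0. Qed.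

Lemma intg_cut_kernel : mu.-integrable setT (EFin \o cut_kernel).
Proof.
apply: (intg_bool_kernel hlambda (rho := h / 2)); first by rewrite divr_gt0.
  exact: measurable_round_index_neq0.
by move=> z; exact: round_index_neq0.
Qed.

(** Outside the central cell |z| >= h / 2; scaling the tail at radius h / 2 produces the factor
    2^lambda h^(-lambda) of the CFL condition. *)
Lemma cut_kernel_mass : \int[mu]_z cut_kernel z <=
  2 `^ lambda * (@kernel_mass R d lambda) / h `^ lambda.
Proof.
apply: le_trans (kernel_tail_le hlambda (rho := h / 2) _ _ _) _.
- by rewrite divr_gt0.
- exact: measurable_round_index_neq0.
- by move=> z; exact: round_index_neq0.
have -> : ((h / 2) `^ lambda)^-1 = 2 `^ lambda / h `^ lambda.
  rewrite powRM ?invr_ge0 ?(ltW h0)// invfM -[2^-1]powR_inv1// -powRrM mulN1r.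
  by rewrite powRN invrK mulrC.
by rewrite mulrAC.
Qed.

Lemma centered_cellE (b : 'rV[int]_d) z :
  centered_cell h b z <-> round_index h z = b.
Proof.
split=> [zb|<- i]; last first.
  have := round_itv z i h0; rewrite /centered_cell/= !mxE => /andP[z1 z2].
  by apply/andP; split; lra.
apply/rowP => i; have := zb i; rewrite !mxE => /andP[z1 z2].
have za : z ord0 i = h * (z ord0 i / h) by field; rewrite gt_eqF.
move: (z ord0 i / h) za z1 z2 => a ->; move: (b ord0 i) => n.
have -> : h * a - h * n%:~R = h * (a - n%:~R) by ring.
have -> : - (h / 2) = h * (- 2^-1) by ring.
rewrite ler_pM2l// ltr_pM2l// => z1 z2.
by apply/floor_def; rewrite intrD mulr1z; apply/andP; split; lra.
Qed.

Lemma weightE (b : 'rV[int]_d) : b != 0 -> weight h c lambda b =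
  c * \int[mu]_z ((round_index h z == b)%:R * cut_kernel z).
Proof.
move=> b0; rewrite /weight Rintegral_mkcond; congr (_ * _).
apply: eq_Rintegral => z _; rewrite patchE /cut_kernel.
have [zb|zb] := eqVneq (round_index h z) b.
  by rewrite ifT ?zb ?b0 ?mul1r// inE; apply/centered_cellE.
by rewrite ifF ?mul0r//; apply/negbTE; rewrite notin_setE => /centered_cellE;
  apply/eqP.
Qed.

Lemma weight_ge0 (b : 'rV[int]_d) : 0 <= weight h c lambda b.
Proof.
by rewrite mulr_ge0//; apply: Rintegral_ge0 => z _; exact: kernel_ge0.
Qed.

Lemma esum_weight (s : 'rV[int]_d -> R) (C : R) : (forall b, 0 <= s b <= C) ->
  (\esum_(b in [set b : 'rV[int]_d | b != 0%R]) (weight h c lambda b * s b)%:E =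
   \int[mu]_z (s (round_index h z) * (c * cut_kernel z))%:E)%E.
Proof.
move=> sC; have s0 b : 0 <= s b by case/andP : (sC b).
pose g z := s (round_index h z) * (c * cut_kernel z).
have g0 z : 0 <= g z by rewrite mulr_ge0 ?s0// mulr_ge0// cut_kernel_ge0.
have mg : measurable_fun setT g.
  apply: measurable_funM; first exact: measurable_fun_round_index.
  by apply: measurable_funM => //; exact: measurable_cut_kernel.
rewrite -[RHS](@esum_fibers _ _ 'rV[int]_d _ mu (round_index h) g)//; last first.
  by move=> b; exact: measurable_round_index.
rewrite esum_mkcond; apply: eq_esum => b _; case: ifPn => [|]; rewrite ?inE ?notin_setE/=.
  move=> b0; rewrite weightE//.
  have ib : mu.-integrable setT (EFin \o (fun z => (round_index h z == b)%:R * cut_kernel z)).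
    apply: (@intg_bddM _ _ _ _ _ _ 1).
    - exact: (measurable_fun_round_index (fun a => (a == b)%:R)).
    - by move=> z; case: (_ == b); rewrite ?normr1 ?normr0.
    - exact: cut_kernel_ge0.
    - exact: intg_cut_kernel.
  rewrite mulrC mulrA -RintZ// /Rintegral fineK; last first.
    exact: integrable_fin_num (intgZ _ ib).
  apply: eq_integral => z _; congr EFin; rewrite /g.
  by have [->|] := eqVneq (round_index h z) b; rewrite ?mul1r ?mul0r ?mulr0// mulrA.
(* The index 0 contributes nothing on either side, [cut_kernel] being 0 on the central cell. *)
move=> /negP; rewrite negbK => /eqP ->; rewrite integral0_eq// => z _.
rewrite /g /cut_kernel; case: eqVneq => [->|]; last by rewrite mul0r.
by rewrite mul0r !mulr0.
Qed.

(** [sum_over] is a difference of two sums of nonnegative terms. Each is an integral by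
    [esum_weight], finite because the family is bounded, and the positive and negative parts
    recombine under the integral. *)
Lemma sum_over_weight (a : 'rV[int]_d -> R) (C : R) : (forall b, `|a b| <= C) ->
  sum_over [set b : 'rV[int]_d | b != 0] (fun b => weight h c lambda b * a b) =
  c * \int[mu]_z (a (round_index h z) * cut_kernel z).
Proof.
move=> aC.
have C0 : 0 <= C by exact: le_trans (aC 0).
have ap b : 0 <= Num.max (a b) 0 <= C.
  by rewrite le_max lexx orbT ge_max C0 andbT (le_trans (ler_norm _)).
have an b : 0 <= Num.max (- a b) 0 <= C.
  by rewrite le_max lexx orbT ge_max C0 andbT (le_trans (ler_norm _))// normrN.
rewrite /sum_over.
rewrite (eq_esum (b := fun b => (weight h c lambda b * Num.max (a b) 0)%:E)); last first.
  by move=> b _; rewrite funeposE/= -EFin_max maxr_pMr ?weight_ge0// mulr0.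
rewrite [X in (_ - X)%E](eq_esum (b := fun b => (weight h c lambda b * Num.max (- a b) 0)%:E)); last first.
  by move=> b _; rewrite funenegE/= -EFin_max -mulrN maxr_pMr ?weight_ge0// mulr0.
rewrite (esum_weight ap) (esum_weight an).
have ii (s : 'rV[int]_d -> R) : (forall b, 0 <= s b <= C) -> mu.-integrable setT
    (EFin \o (fun z => s (round_index h z) * (c * cut_kernel z))).
  move=> sC; apply: (@intg_bddM _ _ _ _ _ _ C).
  - exact: measurable_fun_round_index.
  - by move=> z; have /andP[s0 s1] := sC (round_index h z); rewrite ger0_norm.
  - by move=> z; rewrite mulr_ge0// cut_kernel_ge0.
  - exact: intgZ intg_cut_kernel.
rewrite fineB; [|exact: integrable_fin_num (ii _ ap)|exact: integrable_fin_num (ii _ an)].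
rewrite -/(Rintegral _ _ _) -/(Rintegral _ _ _) -RintB; [|exact: ii ap|exact: ii an].
rewrite -RintZ; last first.
  apply: (@intg_bddM _ _ _ _ _ _ C) => //.
  - exact: measurable_fun_round_index.
  - exact: cut_kernel_ge0.
  - exact: intg_cut_kernel.
apply: eq_Rintegral => z _; rewrite -mulrBl mulrCA; congr (_ * (_ * _)).
move: (a _) => x; rewrite /Num.max.
by case: ifPn; case: ifPn; rewrite -?leNgt => *; lra.
Qed.

End discrete_sums.

Section ae_product.
Context {R : realType} {d : nat}.
Local Notation XT d := ('rV[R]_d * measurableTypeR R)%type.

Lemma lebesgue_xtX (A : set 'rV[R]_d) (B : set (measurableTypeR R)) :
  measurable A -> measurable B ->
  (lebesgue_xt d) (A `*` B) = (lebesgue_rV d A * lebesgue_measure B)%E.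
Proof. by move=> mA mB; exact: product_measure1E. Qed.

Lemma ae_xt_fst (P : 'rV[R]_d -> Prop) : {ae lebesgue_rV d, forall x, P x} ->
  {ae lebesgue_xt d, forall p : XT d, P p.1}.
Proof.
move=> [N [mN N0 hN]]; exists (N `*` setT); split.
- exact: measurableX.
- by rewrite lebesgue_xtX// N0 mul0e.
- by move=> [x t] /= nP; split=> //; exact: hN.
Qed.

Lemma ae_xt_snd (P : R -> Prop) : {ae (@lebesgue_measure R), forall t, P t} ->
  {ae lebesgue_xt d, forall p : XT d, P p.2}.
Proof.
move=> [N [mN N0 hN]]; exists (setT `*` N); split.
- exact: measurableX.
- by rewrite lebesgue_xtX// N0 mule0.
- by move=> [x t] /= nP; split=> //; exact: hN.
Qed.

Lemma ae_notin_countable (C : set R) : countable C ->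
  {ae (@lebesgue_measure R), forall t, ~ C t}.
Proof.
move=> cC; exists C; split; first exact: countable_measurable.
  exact: countable_lebesgue_measure0.
by move=> t /= /contrapT.
Qed.

Lemma near_floor (h : R) (a : R) : 0 < h -> (forall n : int, a <> h * n%:~R) ->
  \forall b \near a, Num.floor (b / h) = Num.floor (a / h).
Proof.
move=> h0 an; have /andP[] := floor_itv (a / h).
set n := Num.floor (a / h); rewrite le_eqVlt => /orP[/eqP na|na] na1.
  by exfalso; apply: (an n); rewrite na mulrC divfK// gt_eqF.
have aI : a \in `]h * n%:~R, h * (n + 1)%:~R[.
  by rewrite in_itv/= !(mulrC h) -ltr_pdivlMr// na -ltr_pdivrMr.
near=> b; apply: floor_def.
have : b \in `]h * n%:~R, h * (n + 1)%:~R[ by near: b; exact: near_in_itvoo.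
rewrite in_itv/= !(mulrC h) => /andP[b1 b2].
by rewrite ler_pdivlMr// (ltW b1) ltr_pdivrMr.
Unshelve. all: by end_near. Qed.

End ae_product.

(** * Interpolated solutions *)

Section interpolation.
Context {R : realType} {d : nat}.
Local Notation XT d := ('rV[R]_d * measurableTypeR R)%type.

Lemma lebesgue_cell (h : R) (a : 'rV[int]_d) : 0 < h ->
  lebesgue_rV d (cell_index h @^-1` [set a]) = ((h ^+ d)%:E).
Proof.
move=> h0; have -> : cell_index h @^-1` [set a] = [set x : 'rV[R]_d | forall i,
   `[h * (a ord0 i)%:~R, h * (a ord0 i + 1)%:~R[%classic (x ord0 i)].
  apply/seteqP; split=> x /=.
    move=> <- i; rewrite mxE in_itv/= !(mulrC h).
    rewrite -ler_pdivlMr// -ltr_pdivrMr//; exact: floor_itv.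
  move=> hx; apply/rowP => i; rewrite mxE; apply: floor_def.
  have := hx i; rewrite in_itv/= !(mulrC h) => /andP[h1 h2].
  by rewrite ler_pdivlMr// ltr_pdivrMr// h1 h2.
rewrite (@lebesgue_rV_box _ _ (fun i =>
  `[h * (a ord0 i)%:~R, h * (a ord0 i + 1)%:~R[%classic)); last first.
  by move=> i; exact: measurable_itv.
rewrite (eq_bigr (fun=> h%:E)).
  by rewrite prodEFin prodr_const card_ord.
move=> i _; rewrite lebesgue_measure_itv/= lte_fin ltr_pM2l// ltr_int ltrDl ltr01.
by rewrite -EFinB -mulrBr intrD addrAC subrr add0r mulr1.
Qed.

Variables (T h tau : R) (U : nat -> 'rV[int]_d -> R).
Hypotheses (h0 : 0 < h) (tau0 : 0 < tau) (T0 : 0 < T).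

Lemma interpolation_index (p : 'rV[R]_d * R) :
  interpolation h tau U p = U (Num.truncn (p.2 / tau)) (cell_index h p.1).
Proof. by []. Qed.

Lemma measurable_interpolation :
  measurable_fun setT (interpolation h tau U : XT d -> R).
Proof.
pose q (p : XT d) : nat * 'rV[int]_d :=
  (Num.truncn ((p.2 : R) / tau), cell_index h p.1).
apply: (@measurable_countable_fibers _ _ _ q _ _ (fun na => U na.1 na.2)).
move=> [n a]; rewrite (_ : _ @^-1` _ = (cell_index h @^-1` [set a]) `*`
    [set t : R | Num.truncn (t / tau) = n]).
  apply: measurableX; first exact: measurable_cell_index.
  exact: measurable_truncn.
by apply/seteqP; split=> -[x t] /= => [[<- <-]|[<- <-]].
Qed.

(* extended by zero outside the time interval *)
Definition interp0 (p : 'rV[R]_d * R) : R :=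
  if (0 < p.2) && (p.2 < T) then interpolation h tau U p else 0.

Lemma measurable_interp0 : measurable_fun setT (interp0 : XT d -> R).
Proof.
have m2 : measurable_fun setT (fun p : XT d => (p.2 : R)) by exact: measurable_snd.
apply: measurable_fun_ifT; last exact: measurable_cst.
  by apply: measurable_and; exact: measurable_fun_ltr.
exact: measurable_interpolation.
Qed.

Lemma near_interp0 (x : 'rV[R]_d) (t : R) :
  (forall i, ~ [set h * n%:~R | n in [set: int]] (x ord0 i)) ->
  ~ [set tau * n%:~R | n in [set: int]] t -> t <> 0 -> t <> T ->
  nbhs ((x, t) : 'rV[R]_d * R)
    [set q : 'rV[R]_d * R | interp0 q = interp0 (x, t)].
Proof.
move=> xC tC' t0 tT.
have c1 : (fst : 'rV[R]_d * R -> 'rV[R]_d) q @[q --> (x, t)] --> x by exact: cvg_fst.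
have c2 : (snd : 'rV[R]_d * R -> R) q @[q --> (x, t)] --> t by exact: cvg_snd.
have nx : \forall q \near ((x, t) : 'rV[R]_d * R), cell_index h q.1 = cell_index h x.
  apply: (c1 [set y | cell_index h y = cell_index h x]).
  have : \forall y \near x, forall i, Num.floor ((y : 'rV[R]_d) ord0 i / h) = Num.floor (x ord0 i / h).
    apply: (@filter_forall _ 'I_d (fun i => [set y : 'rV[R]_d |
      Num.floor (y ord0 i / h) = Num.floor (x ord0 i / h)]) (nbhs x) _) => i.
    apply: (@coord_continuous _ _ _ ord0 i x [set b | Num.floor (b / h) = Num.floor (x ord0 i / h)]).
    by apply: near_floor => // n xn; apply: (xC i); exists n.
  by apply: filterS => y hy; apply/rowP => i; rewrite !mxE.
have nt0 : \forall q \near ((x, t) : 'rV[R]_d * R), (0 < q.2) = (0 < t).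
  apply: (c2 [set s | (0 < s) = (0 < t)]).
  have [tp|tn|te] := ltgtP 0 t; last by exfalso; exact: t0.
    by near=> s; near: s; exact: lt_nbhsr.
  near=> s; apply/negbTE; rewrite -leNgt ltW//; near: s; exact: lt_nbhsl.
have ntT : \forall q \near ((x, t) : 'rV[R]_d * R), (q.2 < T) = (t < T).
  apply: (c2 [set s | (s < T) = (t < T)]).
  have [tp|tn|te] := ltgtP t T; last by exfalso; exact: tT.
    by near=> s; near: s; exact: lt_nbhsl.
  near=> s; apply/negbTE; rewrite -leNgt ltW//; near: s; exact: lt_nbhsr.
have nt : 0 < t -> \forall q \near ((x, t) : 'rV[R]_d * R),
    Num.truncn (q.2 / tau) = Num.truncn (t / tau).
  move=> tp; apply: (c2 [set s | Num.truncn (s / tau) = Num.truncn (t / tau)]).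
  have nf : \forall s \near t, Num.floor (s / tau) = Num.floor (t / tau).
    by apply: near_floor => // n tn; apply: tC'; exists n.
  have np : \forall s \near t, 0 < s by exact: lt_nbhsr.
  apply: filterS2 nf np => s sf sp /=.
  by rewrite !truncEfloor sf.
have nt' : \forall q \near ((x, t) : 'rV[R]_d * R),
    0 < t -> Num.truncn (q.2 / tau) = Num.truncn (t / tau).
  have [tp|tp] := boolP (0 < t); first by apply: filterS (nt tp).
  by apply: filterS nt0.
have nT : \forall q \near ((x, t) : 'rV[R]_d * R), (q.2 < T) = (t < T) /\
    (0 < t -> Num.truncn (q.2 / tau) = Num.truncn (t / tau)).
  by apply: filterS2 ntT nt'.
apply: filterS3 nx nt0 nT => q qx qt0 [qT qt] /=.
rewrite /interp0 qt0 qT /=.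
case: ifP => // /andP[tp _]; rewrite !interpolation_index/=.
by rewrite qt// qx.
Unshelve. all: by end_near. Qed.

(** The jumps lie on countably many coordinate hyperplanes, at countably many times and at the two
    ends of the time interval. *)
Lemma ae_interp0_locally_constant : {ae lebesgue_xt d, forall p : XT d,
  \forall q \near (p : 'rV[R]_d * R), interp0 q = interp0 p}.
Proof.
pose C : set R := [set h * n%:~R | n in [set: int]].
pose C' : set R := [set tau * n%:~R | n in [set: int]].
have cC : countable C by apply: card_le_trans (card_image_le _ _) _; exact: countableP.
have cC' : countable C' by apply: card_le_trans (card_image_le _ _) _; exact: countableP.
have cT : countable [set 0; T] by exact/finite_set_countable/finite_set2.
have h1 := ae_xt_fst (ae_coord_notin d cC).
have h2 := ae_xt_snd (d := d) (ae_notin_countable cC').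
have h3 := ae_xt_snd (d := d) (ae_notin_countable cT).
apply: filterS3 h1 h2 h3 => -[x t] /= xC tC' tC.
by apply: near_interp0 => // [t0|tT]; apply: tC; [left|right].
Qed.

(** A node value is attained on a cell times a time interval, a set of positive measure, so that it
    obeys a bound valid almost everywhere. The level n = N is left out, its time interval lying
    beyond Q_T. *)
Lemma interpolation_bounded (N : nat) (M : R) : N%:R * tau = T ->
  {ae lebesgue_xt d, forall p : XT d, QT T p -> `|interpolation h tau U p| <= M} ->
  forall n a, (n < N)%N -> `|U n a| <= M.
Proof.
move=> NT hM n a nN; rewrite leNgt; apply/negP => Ma.
case: hM => Z [mZ Z0 hZ].
pose I : set (measurableTypeR R) := `]n%:R * tau, n.+1%:R * tau[%classic.
pose J := cell_index h @^-1` [set a] : set 'rV[R]_d.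
have mJ : lebesgue_rV d J = (h ^+ d)%:E by exact: lebesgue_cell.
have sub : J `*` I `<=` Z.
  move=> [x t] /= [xJ]; rewrite /I/= in_itv/= => /andP[t1 t2]; apply: hZ => /= hM.
  have tp : 0 < t by apply: le_lt_trans t1; rewrite mulr_ge0// ltW.
  have : `|interpolation h tau U (x, t)| <= M.
    apply: hM; split=> //=; rewrite in_itv/= tp/= -NT (lt_le_trans t2)//.
    by rewrite ler_wpM2r ?(ltW tau0)// ler_nat.
  have -> : interpolation h tau U (x, t) = U n a.
    rewrite interpolation_index/= xJ; congr U; apply: truncn_def.
    by rewrite ler_pdivlMr// (ltW t1) ltr_pdivrMr.
  by rewrite leNgt Ma.
have : ((lebesgue_xt d) (J `*` I) <= 0)%E.
  rewrite -Z0; apply: le_measure => //; rewrite inE//.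
  apply: measurableX; last exact: measurable_itv.
  exact: measurable_cell_index.
rewrite lebesgue_xtX//; last 2 first.
- exact: measurable_cell_index.
- exact: measurable_itv.
rewrite mJ /I lebesgue_measure_itv/= lte_fin ltr_pM2r// ltr_nat ltnSn.
rewrite -EFinB -EFinM lee_fin -mulrBl -natrB// subSnn mul1r.
by apply/negP; rewrite -ltNge mulr_gt0// exprn_gt0.
Qed.

Lemma cell_index_grid (x : 'rV[R]_d) (b : 'rV[int]_d) :
  cell_index h (x + grid h b) = cell_index h x + b.
Proof.
apply/rowP => i; rewrite !mxE mulrDl mulrAC divff ?gt_eqF// mul1r.
by rewrite floorDrz ?intr_int// intrKfloor.
Qed.

Lemma cell_index_round (x z : 'rV[R]_d) :
  cell_index h (x + round h z) = cell_index h x + round_index h z.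
Proof. exact: cell_index_grid. Qed.

Lemma truncn_step t : 0 <= t ->
  Num.truncn ((t + tau) / tau) = (Num.truncn (t / tau)).+1.
Proof.
move=> t0; rewrite mulrDl divff ?gt_eqF//; apply: truncn_def.
have /andP[n1 n2] := truncn_itv (divr_ge0 t0 (ltW tau0)).
by rewrite -natr1 lerD2r n1/= -natr1 ltrD2r.
Qed.

End interpolation.

Section scheme_entropy.
Context {R : realType} {d : nat}.
Variables (T c lambda h : R) (A : R -> R) (F : 'I_d -> R -> R -> R).

Definition discrete_entropy_at (tau : R) (v : 'rV[R]_d * R -> R)
    (k r : R) (x : 'rV[R]_d) (t : R) : Prop :=
  `|v (x, t + tau) - k| <= `|v (x, t) - k|
    - tau * (\sum_(l < d) (num_entropy_flux F k l (v (x, t)) (v (x + h *: 'e_l, t))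
        - num_entropy_flux F k l (v (x - h *: 'e_l, t)) (v (x, t))) / h)
    + tau * (c * \int[lebesgue_rV d]_z ((enorm z <= r)%R%:R
        * (`|A (v (x + round h z, t)) - A k| - `|A (v (x, t)) - A k|)
        * cut_kernel h lambda z))
    + tau * (c * (Num.sg (v (x, t + tau) - k)
        * \int[lebesgue_rV d]_z ((~~ (enorm z <= r)%R)%:R
            * (A (v (x + round h z, t)) - A (v (x, t))) * cut_kernel h lambda z))).

(** [tau] is kept independent of the time step of the scheme for the sake of the degenerate case. *)
Definition discrete_entropy (tau : R) (v : 'rV[R]_d * R -> R) : Prop :=
  forall k r x t, 0 < t -> t + tau < T -> discrete_entropy_at tau v k r x t.

Variables (f : R -> 'rV[R]_d) (u0 : 'rV[R]_d -> R) (LA LF M Dt : R) (N : nat).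
Variable U : nat -> 'rV[int]_d -> R.
Hypotheses (h0 : 0 < h) (c0 : 0 < c) (hlambda : 0 < lambda < 2) (Dt0 : 0 < Dt).
Hypothesis d0 : (0 < d)%N.
Hypothesis NT : N%:R * Dt = T.
Hypothesis lipA : forall a b, `|A a - A b| <= LA * `|a - b|.
Hypothesis homoA : {homo A : a b / a <= b}.
Hypothesis hF : numerical_flux f LF F.
Hypothesis cfl : CFL d h c lambda LF LA Dt.
Hypothesis hU : scheme_solution h c lambda Dt N A F u0 U.
Hypothesis UM : forall n a, (n < N)%N -> `|U n a| <= M.
Local Notation mu := (lebesgue_rV d).
Local Notation v := (interp0 T h Dt U).

Lemma LA_ge0 : 0 <= LA.
Proof. by have := lipA 1 0; rewrite subr0 normr1 mulr1; exact: le_trans. Qed.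

Lemma LF_ge0 : 0 <= LF.
Proof.
have [lipF _ _ _] := hF (Ordinal d0); have := lipF 1 0 0 0.
by rewrite subr0 subrr normr1 normr0 addr0 mulr1; exact: le_trans.
Qed.

Lemma interp0E x t : 0 < t < T -> v (x, t) = U (Num.truncn (t / Dt)) (cell_index h x).
Proof. by move=> tT; rewrite /interp0/= tT. Qed.

Lemma truncn_lt t : 0 < t < T -> (Num.truncn (t / Dt) < N)%N.
Proof.
move=> /andP[t0 tT]; rewrite -(ltr_nat R).
apply: (@le_lt_trans _ _ (t / Dt)).
  by rewrite truncn_le// divr_ge0// ltW.
by rewrite ltr_pdivrMr// NT.
Qed.

Lemma interp0_le p : `|v p| <= `|M|.
Proof.
case: p => x t; have [tT|tT] := boolP (0 < t < T).
  by rewrite interp0E// (le_trans (UM _ (truncn_lt tT)))// ler_norm.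
by rewrite /interp0/= (negbTE tT) normr0.
Qed.

Lemma grid_delta (l : 'I_d) : grid h ('e_l : 'rV[int]_d) = h *: 'e_l.
Proof. by apply/rowP => i; rewrite !mxE eqxx/=; case: (_ == _). Qed.

Lemma gridN (a : 'rV[int]_d) : grid h (- a) = - grid h a.
Proof. by apply/rowP => i; rewrite !mxE intrN mulrN. Qed.

Lemma interp0_step x t : 0 < t -> t + Dt < T ->
  v (x, t + Dt) = v (x, t)
    - Dt * (\sum_(l < d) (F l (v (x, t)) (v (x + h *: 'e_l, t))
        - F l (v (x - h *: 'e_l, t)) (v (x, t))) / h)
    + Dt * (c * \int[mu]_z ((A (v (x + round h z, t)) - A (v (x, t)))
        * cut_kernel h lambda z)).
Proof.
move=> t0 tT.
have tT' : 0 < t < T by rewrite t0 (lt_trans _ tT)// ltrDl.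
have tT2 : 0 < t + Dt < T by rewrite tT addr_gt0.
have nN := truncn_lt tT'.
rewrite !interp0E// truncn_step ?(ltW t0)//.
set n := Num.truncn (t / Dt) in nN *; set a := cell_index h x.
have [_ /(_ n a nN) ->] := hU.
congr (_ - Dt * _ + Dt * _).
  apply: eq_bigr => l _; rewrite /Dminus subrK !interp0E//.
  by rewrite -grid_delta -gridN !cell_index_grid.
rewrite (@sum_over_weight _ _ h c lambda h0 (ltW c0) hlambda
  (fun b => A (U n (a + b)) - A (U n a)) (LA * (M + M))).
  congr (_ * _); apply: eq_Rintegral => z _.
  by rewrite interp0E// cell_index_round.
move=> b; rewrite (le_trans (lipA _ _))// ler_wpM2l ?LA_ge0//.
by rewrite (le_trans (ler_normB _ _))// lerD ?UM.
Qed.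

Lemma bdd_meas_interp0 x t : bdd_meas (fun z => v (x + round h z, t)).
Proof.
split; last by exists `|M| => z; exact: interp0_le.
rewrite (_ : (fun _ => _) = (fun z => (fun b : 'rV[int]_d =>
   v (x + grid h b, t)) (round_index h z)))//.
exact: (measurable_fun_round_index h0 (fun b => v (x + grid h b, t))).
Qed.

Lemma scheme_discrete_entropy : discrete_entropy Dt v.
Proof.
move=> k r x t t0 tT.
apply: (@cell_entropy_inequality _ _ c LA LF) => //.
- exact: ltW.
- exact: LA_ge0.
- by move=> l; have [lipF _ _ _] := hF l.
- by move=> l; have [_ _ mF _] := hF l.
- by move=> l; have [_ _ _ mF] := hF l.
- exact: cut_kernel_ge0.
- exact: intg_cut_kernel.
- apply: le_trans cfl; rewrite /CFL lerD2l -/(@kernel_mass R d lambda).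
  have cLA : 0 <= c * LA * Dt by rewrite !mulr_ge0 ?LA_ge0// ltW.
  have := ler_wpM2l cLA (cut_kernel_mass h0 hlambda (d := d)).
  move=> /le_trans; apply.
  by rewrite le_eqVlt; apply/orP; left; apply/eqP; ring.
- apply: measurable_fun_ler => //; exact: measurable_enorm.
- exact: bdd_meas_interp0.
- exact: interp0_step.
Qed.

(** [A] and the fluxes are then constant functions, so the flux differences and nonlocal increments
    vanish and the two sides of the inequality coincide. *)
Lemma degenerate_discrete_entropy (tau : R) : 0 < tau -> LA = 0 -> LF = 0 ->
  discrete_entropy tau v.
Proof.
move=> tau0 LA0 LF0 k r x t t0 tT.
have Ac a b : A a = A b.
  by apply/eqP; rewrite -subr_eq0 -normr_le0; have := lipA a b; rewrite LA0 mul0r.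
have Fc l a b a' b' : F l a b = F l a' b'.
  apply/eqP; rewrite -subr_eq0 -normr_le0; have [lipF _ _ _] := hF l.
  by have := lipF a b a' b'; rewrite LF0 mul0r.
have UE n a : (n < N)%N -> U n a = U 0%N a.
  elim: n => // n IH nN; have [_ /(_ n a (ltnW nN)) ->] := hU.
  rewrite big1; last first.
    by move=> l _; rewrite /Dminus (Fc l _ _ 0 0) [X in _ - X](Fc l _ _ 0 0) subrr mul0r.
  rewrite (@sum_over_weight _ _ h c lambda h0 (ltW c0) hlambda
    (fun b => A (U n (a + b)) - A (U n a)) 0); last first.
    by move=> b; rewrite (Ac _ (U n a)) subrr normr0.
  rewrite (@eq_Rintegral _ _ _ mu setT (fun=> 0)); last first.
    by move=> z _; rewrite (Ac _ (U n a)) subrr mul0r.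
  by rewrite Rintegral_cst// mul0r !mulr0 subr0 addr0 IH ?(ltnW nN).
have vE : v (x, t + tau) = v (x, t).
  have tT' : 0 < t < T by rewrite t0 (lt_trans _ tT)// ltrDl.
  have tT2 : 0 < t + tau < T by rewrite tT addr_gt0.
  by rewrite !interp0E// UE ?truncn_lt// [RHS]UE ?truncn_lt.
rewrite /discrete_entropy_at vE big1; last first.
  move=> l _; rewrite /num_entropy_flux (Fc l _ _ 0 0) [X in _ - X - _](Fc l _ _ 0 0).
  by rewrite [X in _ - (X - _)](Fc l _ _ 0 0) [X in _ - (_ - X)](Fc l _ _ 0 0) !subrr mul0r.
rewrite (@eq_Rintegral _ _ _ mu setT (fun=> 0)); last first.
  by move=> z _; rewrite (Ac _ k) [A (v (x, t))](Ac _ k) subrr mulr0 mul0r.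
rewrite [X in _ + _ * (_ * (_ * X))](@eq_Rintegral _ _ _ mu setT (fun=> 0)); last first.
  by move=> z _; rewrite (Ac _ k) [A (v (x, t))](Ac _ k) subrr mulr0 mul0r.
by rewrite Rintegral_cst// !mul0r !mulr0 subr0 !addr0.
Qed.

End scheme_entropy.

(** * Test functions *)

Section continuous_measurable.
Context {R : realType} {d : nat}.
Local Notation XT d := ('rV[R]_d * measurableTypeR R)%type.

Lemma cvg_rV (u : nat -> 'rV[R]_d) (x : 'rV[R]_d) :
  (forall i, u j ord0 i @[j --> \oo] --> x ord0 i) -> u j @[j --> \oo] --> x.
Proof.
move=> ux B [P xP PB].
have h : \forall j \near \oo, forall i i', P i i' (u j i i').
  apply: (@filter_forall _ 'I_1 (fun i => [set j | forall i', P i i' (u j i i')]) \oo _) => i.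
  apply: (@filter_forall _ 'I_d (fun i' => [set j | P i i' (u j i i')]) \oo _) => i'.
  by rewrite (ord1 i); apply: (ux i'); exact: xP.
by apply: filterS h => j; exact: PB.
Qed.

Lemma cvg_xt (u : nat -> 'rV[R]_d) (s : nat -> R) (x : 'rV[R]_d) (t : R) :
  (forall i, u j ord0 i @[j --> \oo] --> x ord0 i) -> s j @[j --> \oo] --> t ->
  ((u j, s j) : 'rV[R]_d * R) @[j --> \oo] --> ((x, t) : 'rV[R]_d * R).
Proof.
move=> /cvg_rV ux st.
exact: (@cvg_pair _ _ _ \oo (nbhs x) (nbhs t) _ _ _ u s ux st).
Qed.

(** Measurability comes from the coordinates and continuity from the product topology. Sampling
    [psi] at the nodes of finer and finer grids gives measurable functions with countably many
    values that converge pointwise to [psi]. *)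
Lemma continuous_measurable_xt (psi : 'rV[R]_d * R -> R) : continuous psi ->
  measurable_fun setT (psi : XT d -> R).
Proof.
move=> cpsi; pose e (n : nat) : R := n.+1%:R^-1.
have e0 n : 0 < e n by rewrite invr_gt0.
have ecvg : e n @[n --> \oo] --> 0 by exact: cvg_harmonic.
pose q n (p : XT d) : 'rV[int]_d * int :=
  (round_index (e n) p.1, Num.floor ((p.2 : R) / e n + 0)).
pose G n (ab : 'rV[int]_d * int) : R := psi (grid (e n) ab.1, e n * ab.2%:~R).
apply: (@measurable_fun_cvg _ _ _ _ (fun n => G n \o q n)).
  move=> n; apply: measurable_countable_fibers => -[a b].
  rewrite (_ : _ @^-1` _ = (round_index (e n) @^-1` [set a]) `*`
      [set t : R | Num.floor (t / e n + 0) = b]).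
    apply: measurableX; first exact: measurable_round_index.
    exact: measurable_floor.
  by apply/seteqP; split=> -[x t] /= => [[<- <-]|[<- <-]].
move=> -[x t] _; rewrite /G/=.
apply: (@cvg_comp _ _ _ (fun n => (grid (e n) (round_index (e n) x),
   e n * (Num.floor ((t : R) / e n + 0))%:~R) : 'rV[R]_d * R) psi _ _ _ _
   (cpsi ((x, t) : 'rV[R]_d * R))).
apply: cvg_xt; first by move=> i; exact: (cvg_round (h := e)).
apply/cvgrPdist_le => eps eps0.
have : \forall n \near \oo, `|0 - e n| <= eps by move/cvgrPdist_le : ecvg; exact.
apply: filterS => n; rewrite sub0r normrN (gtr0_norm (e0 n)) => /(le_trans _); apply.
rewrite addr0; have /andP[n1 n2] := floor_itv ((t : R) / e n).
move: n1 n2; set m := Num.floor _ => n1 n2.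
have te : (t : R) = e n * ((t : R) / e n) by rewrite mulrCA divff ?mulr1// gt_eqF.
rewrite {1}te -mulrBr normrM (gtr0_norm (e0 n)) ler_piMr ?(ltW (e0 n))//.
by rewrite intrD mulr1z in n2; rewrite ler_norml; apply/andP; split; lra.
Qed.

End continuous_measurable.

Section smooth.
Context {R : realType} {d : nat}.
Local Notation E := ('rV[R]_d * R)%type.
Implicit Types (psi : E -> R) (p v : E).

Lemma quotient_cvg psi p v (s : nat -> R) : derivable psi p v ->
  (forall j, s j != 0) -> s j @[j --> \oo] --> 0 ->
  (psi (p + s j *: v) - psi p) / s j @[j --> \oo] --> 'D_v psi p.
Proof.
move=> dpsi s0 scvg.
have s0' : s j @[j --> \oo] --> 0^'.
  move=> B B0; have := scvg _ B0.
  by apply: (@filterS _ \oo) => j /= h; exact: h (s0 j).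
have := cvg_comp s _ s0' dpsi.
rewrite -/(derive psi p v); apply: cvg_trans; apply: near_eq_cvg.
by apply: nearW => j /=; rewrite [RHS]mulrC [p + _]addrC.
Qed.

Lemma mean_value psi p v (s : R) : (forall p, derivable psi p v) ->
  exists2 xi, `|xi| <= `|s| & psi (p + s *: v) - psi p = s * 'D_v psi (p + xi *: v).
Proof.
move=> dpsi; pose g (a : R) := psi (p + a *: v).
have dg (a : R) : is_derive a 1 g ('D_v psi (p + a *: v)).
  have E a' : (fun h : R => h^-1 *: ((g \o shift a') (h *: 1) - g a')) =
     (fun h : R => h^-1 *: ((psi \o shift (p + a' *: v)) (h *: v) - psi (p + a' *: v))).
    apply/funext => h; rewrite /g/=; congr (_ *: (psi _ - _)).
    by rewrite [h *: 1]mulr1 scalerDl addrCA addrA addrC addrA.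
  apply: DeriveDef.
    by rewrite /derivable E; exact: dpsi.
  by rewrite /derive E.
have cg : continuous g.
  move=> a; apply: differentiable_continuous; apply/derivable1_diffP.
  by case: (dg a).
have [s0|s0|<-] := ltgtP 0 s.
- have [xi] := MVT s0 (fun x _ => dg x) (continuous_subspaceT cg).
  rewrite in_itv/= /g scale0r addr0 subr0 => /andP[x0 xs] ->.
  by exists xi; rewrite ?(gtr0_norm s0) ?gtr0_norm ?(ltW xs)// mulrC.
- have [xi] := MVT s0 (fun x _ => dg x) (continuous_subspaceT cg).
  rewrite in_itv/= /g scale0r addr0 sub0r => /andP[x0 xs] E.
  exists xi; first by rewrite (ltr0_norm s0) ltr0_norm// lerN2 ltW.
  by rewrite -opprB E mulrN opprK mulrC.
- by exists 0; rewrite ?normr0// scale0r addr0 subrr mul0r.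
Qed.

(** The vertices of the path from 0 to [y] that changes one coordinate at a time. *)
Definition coord_part (k : nat) (y : 'rV[R]_d) : 'rV[R]_d :=
  \row_i (if (i < k)%N then y ord0 i else 0).

Lemma coord_partS (k : 'I_d) y :
  coord_part k.+1 y = coord_part k y + y ord0 k *: 'e_k.
Proof.
apply/rowP => i; rewrite !mxE ltnS eqxx/= leq_eqVlt.
case: (eqVneq i k) => [->|ik]; first by rewrite ltnn eqxx add0r mulr1.
by rewrite (negbTE (_ : (i : nat) != k)) ?(inj_eq val_inj)//= mulr0 addr0.
Qed.

(** Telescoping along the path [coord_part], with the mean value theorem on each edge. Only
    derivatives along the axes occur, which suits the definition of [Ck] by directional
    derivatives. *)
Lemma increment_decomposition psi (x y : 'rV[R]_d) (t : R) :
  (forall l p, derivable psi p (('e_l, 0) : E)) ->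
  exists w : 'I_d -> 'rV[R]_d, (forall k i, `|w k ord0 i| <= `|y ord0 i|) /\
  psi (x + y, t) - psi (x, t) =
    \sum_(k < d) y ord0 k * 'D_(('e_k, 0) : E) psi (x + w k, t).
Proof.
move=> dpsi.
have step (k : 'I_d) : exists w : 'rV[R]_d, (forall i, `|w ord0 i| <= `|y ord0 i|) /\
   psi (x + coord_part k.+1 y, t) - psi (x + coord_part k y, t) =
   y ord0 k * 'D_(('e_k, 0) : E) psi (x + w, t).
  have [xi xiy] := mean_value (x + coord_part k y, t) (y ord0 k) (dpsi k).
  have sc (a : R) : (x + coord_part k y, t) + a *: (('e_k, 0) : E) =
      (x + (coord_part k y + a *: 'e_k), t).
    by congr (_, _) => /=; rewrite ?addrA// [a *: 0]mulr0 addr0.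
  rewrite !sc -coord_partS => E; exists (coord_part k y + xi *: 'e_k); split=> // i.
  rewrite !mxE eqxx/=; case: (eqVneq i k) => [->|ik].
    by rewrite ltnn add0r mulr1.
  by rewrite mulr0 addr0; case: ifP => // _; rewrite normr0.
have [w hw] := choice step.
exists w; split; first by move=> k i; have [] := hw k.
rewrite -(eq_bigr _ (fun k _ => (hw k).2)).
rewrite -(big_mkord xpredT (fun k => psi (x + coord_part k.+1 y, t) - psi (x + coord_part k y, t))).
rewrite telescope_sumr//.
have -> : coord_part d y = y by apply/rowP => i; rewrite mxE ltn_ord.
have -> : coord_part 0 y = 0 by apply/rowP => i; rewrite !mxE.
by rewrite addr0.
Qed.

End smooth.

Section test_functions.
Context {R : realType} {d : nat}.
Local Notation E := ('rV[R]_d * R)%type.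
Implicit Types (psi phi : E -> R) (p v : E) (K : set E).

Lemma compact_subset_box (T : R) K : compact K -> K `<=` QT T ->
  exists m : nat, forall p, K p ->
    (forall i, `|p.1 ord0 i| <= m.+1%:R) /\ m.+1%:R^-1 <= p.2 <= T - m.+1%:R^-1.
Proof.
(* In near-covering form, compactness turns a bound valid near each point for all large [m] into one
   [m] valid on all of [K]. *)
move=> cK KQ; have /compact_near_coveringP nK := cK.
pose P (m : nat) (p : E) := (forall i, `|p.1 ord0 i| <= m.+1%:R) /\
  m.+1%:R^-1 <= p.2 <= T - m.+1%:R^-1.
have [m _ hm] : \forall m \near \oo, K `<=` P m.
  apply: (nK nat \oo P _) => -[x t] Kp.
  have [_] := KQ _ Kp; rewrite /= in_itv/= => /andP[t0 tT].
  (* Times within [e] of [t] stay at distance at least [e] from both ends, 2 e being at most t and T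
     - t. *)
  pose e := Num.min t (T - t) / 2.
  have e0 : 0 < e by rewrite divr_gt0// lt_min t0 subr_gt0.
  have e1 : 2 * e <= t by rewrite mulrC divfK// ge_min lexx.
  have e2 : 2 * e <= T - t by rewrite mulrC divfK// ge_min lexx orbT.
  pose B := enorm x + 1.
  have hm : \forall m \near \oo, B <= m.+1%:R /\ m.+1%:R^-1 <= e.
    exists (Num.truncn (B + e^-1)) => // m /= Bm.
    have mB : B + e^-1 < m.+1%:R.
      by apply: (lt_le_trans (truncnS_gt _)); rewrite ler_nat.
    have B0 : 0 <= B by rewrite addr_ge0// enorm_ge0.
    have ei0 : 0 < e^-1 by rewrite invr_gt0.
    split; first by apply: ltW; apply: le_lt_trans mB; rewrite lerDl ltW.
    rewrite -[leRHS]invrK lef_pV2 ?posrE//.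
    by apply: ltW; apply: le_lt_trans mB; rewrite lerDr.
  have hx : \forall q \near ((x, t) : E), (forall i, `|(q : E).1 ord0 i - x ord0 i| < 1) /\
      `|q.2 - t| < e.
    have c1 : (fst : E -> 'rV[R]_d) q @[q --> ((x, t) : E)] --> x by exact: cvg_fst.
    have c2 : (snd : E -> R) q @[q --> ((x, t) : E)] --> t by exact: cvg_snd.
    have h1 : \forall q \near ((x, t) : E), forall i, `|(q : E).1 ord0 i - x ord0 i| < 1.
      apply: (c1 [set y : 'rV[R]_d | forall i, `|y ord0 i - x ord0 i| < 1]).
      apply: (@filter_forall _ 'I_d (fun i => [set y : 'rV[R]_d |
        `|y ord0 i - x ord0 i| < 1]) (nbhs x) _) => i.
      apply: (@coord_continuous _ _ _ ord0 i x [set b | `|b - x ord0 i| < 1]).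
      have := @nbhsx_ballx _ _ (x ord0 i) 1 ltr01.
      by apply: filterS => b; rewrite /ball/= distrC.
    have h2 : \forall q \near ((x, t) : E), `|q.2 - t| < e.
      apply: (c2 [set s | `|s - t| < e]).
      have := @nbhsx_ballx _ _ t e e0.
      by apply: filterS => b; rewrite /ball/= distrC.
    by apply: filterS2 h1 h2.
  exists ([set q : E | (forall i, `|q.1 ord0 i - x ord0 i| < 1) /\ `|q.2 - t| < e],
     [set m : nat | B <= m.+1%:R /\ m.+1%:R^-1 <= e]) => //=.
  move=> -[[y s] m] /= [[yx st] [Bm me]]; split=> /= [i|].
    apply: le_trans Bm; rewrite /B.
    rewrite -[y ord0 i](subrK (x ord0 i)) (le_trans (ler_normD _ _))//.
    by rewrite addrC lerD ?coord_le_enorm// ltW// yx.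
  have aux1 (a b u w : R) : a <= b -> 2 * b <= u -> - b < w - u -> a <= w.
    by move=> *; lra.
  have aux2 (a b u w : R) : a <= b -> 2 * b <= T - u -> w - u < b -> w <= T - a.
    by move=> *; lra.
  move: st; rewrite ltr_norml => /andP[s1 s2].
  by rewrite (aux1 _ _ _ _ me e1 s1) (aux2 _ _ _ _ me e2 s2).
by exists m => p Kp; exact: (hm m (leqnn m)).
Qed.

Lemma continuous_support_bounded psi K : continuous psi -> compact K ->
  (forall p, ~ K p -> psi p = 0) -> exists C, forall p, `|psi p| <= C.
Proof.
move=> cpsi cK psi0.
have [M [_ hM]] := compact_bounded (continuous_compact (continuous_subspaceT cpsi) cK).
exists (`|M| + 1) => p; have [Kp|nKp] := pselect (K p); last first.
  by rewrite psi0// normr0.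
by apply: hM; [rewrite ltr_pwDr// ler_norm|exists p].
Qed.

Lemma derive_off_support psi K v : compact K -> (forall p, ~ K p -> psi p = 0) ->
  forall p, ~ K p -> 'D_v psi p = 0.
Proof.
move=> cK psi0 p nKp; rewrite (near_eq_derive (g := cst 0)) ?derive_cst//.
have oK : open (~` K) by rewrite openC; apply: compact_closed => //; exact: norm_hausdorff.
by have := open_nbhs_nbhs (conj oK nKp); apply: filterS => q; exact: psi0.
Qed.

Lemma quotient_le psi v C : (forall p, derivable psi p v) ->
  (forall p, `|'D_v psi p| <= C) ->
  forall p (s : R), `|(psi (p + s *: v) - psi p) / s| <= C.
Proof.
move=> dpsi DC p s; have [->|s0] := eqVneq s 0.
  by rewrite invr0 mulr0 normr0; exact: le_trans (DC p).
have [xi _ ->] := mean_value p s dpsi.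
by rewrite mulrAC divff// mul1r.
Qed.

Lemma coord_lipschitz psi C :
  (forall l p, derivable psi p (('e_l, 0) : E)) ->
  (forall l p, `|'D_(('e_l, 0) : E) psi p| <= C) ->
  forall x y t, `|psi (x + y, t) - psi (x, t)| <= C * \sum_(k < d) `|y ord0 k|.
Proof.
move=> dpsi DC x y t; have [w [_ ->]] := increment_decomposition x y t dpsi.
rewrite mulr_sumr; apply: le_trans (ler_norm_sum _ _ _) _.
by apply: ler_sum => k _; rewrite normrM mulrC ler_wpM2r.
Qed.

(** The increments along y and - y expand over the same axes with opposite factors, and the partial
    derivatives are compared at points whose i-th coordinates differ by at most 2 |y_i|. With S the
    sum of the |y_i| this gives 2 C S^2, and S <= d |y|. *)
Lemma second_difference_le phi C : 0 <= C ->
  (forall l p, derivable phi p (('e_l, 0) : E)) ->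
  (forall l k p, derivable ('D_(('e_l, 0) : E) phi) p (('e_k, 0) : E)) ->
  (forall l k p, `|'D_(('e_k, 0) : E) ('D_(('e_l, 0) : E) phi) p| <= C) ->
  forall x y t, `|phi (x + y, t) + phi (x - y, t) - 2 * phi (x, t)| <=
    2 * C * d%:R ^+ 2 * enorm y ^+ 2.
Proof.
move=> C0 dphi ddphi DC x y t.
have [w [wy E1]] := increment_decomposition x y t dphi.
have [w' [wy' E2]] := increment_decomposition x (- y) t dphi.
have -> : phi (x + y, t) + phi (x - y, t) - 2 * phi (x, t) =
    (phi (x + y, t) - phi (x, t)) + (phi (x - y, t) - phi (x, t)) by ring.
pose S := \sum_(k < d) `|y ord0 k|.
have S0 : 0 <= S by apply: sumr_ge0.
have Sd : S <= d%:R * enorm y.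
  rewrite (le_trans (ler_sum _ (G := fun=> enorm y) _))//.
    by move=> k _; exact: coord_le_enorm.
  by rewrite sumr_const card_ord -[leLHS]mulr_natl lexx.
rewrite E1 E2 -big_split/=.
apply: (@le_trans _ _ (2 * C * S ^+ 2)); last first.
  rewrite -[leRHS]mulrA ler_wpM2l ?mulr_ge0// -exprMn.
  by rewrite lerXn2r ?nnegrE// mulr_ge0// enorm_ge0.
apply: le_trans (ler_norm_sum _ _ _) _.
apply: (@le_trans _ _ (\sum_(k < d) `|y ord0 k| * (2 * C * S))); last first.
  by rewrite -mulr_suml -/S le_eqVlt; apply/orP; left; apply/eqP; ring.
apply: ler_sum => k _.
rewrite mxE mulNr -mulrBr normrM ler_wpM2l//.
have -> : x + w k = (x + w' k) + (w k - w' k) by rewrite -addrA subrKC.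
have := coord_lipschitz (ddphi k) (DC k) (x + w' k) (w k - w' k) t.
move=> /le_trans; apply.
have -> : 2 * C * S = C * (S * 2) by ring.
rewrite ler_wpM2l// /S mulr_suml; apply: ler_sum => i _.
rewrite !mxE (le_trans (ler_normB _ _))// mulr_natr mulr2n lerD//.
by apply: le_trans (wy' k i) _; rewrite mxE normrN.
Qed.

End test_functions.

(** * Local convergence of translates *)

Section local_convergence.
Context {R : realType} {d : nat}.
Local Notation XT d := ('rV[R]_d * measurableTypeR R)%type.
Local Notation E := ('rV[R]_d * R)%type.
Local Notation nu := (lebesgue_xt d).
Implicit Types (p q : XT d) (f g k : XT d -> R).

Lemma xt_shiftNK (q : XT d) : cancel (xt_shift q) (xt_shift (- q.1, - (q.2 : R))).
Proof. by case=> x t; rewrite /xt_shift/= !addrK. Qed.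

Lemma Rint_xt_shift (q : XT d) (f : XT d -> R) : measurable_fun setT f ->
  \int[nu]_p f (xt_shift q p) = \int[nu]_p f p.
Proof.
exact: (Rint_map (measurable_xt_shift q) (lebesgue_xt_shift q)).
Qed.

Lemma intg_xt_shift (q : XT d) (f : XT d -> R) :
  nu.-integrable setT (EFin \o f) ->
  nu.-integrable setT (EFin \o (fun p => f (xt_shift q p))).
Proof.
exact: (intg_map (measurable_xt_shift q) (lebesgue_xt_shift q)).
Qed.

Lemma Rint_xt_shift_mul (q : XT d) (a g : XT d -> R) : measurable_fun setT a ->
  measurable_fun setT g ->
  \int[nu]_p (a (xt_shift q p) * g p) =
  \int[nu]_p (a p * g (xt_shift (- q.1, - (q.2 : R)) p)).
Proof.
move=> ma mg; rewrite -[RHS](Rint_xt_shift q).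
  by apply: eq_Rintegral => p _; rewrite xt_shiftNK.
apply: measurable_funM => //; apply: measurableT_comp mg _.
exact: measurable_xt_shift.
Qed.

Lemma ae_xt_shift (q : XT d) (P : XT d -> Prop) : {ae nu, forall p, P p} ->
  {ae nu, forall p, P (xt_shift q p)}.
Proof.
move=> [N [mN N0 hN]]; exists (xt_shift q @^-1` N); split.
- by rewrite -[X in measurable X]setTI; exact: measurable_xt_shift.
- by rewrite lebesgue_xt_shift.
- by move=> p /= nP; exact: hN.
Qed.

Variable D : set (XT d).
Hypotheses (mD : measurable D) (nuD : (nu D < +oo)%E).

(** The integrability clause gives the limit its meaning: a real-valued integral that diverges to
    infinity counts as 0. *)
Definition cvgL1 (f_ : nat -> XT d -> R) (f : XT d -> R) : Prop :=
  (forall j, nu.-integrable setT (EFin \o (fun p => \1_D p * (f_ j p - f p)))) /\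
  \int[nu]_p (\1_D p * `|f_ j p - f p|) @[j --> \oo] --> 0.

Lemma indic_ge0' p : 0 <= \1_D p :> R.
Proof. by rewrite indicE. Qed.

Lemma intg_indicM (f : XT d -> R) (C : R) : measurable_fun setT f ->
  (forall p, `|f p| <= C) -> nu.-integrable setT (EFin \o (fun p => \1_D p * f p)).
Proof.
move=> mf fC; rewrite (_ : (fun p => _) = fun p => f p * \1_D p); last first.
  by apply/funext => p; rewrite mulrC.
apply: (intg_bddM mf fC); first exact: indic_ge0'.
exact: intg_indic.
Qed.

Lemma intg_indic_norm (f : XT d -> R) :
  nu.-integrable setT (EFin \o (fun p => \1_D p * f p)) ->
  nu.-integrable setT (EFin \o (fun p => \1_D p * `|f p|)).
Proof.
move=> fi; have := intg_norm fi; apply: eq_integrable => // p _ /=.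
by rewrite normrM (ger0_norm (indic_ge0' p)).
Qed.

Lemma intg_cvgL1 (f_ : nat -> XT d -> R) f (C : R) : (forall j, measurable_fun setT (f_ j)) ->
  (forall j p, `|f_ j p| <= C) -> cvgL1 f_ f ->
  nu.-integrable setT (EFin \o (fun p => \1_D p * f p)).
Proof.
move=> mf fC [ff _].
rewrite (_ : (fun p => _) = fun p => \1_D p * f_ 0%N p - \1_D p * (f_ 0%N p - f p)).
  by apply: intgB => //; apply: intg_indicM (fC 0%N).
by apply/funext => p; ring.
Qed.

Lemma cvgL1_dom (f_ : nat -> XT d -> R) f (g_ : nat -> XT d -> R) g (L : R) : 0 <= L ->
  (forall j, measurable_fun setT (g_ j)) -> measurable_fun setT g ->
  (forall j p, D p -> `|g_ j p - g p| <= L * `|f_ j p - f p|) ->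
  cvgL1 f_ f -> cvgL1 g_ g.
Proof.
move=> L0 mg_ mg gL [fi fcvg].
have dom j p : `|\1_D p * (g_ j p - g p)| <= L * (\1_D p * `|f_ j p - f p|).
  rewrite normrM (ger0_norm (indic_ge0' p)) mulrCA indicE.
  have [Dp|nDp] := boolP (p \in D); last by rewrite !mul0r.
  by rewrite !mul1r; apply: gL; rewrite inE in Dp.
have gi j : nu.-integrable setT (EFin \o (fun p => \1_D p * (g_ j p - g p))).
  apply: (intg_le _ (intgZ L (intg_indic_norm (fi j))) (dom j)).
  apply: measurable_funM; first exact: measurable_indic.
  exact: measurable_funB.
split=> //; apply: (@squeeze_cvgr _ _ _ _ (cst 0) (fun j => L *
    \int[nu]_p (\1_D p * `|f_ j p - f p|))).
- apply: nearW => j /=; apply/andP; split.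
    by apply: Rintegral_ge0 => p _; rewrite mulr_ge0// indic_ge0'.
  rewrite -RintZ; last exact: intg_indic_norm.
  apply: le_Rint; [exact: intg_indic_norm|exact/intgZ/intg_indic_norm|].
  by move=> p; have := dom j p; rewrite normrM (ger0_norm (indic_ge0' p)).
- exact: cvg_cst.
- by rewrite -(mulr0 L); apply: cvgMr.
Qed.

Lemma cvgL1_add (f_ : nat -> XT d -> R) f (g_ : nat -> XT d -> R) g
    (k_ : nat -> XT d -> R) k (L : R) : 0 <= L ->
  (forall j, measurable_fun setT (k_ j)) -> measurable_fun setT k ->
  (forall j p, `|k_ j p - k p| <= L * (`|f_ j p - f p| + `|g_ j p - g p|)) ->
  cvgL1 f_ f -> cvgL1 g_ g -> cvgL1 k_ k.
Proof.
move=> L0 mk_ mk kL [fi fcvg] [gi gcvg].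
apply: (@cvgL1_dom (fun j p => `|f_ j p - f p| + `|g_ j p - g p|) (fun=> 0) _ _ L L0) => //.
  by move=> j p _; rewrite subr0 [X in _ <= _ * X]ger0_norm// addr_ge0.
have E0 j : (fun p => \1_D p * (`|f_ j p - f p| + `|g_ j p - g p| - 0)) =
   fun p => \1_D p * `|f_ j p - f p| + \1_D p * `|g_ j p - g p|.
  by apply/funext => p; ring.
split.
  by move=> j; rewrite E0; apply: intgD; exact: intg_indic_norm.
have E1 j : \int[nu]_p (\1_D p * Num.norm (`|f_ j p - f p| + `|g_ j p - g p| - 0)) =
   \int[nu]_p (\1_D p * `|f_ j p - f p|) + \int[nu]_p (\1_D p * `|g_ j p - g p|).
  rewrite -RintD; [|exact: intg_indic_norm..].
  by apply: eq_Rintegral => p _; rewrite subr0 ger0_norm ?addr_ge0// mulrDr.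
under eq_fun do rewrite E1.
by rewrite -[0](addr0 0); apply: cvgD.
Qed.

(** The difference of the products is (f_j - f) g_j, small in L^1 because g_j is bounded and
    vanishes off [D], plus f (g_j - g), treated by dominated convergence with majorant Cg |f| on
    [D]. *)
Lemma cvg_Rint_product (f_ : nat -> XT d -> R) f
    (g_ : nat -> XT d -> R) g (Cf Cg : R) :
  (forall j, measurable_fun setT (f_ j)) -> measurable_fun setT f ->
  (forall j, measurable_fun setT (g_ j)) -> measurable_fun setT g ->
  (forall j p, `|f_ j p| <= Cf) -> (forall j p, `|g_ j p| <= Cg) ->
  (forall j p, ~ D p -> g_ j p = 0) ->
  (forall p, g_ j p @[j --> \oo] --> g p) -> cvgL1 f_ f ->
  nu.-integrable setT (EFin \o (fun p => f p * g p)) /\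
  \int[nu]_p (f_ j p * g_ j p) @[j --> \oo] --> \int[nu]_p (f p * g p).
Proof.
move=> mf_ mf mg_ mg fC gC gD gg ff; have [fi fcvg] := ff.
have iDf := intg_cvgL1 mf_ fC ff.
have Cg0 : 0 <= Cg by exact: le_trans (gC 0%N point).
have gD' p : ~ D p -> g p = 0.
  move=> nDp; have := gg p; under eq_fun do rewrite gD//.
  by move=> /(cvg_unique _ (cvg_cst 0)) <-.
have gC' p : `|g p| <= Cg.
  have gn : `|g_ j p| @[j --> \oo] --> `|g p| by apply: cvg_norm; exact: gg.
  rewrite -(cvg_lim _ gn)//; apply: limr_le; first by apply/cvg_ex; exists `|g p|.
  by apply: nearW => j; exact: gC.
have dom (k : XT d -> R) (a : XT d -> R) p : (~ D p -> k p = 0) -> `|k p| <= Cg ->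
    `|a p * k p| <= Cg * (\1_D p * `|a p|).
  move=> kD kC; rewrite normrM mulrC indicE.
  have [Dp|nDp] := boolP (p \in D); first by rewrite mul1r ler_wpM2r.
  rewrite mul0r mulr0 kD ?normr0 ?mul0r//.
  by rewrite notin_setE in nDp.
have ifg_ j : nu.-integrable setT (EFin \o (fun p => f p * g_ j p)).
  apply: (intg_le _ (intgZ Cg (intg_indic_norm iDf))).
    exact: measurable_funM.
  by move=> p; apply: dom => //; exact: gD.
have iffg_ j : nu.-integrable setT (EFin \o (fun p => (f_ j p - f p) * g_ j p)).
  apply: (intg_le _ (intgZ Cg (intg_indic_norm (fi j)))).
    by apply: measurable_funM => //; exact: measurable_funB.
  by move=> p; apply: (dom (g_ j) (fun p => f_ j p - f p)) => //; exact: gD.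
split.
  apply: (intg_le _ (intgZ Cg (intg_indic_norm iDf))).
    exact: measurable_funM.
  by move=> p; apply: dom => //; exact: gD'.
have E1 j : \int[nu]_p (f_ j p * g_ j p) =
    \int[nu]_p ((f_ j p - f p) * g_ j p) + \int[nu]_p (f p * g_ j p).
  by rewrite -RintD//; apply: eq_Rintegral => p _; ring.
under eq_fun do rewrite E1.
rewrite -[X in nbhs X]add0r; apply: cvgD.
  apply/norm_cvg0P; apply: (@squeeze_cvgr _ _ _ _ (cst 0) (fun j => Cg *
    \int[nu]_p (\1_D p * `|f_ j p - f p|))).
  - apply: nearW => j /=; rewrite normr_ge0/= -RintZ; last exact: intg_indic_norm.
    apply: ler_norm_Rint => //; first exact/intgZ/intg_indic_norm.
    by move=> p; apply: (dom (g_ j) (fun p => f_ j p - f p)) => //; exact: gD.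
  - exact: cvg_cst.
  - by rewrite -(mulr0 Cg); apply: cvgMr.
apply: (cvg_Rint (g := fun p => Cg * (\1_D p * `|f p|))).
- by move=> j; exact: measurable_funM.
- exact: measurable_funM.
- by apply: aeW => p; apply: cvgMr; exact: gg.
- exact/intgZ/intg_indic_norm.
- by move=> j p; apply: dom => //; exact: gD.
Qed.

End local_convergence.

Lemma four_quarters (R : realType) (a b c x : R) :
  a <= x / 4 -> b <= x / 4 -> c <= x / 4 -> a + b + b + c <= x.
Proof. by move=> *; lra. Qed.

Section shift_convergence.
Context {R : realType} {d : nat}.
Local Notation XT d := ('rV[R]_d * measurableTypeR R)%type.
Local Notation E := ('rV[R]_d * R)%type.
Local Notation nu := (lebesgue_xt d).
Variables (v : nat -> E -> R) (u : E -> R) (M : R).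
Hypothesis mv : forall j, measurable_fun setT (v j : XT d -> R).
Hypothesis mu_ : measurable_fun setT (u : XT d -> R).
Hypothesis vM : forall j p, `|v j p| <= M.
Hypothesis vlc : forall j, {ae nu, forall p : XT d,
  \forall q \near (p : E), v j q = v j p}.
Hypothesis ivu : forall j,
  nu.-integrable setT (EFin \o (fun p : XT d => v j p - u p)).
Hypothesis vu : \int[nu]_p `|v j p - u p| @[j --> \oo] --> 0.

Variable D : set (XT d).
Hypotheses (mD : measurable D) (nuD : (nu D < +oo)%E).

Let mshift (f : E -> R) (q : XT d) : measurable_fun setT (f : XT d -> R) ->
  measurable_fun setT (fun p : XT d => f (xt_shift q p)).
Proof. by move=> mf; apply: measurableT_comp mf _; exact: measurable_xt_shift. Qed.

Let idiff (f : E -> R) (q : XT d) :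
  nu.-integrable setT (EFin \o (f : XT d -> R)) ->
  nu.-integrable setT (EFin \o (fun p : XT d => \1_D p * f (xt_shift q p))).
Proof.
move=> fi; apply: (intg_le _ (intg_norm (intg_xt_shift q fi))).
  apply: measurable_funM; first exact: measurable_indic.
  exact: mshift (intg_measurable fi).
move=> p; rewrite normrM indicE; case: (_ \in _); rewrite ?normr1 ?mul1r//.
by rewrite normr0 mul0r.
Qed.

Let idiff_le (f : E -> R) (q : XT d) :
  nu.-integrable setT (EFin \o (f : XT d -> R)) ->
  \int[nu]_p (\1_D p * `|f (xt_shift q p)|) <= \int[nu]_p `|f p|.
Proof.
move=> fi; rewrite -[leRHS](Rint_xt_shift q (f := fun p => `|f p|)); last first.
  by apply: measurableT_comp => //; exact: intg_measurable fi.
apply: le_Rint.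
- exact: (idiff q (intg_norm fi)).
- exact: (intg_xt_shift q (intg_norm fi)).
- by move=> p; rewrite indicE; case: (_ \in _); rewrite ?mul1r// mul0r.
Qed.

(* [v J] serves, for one fixed large [J], as an approximation of [u] by a
   function that is continuous almost everywhere. *)
Lemma cvgL1_shift (y : nat -> 'rV[R]_d) (s : nat -> R) (z : 'rV[R]_d) :
  (forall i, y j ord0 i @[j --> \oo] --> z ord0 i) ->
  s j @[j --> \oo] --> 0 ->
  cvgL1 D (fun j p => v j (xt_shift (y j, s j) p)) (fun p => u (xt_shift (z, 0) p)).
Proof.
move=> yz s0.
pose e j := \int[nu]_p `|v j p - u p|.
pose w J j (p : XT d) := v J (xt_shift (y j, s j) p) - v J (xt_shift (z, 0) p).
have mw J j : measurable_fun setT (w J j) by apply: measurable_funB; exact: mshift.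
have wM J j p : `|w J j p| <= M + M.
  by rewrite (le_trans (ler_normB _ _))// lerD.
have iw J j : nu.-integrable setT (EFin \o (fun p => \1_D p * w J j p)).
  exact: (intg_indicM mD nuD (mw J j) (wM J j)).
(* The error of [v j] and that of [v J] at the moving translate, the oscillation of [v J] between
   the two translates, and the error of [v J] at the limiting one. By translation invariance the
   three errors cost [e j], [e J] and [e J]. *)
have dec J j p : v j (xt_shift (y j, s j) p) - u (xt_shift (z, 0) p) =
   (v j (xt_shift (y j, s j) p) - u (xt_shift (y j, s j) p))
   - (v J (xt_shift (y j, s j) p) - u (xt_shift (y j, s j) p))
   + w J j p + (v J (xt_shift (z, 0) p) - u (xt_shift (z, 0) p)).
  by rewrite /w; ring.
have i1 J j : nu.-integrable setT (EFin \o (fun p =>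
     \1_D p * (v J (xt_shift (y j, s j) p) - u (xt_shift (y j, s j) p)))).
  exact: (idiff (y j, s j) (ivu J)).
have i2 J : nu.-integrable setT (EFin \o (fun p =>
     \1_D p * (v J (xt_shift (z, 0) p) - u (xt_shift (z, 0) p)))).
  exact: (idiff (z, 0) (ivu J)).
have ii j : nu.-integrable setT (EFin \o (fun p =>
    \1_D p * (v j (xt_shift (y j, s j) p) - u (xt_shift (z, 0) p)))).
  rewrite (_ : (fun p => _) = fun p =>
    (\1_D p * (v j (xt_shift (y j, s j) p) - u (xt_shift (y j, s j) p))
     - \1_D p * (v j (xt_shift (y j, s j) p) - u (xt_shift (y j, s j) p)))
    + \1_D p * w j j p
    + \1_D p * (v j (xt_shift (z, 0) p) - u (xt_shift (z, 0) p))).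
    by apply: intgD => //; apply: intgD => //; exact: intgB.
  by apply/funext => p; rewrite (dec j); ring.
split=> //.
have le_e J j : \int[nu]_p (\1_D p * `|v j (xt_shift (y j, s j) p) - u (xt_shift (z, 0) p)|)
   <= (e j + e J + e J) + \int[nu]_p (\1_D p * `|w J j p|).
  apply: (@le_trans _ _ (\int[nu]_p
     (\1_D p * `|v j (xt_shift (y j, s j) p) - u (xt_shift (y j, s j) p)|
      + \1_D p * `|v J (xt_shift (y j, s j) p) - u (xt_shift (y j, s j) p)|
      + \1_D p * `|v J (xt_shift (z, 0) p) - u (xt_shift (z, 0) p)|
      + \1_D p * `|w J j p|))).
    apply: le_Rint.
    - exact: (intg_indic_norm (ii j)).
    - by do 3 (apply: intgD; last exact: intg_indic_norm); exact: intg_indic_norm.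
    - move=> p; rewrite -!mulrDr ler_wpM2l ?indic_ge0'// (dec J).
      rewrite (le_trans (ler_normD _ _))//.
      rewrite [leRHS](_ : _ = `|v j (xt_shift (y j, s j) p) - u (xt_shift (y j, s j) p)|
         + `|v J (xt_shift (y j, s j) p) - u (xt_shift (y j, s j) p)|
         + `|w J j p| + `|v J (xt_shift (z, 0) p) - u (xt_shift (z, 0) p)|); last by ring.
      by rewrite lerD2r (le_trans (ler_normD _ _))// lerD2r ler_normB.
  rewrite RintD; last 2 first.
  - by do 2 (apply: intgD; last exact: intg_indic_norm); exact: intg_indic_norm.
  - exact: intg_indic_norm.
  rewrite lerD2r RintD; last 2 first.
  - by apply: intgD; exact: intg_indic_norm.
  - exact: intg_indic_norm.
  rewrite RintD; [|exact: intg_indic_norm..].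
  apply: lerD; first apply: lerD.
  - exact: (idiff_le (y j, s j) (ivu j)).
  - exact: (idiff_le (y j, s j) (ivu J)).
  - exact: (idiff_le (z, 0) (ivu J)).
have wcvg J : \int[nu]_p (\1_D p * `|w J j p|) @[j --> \oo] --> 0.
  have -> : (0 : R) = \int[nu]_p (cst 0 p) by rewrite Rintegral_cst// mul0r.
  apply: (cvg_Rint (g := fun p => \1_D p * (M + M))).
  - move=> j; apply: measurable_funM; first exact: measurable_indic.
    exact: measurableT_comp.
  - exact: measurable_cst.
  (* For almost every point [v J] is constant near its translate by z, which the moving translates
     approach: the oscillation is eventually 0. *)
  - have := ae_xt_shift (z, 0 : measurableTypeR R) (vlc J).
    apply: filterS => p hp.
    have yc : ((p.1 + y j, (p.2 : R) + s j) : E) @[j --> \oo] -->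
        ((p.1 + z, (p.2 : R) + 0) : E).
      apply: cvg_xt.
        by move=> i; under eq_fun do rewrite mxE; rewrite mxE; apply: cvgD => //; exact: cvg_cst.
      by apply: cvgD => //; exact: cvg_cst.
    have := yc _ hp; rewrite /nbhs/= => hj.
    suff H : \forall j \near \oo, \1_D p * `|w J j p| = 0.
      exact: (@cvg_near_cst nat R 0 (fun j => \1_D p * `|w J j p|) \oo _ H).
    move: hj; apply: filterS => j /= hj.
    rewrite /w/= [v J (xt_shift (y j, s j) p)](_ : _ = v J (xt_shift (z, 0) p))//.
    by rewrite subrr normr0 mulr0.
  - by apply: (@intg_indicM _ _ D mD nuD (cst (M + M)) `|M + M|).
  - move=> j p; rewrite normrM normr_id (ger0_norm (indic_ge0' _ _)).
    by rewrite ler_wpM2l// indic_ge0'.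
apply/cvgrPdist_le => eps eps0.
have e4 : 0 < eps / 4 by rewrite divr_gt0.
have hJ : \forall j \near \oo, e j <= eps / 4.
  have /cvgrPdist_le/(_ _ e4) := vu; apply: filterS => j.
  by rewrite sub0r normrN; apply: le_trans; exact: ler_norm.
have [J _ hJ'] := hJ.
have eJ : e J <= eps / 4 by apply: hJ' => /=.
have hw : \forall j \near \oo, \int[nu]_p (\1_D p * `|w J j p|) <= eps / 4.
  have /cvgrPdist_le/(_ _ e4) := wcvg J; apply: filterS => j.
  by rewrite sub0r normrN; apply: le_trans; exact: ler_norm.
apply: filterS2 hJ hw => j h1 h2.
rewrite sub0r normrN ger0_norm.
  exact: le_trans (le_e J j) (four_quarters h1 eJ h2).
by apply: Rintegral_ge0 => p _; rewrite mulr_ge0// indic_ge0'.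
Qed.

End shift_convergence.

Section xt_sigma_finite.
Context {R : realType} (d : nat).
Local Notation XT d := ('rV[R]_d * measurableTypeR R)%type.

(* The canonical sigma-finite structure of products is shadowed in the library
   by the one for subprobabilities, hence this alias. *)
Definition xt_measure : set (XT d) -> \bar R := lebesgue_xt d.

Arguments xt_measure : clear implicits.
HB.instance Definition _ := Measure.on xt_measure.

Let xt_sigma_finite : sigma_finite setT xt_measure.
Proof.
have /sigma_finiteP[F [TF ndF Foo]] := sigma_finiteT (@lebesgue_rV R d).
have /sigma_finiteP[G [TG ndG Goo]] := sigma_finiteT (@lebesgue_measure R).
exists (fun k => F k `*` G k).
  rewrite -setXTT TF TG; apply/seteqP; split=> -[x y] /=; last first.
    by move=> [k _ [? ?]]; split; exists k.
  move=> [[i _ Fx] [j _ Gy]]; exists (maxn i j) => //; split.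
  - by move: x Fx; exact/subsetPset/ndF/leq_maxl.
  - by move: y Gy; exact/subsetPset/ndG/leq_maxr.
move=> k; have [mF Fk] := Foo k; have [mG Gk] := Goo k.
split; first exact: measurableX.
by rewrite /xt_measure product_measure1E// lte_mul_pinfty// ge0_fin_numE.
Qed.

HB.instance Definition _ :=
  Measure_isSigmaFinite.Build _ _ _ xt_measure xt_sigma_finite.

End xt_sigma_finite.

Arguments xt_measure {R} d.

(** * Moving the nonlocal operator to the test function *)

Section adjoint.
Context {R : realType} {d : nat}.
Local Notation XT d := ('rV[R]_d * measurableTypeR R)%type.
Local Notation nu := (lebesgue_xt d).
Local Notation mu := (@lebesgue_rV R d).
Implicit Types (p q : XT d).

Lemma intg_bddMl dd (X : measurableType dd) (m : {measure set X -> \bar R})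
    (a phi : X -> R) (C : R) : measurable_fun setT a ->
  (forall x, `|a x| <= C) -> m.-integrable setT (EFin \o phi) ->
  m.-integrable setT (EFin \o (fun x => a x * phi x)).
Proof.
move=> ma aC iphi; apply: (intg_le _ (intgZ C (intg_norm iphi))).
  exact: (measurable_funM ma (intg_measurable iphi)).
by move=> p; rewrite normrM ler_wpM2r.
Qed.

Lemma adjoint_shift (a phi : XT d -> R) q (C : R) : measurable_fun setT a ->
  (forall p, `|a p| <= C) -> nu.-integrable setT (EFin \o phi) ->
  \int[nu]_p ((a (xt_shift q p) - a p) * phi p) =
  \int[nu]_p (a p * (phi (xt_shift (- q.1, - (q.2 : R)) p) - phi p)).
Proof.
move=> ma aC iphi; have mphi := intg_measurable iphi.
have iaphi := intg_bddMl ma aC iphi.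
have masq : measurable_fun setT (fun p => a (xt_shift q p)).
  by apply: measurableT_comp ma _; exact: measurable_xt_shift.
rewrite (@eq_Rintegral _ _ _ nu setT (fun p => a (xt_shift q p) * phi p - a p * phi p));
  last by move=> p _; rewrite mulrBl.
rewrite RintB//; last exact: intg_bddMl masq (fun p => aC _) iphi.
rewrite Rint_xt_shift_mul// -RintB//; last first.
  by apply: (intg_bddMl ma aC); exact: intg_xt_shift.
by apply: eq_Rintegral => p _; rewrite mulrBr.
Qed.

Lemma measurable_rV_add :
  measurable_fun setT (fun xy : 'rV[R]_d * 'rV[R]_d => xy.1 + xy.2).
Proof.
apply/measurable_fun_rVP => i.
rewrite (_ : _ \o _ = fun xy => rV_coord i xy.1 + rV_coord i xy.2).
  apply: measurable_funD; apply: (measurableT_comp (measurable_rV_coord i));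
    [exact: measurable_fst|exact: measurable_snd].
by apply/funext => xy; rewrite /rV_coord/= mxE.
Qed.

Variables (rho : 'rV[R]_d -> 'rV[R]_d) (w : 'rV[R]_d -> R).
Hypotheses (mrho : measurable_fun setT rho) (w0 : forall z, 0 <= w z).
Hypothesis iw : mu.-integrable setT (EFin \o w).

Lemma measurable_translate (a : XT d -> R) (s : 'rV[R]_d -> 'rV[R]_d) :
  measurable_fun setT s -> measurable_fun setT a ->
  measurable_fun setT (fun pz : XT d * 'rV[R]_d => a (pz.1.1 + s pz.2, pz.1.2)).
Proof.
move=> ms ma; apply: measurableT_comp ma _.
apply/measurable_fun_pairP; split; last first.
  exact: (measurableT_comp measurable_snd measurable_fst).
rewrite (_ : _ \o _ = (fun xy => xy.1 + xy.2) \o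
  (fun pz : XT d * 'rV[R]_d => (pz.1.1, s pz.2)))//.
apply: (measurableT_comp measurable_rV_add).
apply/measurable_fun_pairP; split.
  exact: (measurableT_comp (@measurable_fst _ _ _ _) (@measurable_fst _ _ _ _)).
exact: (measurableT_comp ms (@measurable_snd _ _ _ _)).
Qed.

Definition nonlocal (s : 'rV[R]_d -> 'rV[R]_d) (om : 'rV[R]_d -> R)
    (a : XT d -> R) p : R :=
  \int[mu]_z ((a (p.1 + s z, p.2) - a p) * om z).

Lemma measurable_increment (a : XT d -> R) (s : 'rV[R]_d -> 'rV[R]_d) :
  measurable_fun setT s -> measurable_fun setT a ->
  measurable_fun setT (fun pz : XT d * 'rV[R]_d =>
    a (pz.1.1 + s pz.2, pz.1.2) - a pz.1).
Proof.
move=> ms ma; apply: measurable_funB; first exact: (measurable_translate ms ma).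
exact: (measurableT_comp ma measurable_fst).
Qed.

Lemma measurable_nonlocal (a : XT d -> R) : measurable_fun setT a ->
  measurable_fun setT (nonlocal rho w a).
Proof.
move=> ma; pose f (pz : XT d * 'rV[R]_d) :=
  (a (pz.1.1 + rho pz.2, pz.1.2) - a pz.1) * w pz.2.
apply: (@measurable_Rint _ _ _ _ _ mu f); apply: measurable_funM.
  exact: (measurable_increment mrho ma).
exact: (measurableT_comp (intg_measurable iw) measurable_snd).
Qed.

Lemma increment_le (a : XT d -> R) (C : R) p p' : (forall p, `|a p| <= C) ->
  `|a p - a p'| <= C + C.
Proof. by move=> aC; rewrite (le_trans (ler_normB _ _))// lerD. Qed.

Lemma measurable_increment_at (a : XT d -> R) p (s : 'rV[R]_d -> 'rV[R]_d) :
  measurable_fun setT s -> measurable_fun setT a ->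
  measurable_fun setT (fun z => a (p.1 + s z, p.2) - a p).
Proof.
move=> ms ma.
exact: (measurableT_comp (measurable_increment ms ma) (pair1_measurable p)).
Qed.

Lemma nonlocal_le (a : XT d -> R) (C : R) p : measurable_fun setT a ->
  (forall p, `|a p| <= C) ->
  `|nonlocal rho w a p| <= (C + C) * \int[mu]_z w z.
Proof.
move=> ma aC; rewrite -RintZ//; apply: ler_norm_Rint.
- apply: (intg_bddMl _ _ iw); first exact: (measurable_increment_at p mrho ma).
  by move=> z; exact: increment_le.
- exact: intgZ.
- by move=> z; rewrite normrM (ger0_norm (w0 z)) ler_wpM2r// increment_le.
Qed.

(** Fubini in (p, z) and, for each z, translation invariance in p, which replaces [rho z] by its
    opposite. The integrability of the weight makes both product integrals absolutely convergent;
    the cut kernel has it, the full kernel does not. *)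
Lemma adjoint_nonlocal (a phi : XT d -> R) (C C' : R) : measurable_fun setT a ->
  (forall p, `|a p| <= C) -> (forall p, `|phi p| <= C') -> nu.-integrable setT (EFin \o phi) ->
  \int[nu]_p (phi p * nonlocal rho w a p) =
  \int[nu]_p (a p * nonlocal (fun z => - rho z) w phi p).
Proof.
move=> ma aC phiC iphi; have mphi := intg_measurable iphi.
have C0 : 0 <= C by exact: le_trans (aC point).
have mrhoN : measurable_fun setT (fun z => - rho z).
  exact: (measurableT_comp (@measurable_rV_opp _ _) mrho).
have mw2 : measurable_fun setT (fun pz : XT d * 'rV[R]_d => w pz.2).
  exact: (measurableT_comp (intg_measurable iw) measurable_snd).
pose f (pz : XT d * 'rV[R]_d) :=
  phi pz.1 * ((a (pz.1.1 + rho pz.2, pz.1.2) - a pz.1) * w pz.2).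
pose g (pz : XT d * 'rV[R]_d) :=
  a pz.1 * ((phi (pz.1.1 - rho pz.2, pz.1.2) - phi pz.1) * w pz.2).
have mf : measurable_fun setT f.
  apply: measurable_funM; first exact: (measurableT_comp mphi measurable_fst).
  apply: measurable_funM => //; exact: (measurable_increment mrho ma).
have mg : measurable_fun setT g.
  apply: measurable_funM; first exact: (measurableT_comp ma measurable_fst).
  apply: measurable_funM => //; exact: (measurable_increment mrhoN mphi).
have if_ : (nu \x mu)%E.-integrable setT (EFin \o f).
  apply: (@intg_prod_mul _ _ _ _ _ (xt_measure d) mu (fun p => (C + C) * `|phi p|) w f mf _ iw).
    exact: (intgZ (C + C) (intg_norm iphi)).
  move=> p z.
  rewrite /f/= !normrM (ger0_norm (w0 z)) mulrA ler_wpM2r// mulrC ler_wpM2r//.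
  exact: increment_le.
have ish z : nu.-integrable setT (EFin \o
    (fun p => phi (p.1 - rho z, p.2) - phi p)).
  apply: intgB => //; have := intg_xt_shift (- rho z, 0 : measurableTypeR R) iphi.
  by apply: eq_integrable => // -[x t] _; rewrite /xt_shift/= addr0.
have Esh z : \int[nu]_p `|phi (p.1 - rho z, p.2)| = \int[nu]_p `|phi p|.
  rewrite -[RHS](Rint_xt_shift (- rho z, 0 : measurableTypeR R)); last exact: measurableT_comp.
  by apply: eq_Rintegral => -[x t] _; rewrite /xt_shift/= addr0.
(* Here [phi] is translated with z and no product majorant is at hand; instead, for fixed z, the
   integral in p is bounded by 2 C times the L^1 norm of [phi] times [w z]. *)
have ig : (nu \x mu)%E.-integrable setT (EFin \o g).
  apply: (@intg_prod_dom _ _ _ _ _ (xt_measure d) mu g (fun z => C * (2 * \int[nu]_p `|phi p|) * w z) mg).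
  - move=> z; apply: (intg_bddMl ma aC).
    by under eq_fun do rewrite mulrC; exact: (intgZ (w z) (ish z)).
  - exact: intgZ.
  - move=> z.
    apply: (@le_trans _ _ (\int[nu]_p (C * w z * (`|phi (p.1 - rho z, p.2)| + `|phi p|)))).
      apply: le_Rint.
      + apply: intg_norm; apply: (intg_bddMl ma aC).
        by under eq_fun do rewrite mulrC; exact: (intgZ (w z) (ish z)).
      + apply: intgZ; apply: intgD; last exact: intg_norm.
        have := intg_norm (intg_xt_shift (- rho z, 0 : measurableTypeR R) iphi).
        by apply: eq_integrable => // -[x t] _; rewrite /xt_shift/= addr0.
      + move=> p; rewrite /g/= !normrM (ger0_norm (w0 z)) -mulrA ler_pM//.
          by rewrite mulr_ge0.
        by rewrite mulrC ler_wpM2l// ler_normB.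
    rewrite RintZ; last first.
      apply: intgD; last exact: intg_norm.
      have := intg_norm (intg_xt_shift (- rho z, 0 : measurableTypeR R) iphi).
      by apply: eq_integrable => // -[x t] _; rewrite /xt_shift/= addr0.
    rewrite RintD; last 2 first.
    + have := intg_norm (intg_xt_shift (- rho z, 0 : measurableTypeR R) iphi).
      by apply: eq_integrable => // -[x t] _; rewrite /xt_shift/= addr0.
    + exact: intg_norm.
    by rewrite Esh le_eqVlt; apply/orP; left; apply/eqP; ring.
transitivity (\int[nu]_p \int[mu]_z f (p, z)).
  apply: eq_Rintegral => p _; rewrite -RintZ//.
  apply: (intg_bddMl _ _ iw); first exact: (measurable_increment_at p mrho ma).
  by move=> z; exact: increment_le.
rewrite (@Rint_fubini _ _ _ _ _ (xt_measure d) mu f if_); transitivity (\int[mu]_z \int[nu]_p g (p, z)).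
  apply: eq_Rintegral => z _.
  have := @adjoint_shift a phi (rho z, 0) C ma aC iphi.
  move=> /(congr1 (fun x => w z * x)).
  rewrite -!RintZ; last 2 first.
  - apply: (intg_bddMl ma aC); have := ish z.
    by apply: eq_integrable => // -[x t] _; rewrite /xt_shift/= oppr0 addr0.
  - apply: intg_bddMl iphi; last by move=> p; exact: increment_le.
    apply: measurable_funB => //; apply: measurableT_comp ma _.
    exact: measurable_xt_shift.
  move=> E; transitivity (\int[nu]_p (w z * ((a (xt_shift (rho z, 0) p) - a p) * phi p))).
    apply: eq_Rintegral => -[x t] _; rewrite /f /xt_shift/= addr0; ring.
  rewrite E; apply: eq_Rintegral => -[x t] _; rewrite /g /xt_shift/= oppr0 addr0; ring.
rewrite -(@Rint_fubini _ _ _ _ _ (xt_measure d) mu g ig); apply: eq_Rintegral => p _; rewrite /nonlocal.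
rewrite -RintZ//; apply: (intg_bddMl _ _ iw).
  exact: (measurable_increment_at p mrhoN mphi).
by move=> z; exact: increment_le phiC.
Qed.

End adjoint.

(** * The weak form of the discrete inequality *)

Section weak_entropy.
Context {R : realType} {d : nat}.
Local Notation XT d := ('rV[R]_d * measurableTypeR R)%type.
Local Notation E := ('rV[R]_d * R)%type.
Local Notation nu := (lebesgue_xt d).
Local Notation mu := (@lebesgue_rV R d).

(** [G] is continuous on the plane, presented as pairs of a one-component row vector and a real so
    that [continuous_measurable_xt] applies in dimension 1. *)
Lemma measurable_lipschitz2 (G : R -> R -> R) (L : R) :
  (forall a b a' b', `|G a b - G a' b'| <= L * (`|a - a'| + `|b - b'|)) ->
  forall dd (X : measurableType dd) (a b : X -> R), measurable_fun setT a ->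
  measurable_fun setT b -> measurable_fun setT (fun x => G (a x) (b x)).
Proof.
move=> lipG dd X a b ma mb.
have L0 : 0 <= L.
  have := lipG 1 0 0 0; rewrite subr0 subrr normr0 normr1 addr0 mulr1.
  exact: le_trans.
pose psi (p : 'rV[R]_1 * R) := G (p.1 ord0 ord0) p.2.
have cpsi : continuous psi.
  move=> p; apply/cvgrPdist_le => e e0.
  pose e' := e / (2 * (L + 1)).
  have L1 : 0 < L + 1 by rewrite ltr_wpDl.
  have e'0 : 0 < e' by rewrite divr_gt0// mulr_gt0.
  have c1 : (q : 'rV[R]_1 * R).1 @[q --> p] --> p.1 by exact: cvg_fst.
  have c2 : (q : 'rV[R]_1 * R).2 @[q --> p] --> p.2 by exact: cvg_snd.
  have c3 : ((q : 'rV[R]_1 * R).1 : 'rV[R]_1) ord0 ord0 @[q --> p] --> (p.1 : 'rV[R]_1) ord0 ord0.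
    exact: (cvg_comp _ _ c1 (@coord_continuous _ _ _ ord0 ord0 p.1)).
  have /cvgrPdist_le/(_ _ e'0) h3 := c3.
  have /cvgrPdist_le/(_ _ e'0) h2 := c2.
  apply: filterS2 h3 h2 => q h3 h2; rewrite /psi (le_trans (lipG _ _ _ _))//.
  apply: (@le_trans _ _ ((L + 1) * (e' + e'))).
    by apply: ler_pM => //; [rewrite lerDl|exact: lerD].
  by rewrite le_eqVlt; apply/orP; left; apply/eqP; rewrite /e'; field; rewrite gt_eqF.
have := continuous_measurable_xt cpsi.
pose g (x : X) : 'rV[R]_1 * measurableTypeR R := (const_mx (a x), b x).
move=> /measurableT_comp/(_ (_ : measurable_fun setT g)).
have mg : measurable_fun setT g.
  apply/measurable_fun_pairP; split => //.
  apply/measurable_fun_rVP => i; rewrite (_ : _ \o _ = a)//.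
  by apply/funext => x; rewrite /rV_coord/= mxE.
move=> /(_ mg); apply: eq_measurable_fun => x _.
by rewrite /psi/= mxE.
Qed.

Lemma measurable_sgr : measurable_fun setT (Num.sg : R -> R).
Proof.
apply: nondecreasing_measurable => // x y xy; rewrite !sgr_def.
have [x0|x0|x0] := ltgtP x 0; have [y0|y0|y0] := ltgtP y 0;
  rewrite ?mulr1n ?mulr0n ?mulr1 ?mulr0//=; lra.
Qed.

Variables (c lambda h tau T M k r LA LF : R) (A : R -> R).
Variables (F : 'I_d -> R -> R -> R) (f : R -> 'rV[R]_d).
Hypotheses (h0 : 0 < h) (tau0 : 0 < tau) (c0 : 0 < c) (hlambda : 0 < lambda < 2).
Hypothesis lipA : forall a b, `|A a - A b| <= LA * `|a - b|.
Hypothesis hF : numerical_flux f LF F.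

Lemma num_entropy_flux_lipschitz (l : 'I_d) a b a' b' :
  `|num_entropy_flux F k l a b - num_entropy_flux F k l a' b'| <=
  2 * LF * (`|a - a'| + `|b - b'|).
Proof.
have [lipF _ _ _] := hF l; rewrite /num_entropy_flux.
have LF0 : 0 <= LF.
  by have := lipF 1 0 0 0; rewrite subr0 subrr normr1 normr0 addr0 mulr1; exact: le_trans.
have dmax x y : `|Num.max x k - Num.max y k| <= `|x - y|.
  have h1 := ler_norm (x - y); have := ler_norm (y - x); rewrite distrC ler_norml.
  by case: (leP x k); case: (leP y k) => *; apply/andP; split; lra.
have dmin x y : `|Num.min x k - Num.min y k| <= `|x - y|.
  have h1 := ler_norm (x - y); have := ler_norm (y - x); rewrite distrC ler_norml.
  by case: (leP x k); case: (leP y k) => *; apply/andP; split; lra.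
have h1 := lipF (Num.max a k) (Num.max b k) (Num.max a' k) (Num.max b' k).
have h2 := lipF (Num.min a k) (Num.min b k) (Num.min a' k) (Num.min b' k).
set x1 := F l _ _ in h1 *; set x2 := F l (Num.min a k) _ in h2 *.
set x3 := F l _ _ in h1 *; set x4 := F l (Num.min a' k) _ in h2 *.
have -> : x1 - x2 - (x3 - x4) = (x1 - x3) - (x2 - x4) by ring.
rewrite (le_trans (ler_normB _ _))//.
have -> : 2 * LF * (`|a - a'| + `|b - b'|) =
  LF * (`|a - a'| + `|b - b'|) + LF * (`|a - a'| + `|b - b'|) by ring.
by apply: lerD; [apply: le_trans h1 _|apply: le_trans h2 _]; rewrite ler_wpM2l// lerD.
Qed.

Lemma num_entropy_flux_consistent (l : 'I_d) a :
  num_entropy_flux F k l a a = qflux f k a l.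
Proof.
have [_ Fcons _ _] := hF l; rewrite /num_entropy_flux !Fcons /qflux /deta.
have [ak|ka|->] := ltgtP a k.
- by rewrite ltr0_sg ?subr_lt0// mulN1r opprB.
- by rewrite gtr0_sg ?subr_gt0// mul1r.
- by rewrite !subrr sgr0 mul0r.
Qed.

Lemma num_entropy_flux_le (l : 'I_d) a b C : `|a| <= C -> `|b| <= C ->
  `|num_entropy_flux F k l a b| <= 2 * LF * ((C + `|k|) + (C + `|k|)).
Proof.
move=> aC bC; have := num_entropy_flux_lipschitz l a b k k.
rewrite num_entropy_flux_consistent /qflux /deta subrr sgr0 mul0r subr0.
have [lipF _ _ _] := hF l.
have LF0 : 0 <= LF.
  by have := lipF 1 0 0 0; rewrite subr0 subrr normr1 normr0 addr0 mulr1; exact: le_trans.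
move=> /le_trans; apply; rewrite ler_wpM2l ?mulr_ge0// lerD// (le_trans (ler_normB _ _))//;
  exact: lerD.
Qed.

Definition inner_weight (z : 'rV[R]_d) : R :=
  (enorm z <= r)%R%:R * cut_kernel h lambda z.

Definition outer_weight (z : 'rV[R]_d) : R :=
  (~~ (enorm z <= r)%R)%:R * cut_kernel h lambda z.

Lemma measurable_boolR_ball (b : bool) : measurable_fun setT
  (fun z : 'rV[R]_d => ((enorm z <= r)%R (+) b)%:R : R).
Proof.
apply: measurable_boolR; have mb : measurable_fun setT (fun z : 'rV[R]_d => (enorm z <= r)%R).
  by apply: measurable_fun_ler => //; exact: measurable_enorm.
case: b; last by under eq_fun do rewrite addbF.
by under eq_fun do rewrite addbT; exact: measurable_neg.
Qed.

Lemma inner_weight_ge0 z : 0 <= inner_weight z.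
Proof. by rewrite mulr_ge0// cut_kernel_ge0. Qed.

Lemma outer_weight_ge0 z : 0 <= outer_weight z.
Proof. by rewrite mulr_ge0// cut_kernel_ge0. Qed.

Lemma intg_inner_weight : mu.-integrable setT (EFin \o inner_weight).
Proof.
apply: (intg_bddMl (C := 1) _ _ (intg_cut_kernel h0 hlambda (d := d))).
  by under eq_fun do rewrite -[_ <= _]addbF; exact: measurable_boolR_ball.
by move=> z; case: (enorm z <= r); rewrite ?normr0 ?normr1.
Qed.

Lemma intg_outer_weight : mu.-integrable setT (EFin \o outer_weight).
Proof.
apply: (intg_bddMl (C := 1) _ _ (intg_cut_kernel h0 hlambda (d := d))).
  by under eq_fun do rewrite -addbT; exact: measurable_boolR_ball.
by move=> z; case: (enorm z <= r); rewrite /= ?normr0 ?normr1.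
Qed.

Variables (v : E -> R) (phi : XT d -> R) (C : R).
Hypothesis mv : measurable_fun setT (v : XT d -> R).
Hypothesis vM : forall p, `|v p| <= M.
Hypothesis dv : discrete_entropy T c lambda h A F tau v.
Hypothesis iphi : nu.-integrable setT (EFin \o phi).
Hypothesis phiC : forall p, `|phi p| <= C.
Hypothesis phi0 : forall p, 0 <= phi p.
Hypothesis phit : forall p, phi p != 0 -> 0 < p.2 < T - tau.

(** The pointwise inequality is multiplied by phi / tau and integrated; changes of variables take
    the place of summation by parts. The outer term stays on [v]: its sign factor does not commute
    with translations, and its kernel is not singular. *)
Lemma weak_discrete_entropy :
  0 <= \int[nu]_p (`|v p - k| * ((phi p - phi (xt_shift (0, - tau) p)) / tau))
   + \sum_(l < d) \int[nu]_p (num_entropy_flux F k l (v p) (v (xt_shift (h *: 'e_l, 0) p))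
        * ((phi (xt_shift (h *: 'e_l, 0) p) - phi p) / h))
   + c * \int[nu]_p (`|A (v p) - A k|
        * nonlocal (fun z => - round h z) inner_weight phi p)
   + c * \int[nu]_p (phi p * Num.sg (v (xt_shift (0, tau) p) - k)
        * nonlocal (round h) outer_weight (A \o v) p).
Proof.
have LA0 := LA_ge0 lipA.
have mA : measurable_fun setT A by exact: measurable_lipschitz LA0 lipA.
have mvq q : measurable_fun setT (fun p => v (xt_shift q p)).
  by apply: measurableT_comp mv _; exact: measurable_xt_shift.
pose a1 (p : XT d) := `|v p - k|.
have ma1 : measurable_fun setT a1.
  by apply: measurableT_comp => //; exact: measurable_funB.
have a1C p : `|a1 p| <= M + `|k|.
  by rewrite normr_id (le_trans (ler_normB _ _))// lerD.
pose Q l (p : XT d) := num_entropy_flux F k l (v p) (v (xt_shift (h *: 'e_l, 0) p)).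
have mQ l : measurable_fun setT (Q l).
  exact: (measurable_lipschitz2 (num_entropy_flux_lipschitz l) mv (mvq _)).
have QC l p : `|Q l p| <= 2 * LF * ((M + `|k|) + (M + `|k|)).
  exact: num_entropy_flux_le.
pose aA (p : XT d) := `|A (v p) - A k|.
have maA : measurable_fun setT aA.
  by apply: measurableT_comp => //; apply: measurable_funB => //; exact: measurableT_comp mA mv.
have aAC p : `|aA p| <= LA * (M + `|k|).
  rewrite normr_id (le_trans (lipA _ _))// ler_wpM2l//.
  by rewrite (le_trans (ler_normB _ _))// lerD.
have mAv : measurable_fun setT (A \o v : XT d -> R) by exact: measurableT_comp mA mv.
have AvC p : `|(A \o v) p| <= LA * M + `|A 0|.
  rewrite /= -[A (v p)](subrK (A 0)) (le_trans (ler_normD _ _))// lerD2r.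
  by rewrite (le_trans (lipA _ _))// subr0 ler_wpM2l.
have mr := measurable_round h0 (d := d).
have iin := intg_inner_weight; have iout := intg_outer_weight.
have in0 := inner_weight_ge0; have out0 := outer_weight_ge0.
have mNin := measurable_nonlocal mr iin maA.
have NinC p := nonlocal_le mr in0 iin p maA aAC.
have mNout := measurable_nonlocal mr iout mAv.
have NoutC p := nonlocal_le mr out0 iout p mAv AvC.
pose S (p : XT d) := phi p * Num.sg (v (xt_shift (0, tau) p) - k).
have iS : nu.-integrable setT (EFin \o S).
  rewrite (_ : S = fun p => Num.sg (v (xt_shift (0, tau) p) - k) * phi p); last first.
    by apply/funext => p; rewrite mulrC.
  apply: (intg_bddMl (C := 1) _ _ iphi).
    by apply: measurableT_comp; [exact: measurable_sgr|exact: measurable_funB].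
  by move=> p; rewrite normr_sg; case: (_ != _).
have i1 : nu.-integrable setT (EFin \o (fun p => tau^-1 * ((a1 p - a1 (xt_shift (0, tau) p)) * phi p))).
  apply: intgZ; apply: intg_bddMl iphi; last by move=> p; exact: increment_le a1C.
  by apply: measurable_funB => //; apply: measurableT_comp ma1 _; exact: measurable_xt_shift.
have i2 l : nu.-integrable setT (EFin \o (fun p => h^-1 * ((Q l (xt_shift (- (h *: 'e_l), 0) p) - Q l p) * phi p))).
  apply: intgZ; apply: intg_bddMl iphi; last by move=> p; exact: increment_le (QC l).
  by apply: measurable_funB => //; apply: measurableT_comp (mQ l) _; exact: measurable_xt_shift.
have i3 : nu.-integrable setT (EFin \o (fun p => c * (phi p * nonlocal (round h) inner_weight aA p))).
  apply: intgZ; under eq_fun do rewrite mulrC; exact: intg_bddMl iphi.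
have i4 : nu.-integrable setT (EFin \o (fun p => c * (S p * nonlocal (round h) outer_weight (A \o v) p))).
  apply: intgZ; under eq_fun do rewrite mulrC; exact: intg_bddMl iS.
have pw p : 0 <= tau^-1 * ((a1 p - a1 (xt_shift (0, tau) p)) * phi p)
    + \sum_(l < d) h^-1 * ((Q l (xt_shift (- (h *: 'e_l), 0) p) - Q l p) * phi p)
    + c * (phi p * nonlocal (round h) inner_weight aA p)
    + c * (S p * nonlocal (round h) outer_weight (A \o v) p).
  (* Where [phi] vanishes so does every term; elsewhere [phit] puts both time levels inside (0,
     T). *)
  have [p0|p0] := eqVneq (phi p) 0.
    rewrite big1 => [|l _]; last by rewrite p0 !mulr0.
    by rewrite /S p0 !mul0r !mulr0 !addr0.
  case: p p0 => x t p0; have /andP[/= t0 tT] := phit p0.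
  have tT' : t + tau < T by rewrite -ltrBrDr.
  have := dv k r x t0 tT'; rewrite /discrete_entropy_at.
  set I1 := \int[mu]_z _; set I2 := \int[mu]_z _.
  have -> : I1 = nonlocal (round h) inner_weight aA (x, t).
    by apply: eq_Rintegral => z _; rewrite /inner_weight /aA/=; ring.
  have -> : I2 = nonlocal (round h) outer_weight (A \o v) (x, t).
    by apply: eq_Rintegral => z _; rewrite /outer_weight/=; ring.
  set sm := \sum_(l < d) _.
  have -> : \sum_(l < d) h^-1 * ((Q l (xt_shift (- (h *: 'e_l), 0) (x, t)) - Q l (x, t)) * phi (x, t))
      = - sm * phi (x, t).
    rewrite -sumrN mulr_suml; apply: eq_bigr => l _.
    by rewrite /Q /xt_shift/= !addr0 subrK; ring.
  rewrite /S /a1 /xt_shift/= addr0.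
  set v1 := v (x, t + tau); set v0 := v (x, t); set J1 := nonlocal _ _ _ _.
  set J2 := nonlocal _ _ _ _ => ineq.
  have -> : tau^-1 * ((`|v0 - k| - `|v1 - k|) * phi (x, t)) + - sm * phi (x, t)
      + c * (phi (x, t) * J1) + c * (phi (x, t) * Num.sg (v1 - k) * J2)
    = phi (x, t) / tau * (`|v0 - k| - tau * sm + tau * (c * J1)
       + tau * (c * (Num.sg (v1 - k) * J2)) - `|v1 - k|).
    by field; rewrite gt_eqF.
  by rewrite mulr_ge0 ?divr_ge0 ?phi0 ?(ltW tau0)// subr_ge0.
have : 0 <= \int[nu]_p (tau^-1 * ((a1 p - a1 (xt_shift (0, tau) p)) * phi p)
    + \sum_(l < d) h^-1 * ((Q l (xt_shift (- (h *: 'e_l), 0) p) - Q l p) * phi p)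
    + c * (phi p * nonlocal (round h) inner_weight aA p)
    + c * (S p * nonlocal (round h) outer_weight (A \o v) p)).
  by apply: Rintegral_ge0 => p _; exact: pw.
have i2s := intg_sum i2.
rewrite RintD//; last by do 2 apply: intgD => //.
rewrite RintD//; last by apply: intgD.
rewrite RintD// Rint_sum//.
move=> /le_trans; apply; rewrite le_eqVlt; apply/orP; left; apply/eqP.
congr (_ + _ + _ + _).
- rewrite RintZ; last first.
    apply: intg_bddMl iphi; last by move=> p; exact: increment_le a1C.
    by apply: measurable_funB => //; apply: measurableT_comp ma1 _; exact: measurable_xt_shift.
  have := adjoint_shift (0, tau) ma1 a1C iphi; rewrite /= oppr0 => E1.
  transitivity (tau^-1 * - \int[nu]_p ((a1 (xt_shift (0, tau) p) - a1 p) * phi p)).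
    congr (_ * _); rewrite -mulN1r -RintZ.
      by apply: eq_Rintegral => p _; ring.
    apply: intg_bddMl iphi; last by move=> p; exact: increment_le a1C.
    by apply: measurable_funB => //; apply: measurableT_comp ma1 _; exact: measurable_xt_shift.
  rewrite E1 mulrN -mulNr -RintZ.
    by apply: eq_Rintegral => p _; rewrite /a1; ring.
  apply: (intg_bddMl ma1 a1C); apply: intgB => //; exact: intg_xt_shift.
- apply: eq_bigr => l _; rewrite RintZ; last first.
    apply: intg_bddMl iphi; last by move=> p; exact: increment_le (QC l).
    by apply: measurable_funB => //; apply: measurableT_comp (mQ l) _; exact: measurable_xt_shift.
  rewrite (adjoint_shift (- (h *: 'e_l), 0) (mQ l) (QC l) iphi)/= opprK oppr0 -RintZ.
    by apply: eq_Rintegral => p _; rewrite /Q; ring.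
  apply: (intg_bddMl (mQ l) (QC l)); apply: intgB => //; exact: intg_xt_shift.
- rewrite RintZ; last by under eq_fun do rewrite mulrC; exact: intg_bddMl iphi.
  by congr (_ * _); exact: (adjoint_nonlocal mr in0 iin maA aAC phiC iphi).
- rewrite RintZ//; by under eq_fun do rewrite mulrC; exact: intg_bddMl iS.
Qed.

End weak_entropy.

(** * Limits of the nonlocal operators *)

Section inner_operator.
Context {R : realType} {d : nat}.
Local Notation XT d := ('rV[R]_d * measurableTypeR R)%type.
Local Notation E := ('rV[R]_d * R)%type.
Local Notation nu := (lebesgue_xt d).
Local Notation mu := (@lebesgue_rV R d).
Variables (c lambda r B : R) (phi : E -> R).
Hypotheses (hlambda : 0 < lambda < 2) (r0 : 0 < r) (d0 : (0 < d)%N) (B0 : 0 <= B).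
Hypothesis cphi : continuous phi.
Local Notation K := (@Defs.kernel R d lambda).

Definition second_difference (p : E) (y : 'rV[R]_d) : R :=
  phi (p.1 + y, p.2) + phi (p.1 - y, p.2) - 2 * phi p.

Hypothesis sdB : forall p y, `|second_difference p y| <= B * enorm y ^+ 2.

(** An absolutely convergent form of the principal value g_r[phi], up to the constant [c], see
    [g_innerE]. *)
Definition inner_limit (p : E) : R :=
  2^-1 * \int[mu]_z (second_difference p z * ((enorm z <= r)%R%:R * K z)).

Let mphi : measurable_fun setT (phi : XT d -> R).
Proof. exact: continuous_measurable_xt. Qed.

Lemma measurable_second_difference p (s : 'rV[R]_d -> 'rV[R]_d) :
  measurable_fun setT s -> measurable_fun setT (fun z => second_difference p (s z)).
Proof.
move=> ms; have msN : measurable_fun setT (fun z => - s z).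
  exact: (measurableT_comp (@measurable_rV_opp _ _) ms).
rewrite (_ : (fun _ => _) = fun z => (phi (p.1 + s z, p.2) - phi p) +
    (phi (p.1 + (- s z), p.2) - phi p)).
  by apply: measurable_funD; exact: (@measurable_increment_at _ _ phi p).
by apply/funext => z; rewrite /second_difference; ring.
Qed.

Let mball : measurable_fun setT (fun z : 'rV[R]_d => (enorm z <= r)%R).
Proof. by apply: measurable_fun_ler => //; exact: measurable_enorm. Qed.

(** Averaging the integral with its image under z -> - z. The parities are required almost
    everywhere only, since rounding fails to be odd on cell boundaries. The discrete operator and
    the truncated principal value are both instances. *)
Lemma Rint_symmetrize (rho : 'rV[R]_d -> 'rV[R]_d) (w : 'rV[R]_d -> R) p :
  measurable_fun setT rho -> {ae mu, forall z, rho (- z) = - rho z} ->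
  (forall z, 0 <= w z) -> mu.-integrable setT (EFin \o w) ->
  {ae mu, forall z, w (- z) = w z} -> (exists C, forall p, `|phi p| <= C) ->
  \int[mu]_z ((phi (p.1 + rho z, p.2) - phi p) * w z) =
  2^-1 * \int[mu]_z (second_difference p (rho z) * w z).
Proof.
move=> mrho rhoN w0 iw wN [C phiC].
pose f z := (phi (p.1 + rho z, p.2) - phi p) * w z.
pose g z := (phi (p.1 - rho z, p.2) - phi p) * w z.
have mrhoN : measurable_fun setT (fun z => - rho z).
  exact: (measurableT_comp (@measurable_rV_opp _ _) mrho).
have if_ : mu.-integrable setT (EFin \o f).
  apply: (intg_bddMl (C := C + C) _ _ iw).
    exact: (@measurable_increment_at _ _ phi p).
  by move=> z; exact: (@increment_le _ _ phi).
have ig : mu.-integrable setT (EFin \o g).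
  apply: (intg_bddMl (C := C + C) _ _ iw).
    exact: (@measurable_increment_at _ _ phi p).
  by move=> z; exact: (@increment_le _ _ phi).
have E1 : \int[mu]_z f z = \int[mu]_z g z.
  rewrite -(Rint_map (@measurable_rV_opp _ _) (@lebesgue_rV_opp R d)); last exact: intg_measurable if_.
  apply: eq_Rint_ae.
  - exact: (measurableT_comp (intg_measurable if_) (@measurable_rV_opp _ _)).
  - exact: intg_measurable ig.
  - by apply: filterS2 rhoN wN => z h1 h2; rewrite /f /g h1 h2.
rewrite -[LHS]/(\int[mu]_z f z).
have -> : \int[mu]_z f z = 2^-1 * (\int[mu]_z f z + \int[mu]_z g z).
  by rewrite -E1; field.
rewrite -RintD//; congr (_ * _); apply: eq_Rintegral => z _.
by rewrite /f /g /second_difference; ring.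
Qed.

Section discrete.
Variable h : R.
Hypothesis h0 : 0 < h.
Local Notation Phi := (nonlocal (fun z => - round h z)
  (inner_weight lambda h r) (phi : XT d -> R)).

Lemma nonlocal_inner_symm (p : XT d) : (exists C, forall p, `|phi p| <= C) ->
  Phi p = 2^-1 * \int[mu]_z (second_difference p (round h z) * inner_weight lambda h r z).
Proof.
move=> phiC.
have mr := measurable_round h0 (d := d).
have rN := ae_roundN (d := d) h0.
rewrite /nonlocal (@Rint_symmetrize (fun z => - round h z)) //.
- congr (_ * _); apply: eq_Rintegral => z _.
  by rewrite /second_difference opprK; ring.
- exact: (measurableT_comp (@measurable_rV_opp _ _) mr).
- by apply: filterS rN => z rz; rewrite /round rz gridN.
- exact: inner_weight_ge0.
- exact: intg_inner_weight.
- apply: filterS rN => z rz.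
  by rewrite /inner_weight /cut_kernel rz enormN kernelN oppr_eq0.
Qed.

(** The factor 4 is the square of the 2 in |round h z| <= 2 |z|; the majorant does not depend on
    h. *)
Lemma second_difference_round_le (p : E) z :
  `|second_difference p (round h z) * inner_weight lambda h r z| <=
  4 * B * (1 + r ^+ 2) * levy lambda z.
Proof.
have L0 : 0 <= 4 * B * (1 + r ^+ 2) * levy lambda z.
  by rewrite mulr_ge0 ?levy_ge0// mulr_ge0 ?addr_ge0 ?sqr_ge0// mulr_ge0.
rewrite /inner_weight /cut_kernel; have [zr|zr] := boolP (enorm z <= r); last first.
  by rewrite mul0r mulr0 normr0.
rewrite mul1r normrM [X in _ * X]ger0_norm; last by rewrite mulr_ge0// kernel_ge0.
apply: (@le_trans _ _ (B * (2 * enorm z) ^+ 2 * K z)).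
  apply: ler_pM => //; first by rewrite mulr_ge0// kernel_ge0.
    apply: le_trans (sdB _ _) _; rewrite ler_wpM2l//.
    by rewrite lerXn2r ?nnegrE ?mulr_ge0 ?enorm_ge0// enorm_round.
  by case: (_ != _); rewrite ?mul1r// mul0r kernel_ge0.
have -> : B * (2 * enorm z) ^+ 2 * K z = 4 * B * (enorm z ^+ 2 * K z) by ring.
by rewrite -[leRHS]mulrA ler_wpM2l ?mulr_ge0//; exact: sqr_kernel_le_levy.
Qed.

Lemma nonlocal_inner_le (p : XT d) : (exists C, forall p, `|phi p| <= C) ->
  `|Phi p| <= 4 * B * (1 + r ^+ 2) * \int[mu]_z levy lambda z.
Proof.
move=> phiC; rewrite nonlocal_inner_symm// normrM ger0_norm//.
rewrite -RintZ; last exact: intg_levy.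
apply: (@le_trans _ _ `|\int[mu]_z (second_difference p (round h z) * inner_weight lambda h r z)|).
  by rewrite ler_piMl// invf_le1// ler1n.
have mi : measurable_fun setT (fun z => second_difference p (round h z) * inner_weight lambda h r z).
  apply: measurable_funM; first exact: (measurable_second_difference p (measurable_round h0)).
  exact: (intg_measurable (intg_inner_weight r h0 hlambda)).
apply: ler_norm_Rint.
- apply: (intg_le mi (intgZ _ (intg_levy hlambda))).
  exact: second_difference_round_le.
- exact: intgZ (intg_levy hlambda).
- exact: second_difference_round_le.
Qed.

End discrete.

Lemma second_difference_cvg (p : E) (s : nat -> 'rV[R]_d) (z : 'rV[R]_d) :
  (forall i, s j ord0 i @[j --> \oo] --> z ord0 i) ->
  second_difference p (s j) @[j --> \oo] --> second_difference p z.
Proof.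
move=> sz.
have comp (s' : nat -> 'rV[R]_d) (z' : 'rV[R]_d) :
    (forall i, s' j ord0 i @[j --> \oo] --> z' ord0 i) ->
    phi (s' j, p.2) @[j --> \oo] --> phi (z', p.2).
  move=> sz'.
  apply: (cvg_comp _ phi _ (@cphi (z', p.2))).
  by apply: cvg_xt => //; exact: cvg_cst.
apply: cvgB; last exact: cvg_cst.
apply: cvgD; apply: comp => i.
  by under eq_fun do rewrite mxE; rewrite mxE; apply: cvgD => //; exact: cvg_cst.
under eq_fun do rewrite mxE [X in _ + X]mxE; rewrite mxE [X in _ + X]mxE.
by apply: cvgB => //; exact: cvg_cst.
Qed.

Lemma second_difference_le_levy (p : E) z :
  `|second_difference p z * ((enorm z <= r)%R%:R * K z)| <=
  B * (1 + r ^+ 2) * levy lambda z.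
Proof.
have [zr|zr] := boolP (enorm z <= r); last first.
  rewrite mul0r mulr0 normr0 mulr_ge0 ?levy_ge0// mulr_ge0//.
  by rewrite addr_ge0// sqr_ge0.
rewrite mul1r normrM (ger0_norm (kernel_ge0 _ _)).
apply: (@le_trans _ _ (B * (enorm z ^+ 2 * K z))).
  by rewrite mulrA ler_wpM2r ?kernel_ge0.
by rewrite -mulrA ler_wpM2l//; exact: sqr_kernel_le_levy.
Qed.

Let msdK p : measurable_fun setT
  (fun z => second_difference p z * ((enorm z <= r)%R%:R * K z)).
Proof.
apply: measurable_funM; first exact: (@measurable_second_difference p id).
by apply: measurable_funM; [exact: measurable_boolR|exact: measurable_kernel].
Qed.

Lemma cvg_nonlocal_inner (h : nat -> R) (p : XT d) : (forall j, 0 < h j) ->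
  h j @[j --> \oo] --> 0 -> (exists C, forall p, `|phi p| <= C) ->
  nonlocal (fun z => - round (h j) z) (inner_weight lambda (h j) r) (phi : XT d -> R) p
    @[j --> \oo] --> inner_limit p.
Proof.
move=> h0 hcvg phiC.
under eq_fun do rewrite nonlocal_inner_symm//.
apply: cvgMr.
apply: (cvg_Rint (g := fun z => 4 * B * (1 + r ^+ 2) * levy lambda z)).
- move=> j; apply: measurable_funM; first exact: (measurable_second_difference p (measurable_round (h0 j))).
  exact: (intg_measurable (intg_inner_weight r (h0 j) hlambda)).
- exact: msdK.
(* At the origin both sides are 0. Elsewhere some coordinate of [round (h j) z] has a nonzero limit,
   so that the removal of the central cell is eventually not felt at z. *)
- apply: aeW => z; have [->|z0] := eqVneq z 0.
    rewrite [X in _ --> X](_ : _ = 0); last first.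
      by rewrite /second_difference addr0 subr0 (_ : phi _ + phi _ - _ = 0) ?mul0r//; case: p => x t /=; ring.
    under eq_fun => j.
      rewrite /inner_weight /cut_kernel (_ : round_index (h j) 0 = 0); last first.
        apply/rowP => i; rewrite !mxE mul0r add0r; apply: floor_def.
        by rewrite mulr0z add0r mulr1z; apply/andP; split; lra.
      rewrite eqxx mul0r !mulr0; over.
    exact: cvg_cst.
  apply: cvgM.
    by apply: second_difference_cvg => i; exact: cvg_round.
  apply: cvgMr; rewrite -[X in _ --> X]mul1r; apply: cvgMl.
  have [i zi] : exists i, z ord0 i != 0.
    apply/existsP; move: z0; apply: contraNT; rewrite negb_exists => /forallP z0.
    by apply/eqP/rowP => i; rewrite mxE; apply/eqP; have := z0 i; rewrite negbK.
  have near1 : \forall j \near \oo, (round_index (h j) z != 0)%:R = 1 :> R.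
    have /cvgrPdist_lt hc := @cvg_round _ _ _ z i h0 hcvg.
    have := hc `|z ord0 i|; rewrite normr_gt0 zi => /(_ isT); apply: filterS => j.
    case: eqVneq => // rj; rewrite /round rj grid0 mxE subr0 ltxx//.
  exact: (@cvg_near_cst nat R 1 (fun j => (round_index (h j) z != 0)%:R) \oo _ near1).
- exact: intgZ (intg_levy hlambda).
- by move=> j z; exact: second_difference_round_le.
Qed.

(** The annulus b < |z| < r is symmetric, so the integral can be symmetrized before b tends to 0,
    and second differences then give a majorant independent of b. The sphere |z| = r, which the
    limit includes, is null because d > 0. *)
Lemma g_innerE (x : 'rV[R]_d) (t : R) : (exists C, forall p, `|phi p| <= C) ->
  g_inner c lambda r (fun y => phi (y, t)) x = c * inner_limit (x, t).
Proof.
move=> phiC; apply: cvg_lim => //.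
apply/cvg_at_rightP => b [b0 bcvg].
pose bw (n : nat) (z : 'rV[R]_d) : bool := (b n < enorm z)%R && (enorm z < r)%R.
have mbw n : measurable_fun setT (bw n).
  apply: measurable_and; first exact: measurable_fun_ltr_enorm.
  by apply: measurable_fun_ltr => //; exact: measurable_enorm.
have gE n : g_on c lambda [set z | b n < enorm z < r] (fun y => phi (y, t)) x =
   c * (2^-1 * \int[mu]_z (second_difference (x, t) z * ((bw n z)%:R * K z))).
  rewrite /g_on; congr (_ * _); rewrite Rintegral_mkcond.
  rewrite -(@Rint_symmetrize id (fun z => (bw n z)%:R * K z))//.
  - apply: eq_Rintegral => z _; rewrite patchE /bw; case: ifPn.
      by rewrite inE/= => ->; rewrite mul1r.
    by rewrite notin_setE/= => /negP/negbTE ->; rewrite mul0r mulr0.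
  - exact: aeW.
  - by move=> z; rewrite mulr_ge0// kernel_ge0.
  - by apply: (intg_bool_kernel hlambda (b0 n) (mbw n)) => z /andP[/ltW].
  - by apply: aeW => z; rewrite /bw enormN kernelN.
under eq_fun do rewrite gE.
apply: cvgMr; apply: cvgMr.
apply: (cvg_Rint (g := fun z => B * (1 + r ^+ 2) * levy lambda z)).
- move=> n; apply: measurable_funM; first exact: (@measurable_second_difference _ id).
  by apply: measurable_funM; [exact: measurable_boolR|exact: measurable_kernel].
- exact: msdK.
- apply: filterS (ae_enorm_neq r d0) => z zr.
  have [z0|z0] := eqVneq (enorm z) 0.
    rewrite (enorm_eq0 z0) /second_difference addr0 subr0.
    have -> : phi (x, t) + phi (x, t) - 2 * phi (x, t) = 0 by ring.
    by under eq_fun do rewrite mul0r; rewrite mul0r; exact: cvg_cst.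
  apply: cvgMr; apply: cvgMl.
  have near1 : \forall n \near \oo, (bw n z)%:R = (enorm z <= r)%R%:R :> R.
    have zp : 0 < enorm z by rewrite lt0r z0 enorm_ge0.
    have /cvgrPdist_lt/(_ _ zp) := bcvg; apply: filterS => n.
    rewrite sub0r normrN (gtr0_norm (b0 n)) /bw => ->.
    by rewrite le_eqVlt (negbTE zr).
  exact: (@cvg_near_cst nat R _ (fun n => (bw n z)%:R) \oo _ near1).
- exact: intgZ (intg_levy hlambda).
- move=> n z; apply: le_trans (second_difference_le_levy (x, t) z).
  rewrite !normrM ler_wpM2l// !(ger0_norm (kernel_ge0 _ _)) ler_wpM2r ?kernel_ge0//.
  rewrite !ger0_norm// ler_nat /bw; case: (enorm z <= r) / boolP => //.
    by case: (_ && _).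
  by rewrite -ltNge => /ltW; rewrite leNgt => /negbTE ->; rewrite andbF.
Qed.

End inner_operator.

(** * Strong convergence of the outer nonlocal term *)

Section outer_operator.
Context {R : realType} {d : nat}.
Local Notation XT d := ('rV[R]_d * measurableTypeR R)%type.
Local Notation E := ('rV[R]_d * R)%type.
Local Notation nu := (lebesgue_xt d).
Local Notation mu := (@lebesgue_rV R d).
Variables (lambda r LA M : R) (A : R -> R) (v : nat -> E -> R) (u : E -> R).
Variable h : nat -> R.
Hypotheses (hlambda : 0 < lambda < 2) (r0 : 0 < r).
Hypothesis lipA : forall a b, `|A a - A b| <= LA * `|a - b|.
Hypotheses (h0 : forall j, 0 < h j) (hcvg : h j @[j --> \oo] --> 0).
Hypothesis mv : forall j, measurable_fun setT (v j : XT d -> R).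
Hypothesis mu_ : measurable_fun setT (u : XT d -> R).
Hypothesis vM : forall j p, `|v j p| <= M.
Hypothesis uM : forall p, `|u p| <= M.
Hypothesis vlc : forall j, {ae nu, forall p : XT d,
  \forall q \near (p : E), v j q = v j p}.
Hypothesis ivu : forall j,
  nu.-integrable setT (EFin \o (fun p : XT d => v j p - u p)).
Hypothesis vu : \int[nu]_p `|v j p - u p| @[j --> \oo] --> 0.
Variable D : set (XT d).
Hypotheses (mD : measurable D) (nuD : (nu D < +oo)%E).
Local Notation K := (@Defs.kernel R d lambda).

Definition far_kernel (z : 'rV[R]_d) : R := (~~ (enorm z <= r)%R)%:R * K z.

Lemma far_kernel_ge0 z : 0 <= far_kernel z.
Proof. by rewrite mulr_ge0// kernel_ge0. Qed.

Lemma intg_far_kernel : mu.-integrable setT (EFin \o far_kernel).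
Proof.
apply: (intg_bool_kernel hlambda r0).
  apply: measurable_neg; apply: measurable_fun_ler => //; exact: measurable_enorm.
by move=> z; rewrite -ltNge => /ltW.
Qed.

(* The increments vanish where [cut_kernel] differs from the kernel. *)
Lemma nonlocal_outerE (g : R) (a : XT d -> R) p :
  nonlocal (round g) (outer_weight lambda g r) a p = nonlocal (round g) far_kernel a p.
Proof.
apply: eq_Rintegral => z _; rewrite /outer_weight /far_kernel /cut_kernel.
have [z0|z0] := eqVneq (round_index g z) 0; last by rewrite mul1r.
by rewrite /round z0 grid0 addr0 -surjective_pairing subrr !mul0r.
Qed.

Definition outer_limit (p : XT d) : R := nonlocal id far_kernel (A \o u : XT d -> R) p.

Let C := LA * M + `|A 0|.

Lemma lipschitz_bounded (w : E -> R) p : (forall p, `|w p| <= M) -> `|A (w p)| <= C.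
Proof.
move=> wM; rewrite -[A (w p)](subrK (A 0)) (le_trans (ler_normD _ _))// lerD2r.
by rewrite (le_trans (lipA _ _))// subr0 ler_wpM2l// (LA_ge0 lipA).
Qed.

Let mA : measurable_fun setT A.
Proof. exact: measurable_lipschitz (LA_ge0 lipA) lipA. Qed.

Let mAv j : measurable_fun setT (A \o v j : XT d -> R).
Proof. exact: (measurableT_comp mA (mv j)). Qed.

Let mAu : measurable_fun setT (A \o u : XT d -> R).
Proof. exact: (measurableT_comp mA mu_). Qed.

Lemma nonlocal_outer_le j p :
  `|nonlocal (round (h j)) (outer_weight lambda (h j) r) (A \o v j : XT d -> R) p|
  <= (C + C) * \int[mu]_z far_kernel z.
Proof.
rewrite nonlocal_outerE.
apply: (nonlocal_le (measurable_round (h0 j)) far_kernel_ge0 intg_far_kernel p (mAv j)).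
by move=> q; exact: (lipschitz_bounded q (vM j)).
Qed.

Lemma outer_limit_le p : `|outer_limit p| <= (C + C) * \int[mu]_z far_kernel z.
Proof.
apply: (nonlocal_le _ far_kernel_ge0 intg_far_kernel p mAu) => //.
by move=> q; exact: (lipschitz_bounded q uM).
Qed.

Lemma measurable_outer_limit : measurable_fun setT outer_limit.
Proof. exact: (measurable_nonlocal _ intg_far_kernel mAu). Qed.

Lemma measurable_nonlocal_outer j : measurable_fun setT
  (nonlocal (round (h j)) (outer_weight lambda (h j) r) (A \o v j : XT d -> R)).
Proof.
exact: (measurable_nonlocal (measurable_round (h0 j)) (intg_outer_weight r (h0 j) hlambda) (mAv j)).
Qed.

(** Bounds the difference between the increment of [A \o v j] towards the rounded point and the
    increment of [A \o u] towards the point itself. *)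
Let gap j (pz : XT d * 'rV[R]_d) : R :=
  `|A (v j (pz.1.1 + round (h j) pz.2, pz.1.2)) - A (u (pz.1.1 + pz.2, pz.1.2))|
  + `|A (v j pz.1) - A (u pz.1)|.

Let mgap j : measurable_fun setT (gap j).
Proof.
apply: measurable_funD; apply: measurableT_comp => //; apply: measurable_funB.
- exact: (measurable_translate (measurable_round (h0 j)) (mAv j)).
- exact: (measurable_translate (s := id) _ mAu).
- exact: (measurableT_comp (mAv j) (@measurable_fst _ _ _ _)).
- exact: (measurableT_comp mAu (@measurable_fst _ _ _ _)).
Qed.

Let gapC j pz : 0 <= gap j pz <= (C + C) + (C + C).
Proof.
rewrite addr_ge0//=; apply: lerD;
  rewrite (le_trans (ler_normB _ _))// lerD// lipschitz_bounded//; exact: vM.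
Qed.

Let cvg_gap z : (forall j, nu.-integrable setT (EFin \o (fun p => \1_D p * gap j (p, z)))) /\
  \int[nu]_p (\1_D p * gap j (p, z)) @[j --> \oo] --> 0.
Proof.
have shiftA (y : nat -> 'rV[R]_d) (z' : 'rV[R]_d) :
    (forall i, y j ord0 i @[j --> \oo] --> z' ord0 i) ->
    cvgL1 D (fun j p => A (v j (p.1 + y j, p.2))) (fun p => A (u (p.1 + z', p.2))).
  move=> yz.
  have s0 : (fun=> 0 : R) j @[j --> \oo] --> 0 by exact: cvg_cst.
  have := cvgL1_shift mv vM vlc ivu vu mD nuD yz s0.
  apply: (cvgL1_dom mD (L := LA)).
  - exact: LA_ge0 lipA.
  - move=> j; have mt := measurable_xt_shift (y j, 0 : measurableTypeR R).
    rewrite (_ : (fun _ => _) = (A \o v j) \o xt_shift (y j, 0)).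
      exact: (measurableT_comp (mAv j) mt).
    by apply/funext => p; rewrite /xt_shift/= addr0.
  - have mt := measurable_xt_shift (z', 0 : measurableTypeR R).
    rewrite (_ : (fun _ => _) = (A \o u) \o xt_shift (z', 0)).
      exact: (measurableT_comp mAu mt).
    by apply/funext => p; rewrite /xt_shift/= addr0.
  - by move=> j p _; rewrite /xt_shift/= addr0.
have [i1 c1] : cvgL1 D (fun j p => A (v j (p.1 + round (h j) z, p.2)))
    (fun p => A (u (p.1 + z, p.2))).
  by apply: shiftA => i; exact: cvg_round.
(* The untranslated term is written as a translation by 0 so that [shiftA] covers it. *)
have [i2 c2] : cvgL1 D (fun j p => A (v j (p.1 + 0, p.2)))
    (fun p => A (u (p.1 + 0, p.2))).
  by apply: shiftA => i; exact: cvg_cst.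
have E2 j : (fun p : XT d => \1_D p * `|A (v j (p.1 + 0, p.2)) - A (u (p.1 + 0, p.2))|)
   = fun p => \1_D p * `|A (v j p) - A (u p)|.
  by apply/funext => -[x t]; rewrite /= addr0.
have i2' j := intg_indic_norm (i2 j).
have Eg j : (fun p => \1_D p * gap j (p, z)) = fun p =>
    \1_D p * `|A (v j (p.1 + round (h j) z, p.2)) - A (u (p.1 + z, p.2))|
    + \1_D p * `|A (v j (p.1 + 0, p.2)) - A (u (p.1 + 0, p.2))|.
  by apply/funext => -[x t]; rewrite /gap/= addr0 mulrDr.
split=> [j|].
  by rewrite Eg; apply: intgD; exact: intg_indic_norm.
under eq_fun do rewrite Eg RintD ?(intg_indic_norm (i1 _)) ?(intg_indic_norm (i2 _))//.
by rewrite -[0](addr0 0); apply: cvgD.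
Qed.

(** For each fixed z the gap tends to 0 in L^1(D), by the convergence of translates; Fubini and
    dominated convergence against the integrable far kernel carry this through the integral in z. *)
Lemma cvgL1_outer : cvgL1 D
  (fun j => nonlocal (round (h j)) (outer_weight lambda (h j) r) (A \o v j : XT d -> R))
  outer_limit.
Proof.
pose G j (pz : XT d * 'rV[R]_d) := \1_D pz.1 * gap j pz * far_kernel pz.2.
have mG j : measurable_fun setT (G j).
  apply: measurable_funM; last first.
    exact: (measurableT_comp (intg_measurable intg_far_kernel) (@measurable_snd _ _ _ _)).
  apply: measurable_funM => //.
  exact: (measurableT_comp (measurable_indic mD) (@measurable_fst _ _ _ _)).
have G0 j pz : 0 <= G j pz.
  have /andP[g0 _] := gapC j pz.
  by rewrite mulr_ge0 ?far_kernel_ge0// mulr_ge0// indic_ge0'.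
pose b := (C + C) + (C + C).
have iG j : (nu \x mu)%E.-integrable setT (EFin \o G j).
  apply: (@intg_prod_mul _ _ _ _ _ (xt_measure d) mu (fun p => b * \1_D p) far_kernel _ (mG j)).
  - by apply: intgZ; exact: intg_indic.
  - exact: intg_far_kernel.
  - move=> p z; rewrite ger0_norm ?G0// /G/= ler_wpM2r ?far_kernel_ge0//.
    by rewrite mulrC ler_wpM2r ?indic_ge0'//; have /andP[] := gapC j (p, z).
have dom j p : `|\1_D p * (nonlocal (round (h j)) (outer_weight lambda (h j) r) (A \o v j : XT d -> R) p
     - outer_limit p)| <= \int[mu]_z G j (p, z).
  rewrite nonlocal_outerE /outer_limit /nonlocal -RintB; last 2 first.
  - apply: (intg_bddMl _ _ intg_far_kernel).
      exact: (measurable_increment_at p (measurable_round (h0 j)) (mAv j)).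
    move=> z; apply: (increment_le (C := C)) => q.
    by exact: (lipschitz_bounded q (vM j)).
  - apply: (intg_bddMl _ _ intg_far_kernel).
      exact: (measurable_increment_at (s := id) p _ mAu).
    move=> z; apply: (increment_le (C := C)) => q.
    by exact: (lipschitz_bounded q uM).
  have igap : mu.-integrable setT (EFin \o (fun z => gap j (p, z) * far_kernel z)).
    apply: (intg_bddMl (C := b) _ _ intg_far_kernel).
      exact: (measurableT_comp (mgap j) (pair1_measurable p)).
    by move=> z; have /andP[g0 gb] := gapC j (p, z); rewrite ger0_norm.
  rewrite normrM (ger0_norm (indic_ge0' _ _)).
  have -> : \int[mu]_z G j (p, z) = \1_D p * \int[mu]_z (gap j (p, z) * far_kernel z).
    by rewrite -RintZ//; apply: eq_Rintegral => z _; rewrite /G/= mulrA.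
  rewrite ler_wpM2l ?indic_ge0'//; apply: ler_norm_Rint => //.
    apply: intgB; apply: (intg_bddMl _ _ intg_far_kernel).
    - exact: (measurable_increment_at p (measurable_round (h0 j)) (mAv j)).
    - move=> z; apply: (increment_le (C := C)) => q.
      by exact: (lipschitz_bounded q (vM j)).
    - exact: (measurable_increment_at (s := id) p _ mAu).
    - move=> z; apply: (increment_le (C := C)) => q.
      by exact: (lipschitz_bounded q uM).
  move=> z; rewrite -mulrBl normrM (ger0_norm (far_kernel_ge0 z)).
  rewrite ler_wpM2r ?far_kernel_ge0// /gap/=.
  set a1 := A _; set a2 := A _; set a3 := A _; set a4 := A _.
  have -> : a1 - a2 - (a3 - a4) = (a1 - a3) - (a2 - a4) by ring.
  exact: ler_normB.
have iGp j : nu.-integrable setT (EFin \o (fun p => \int[mu]_z G j (p, z))).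
  exact: (@intg_prod1 _ _ _ _ _ (xt_measure d) mu (G j) (iG j)).
have mO j : measurable_fun setT (fun p => \1_D p *
    (nonlocal (round (h j)) (outer_weight lambda (h j) r) (A \o v j : XT d -> R) p
     - outer_limit p)).
  apply: measurable_funM => //; apply: measurable_funB.
    exact: measurable_nonlocal_outer.
  exact: measurable_outer_limit.
have iO j := intg_le (mO j) (iGp j) (dom j).
split=> //.
apply: (@squeeze_cvgr _ _ _ _ (cst 0) (fun j => \int[nu]_p \int[mu]_z G j (p, z))).
- apply: nearW => j /=; apply/andP; split.
    by apply: Rintegral_ge0 => p _; rewrite mulr_ge0// indic_ge0'.
  apply: le_Rint => //; first exact: intg_indic_norm.
  by move=> p; apply: le_trans (dom j p); rewrite normrM (ger0_norm (indic_ge0' _ _)).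
- exact: cvg_cst.
have E j : \int[nu]_p \int[mu]_z G j (p, z) =
    \int[mu]_z ((\int[nu]_p (\1_D p * gap j (p, z))) * far_kernel z).
  rewrite (@Rint_fubini _ _ _ _ _ (xt_measure d) mu (G j) (iG j)).
  apply: eq_Rintegral => z _; rewrite mulrC -RintZ; last by have [] := cvg_gap z.
  by apply: eq_Rintegral => p _; rewrite /G/= mulrC.
under eq_fun do rewrite E.
have -> : (0 : R) = \int[mu]_z (cst 0 z) by rewrite Rintegral_cst// mul0r.
apply: (cvg_Rint (g := fun z => (b * \int[nu]_p \1_D p) * far_kernel z)).
- move=> j; apply: measurable_funM; last exact: intg_measurable intg_far_kernel.
  have mDg : measurable_fun setT (fun pz : XT d * 'rV[R]_d => \1_D pz.1 * gap j pz).
    apply: measurable_funM => //.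
    exact: (measurableT_comp (measurable_indic mD) (@measurable_fst _ _ _ _)).
  exact: (@measurable_Rint2 _ _ _ _ _ (xt_measure d) _ mDg).
- exact: measurable_cst.
- apply: aeW => z; rewrite -[X in _ --> X](mul0r (far_kernel z)).
  by apply: cvgMl; have [] := cvg_gap z.
- exact: intgZ intg_far_kernel.
- move=> j z; rewrite normrM (ger0_norm (far_kernel_ge0 z)).
  rewrite ler_wpM2r ?far_kernel_ge0// -RintZ; last exact: intg_indic.
  apply: ler_norm_Rint.
  + by have [] := cvg_gap z.
  + by apply: intgZ; exact: intg_indic.
  + move=> p; have /andP[g0 gb] := gapC j (p, z).
    by rewrite normrM (ger0_norm (indic_ge0' _ _)) (ger0_norm g0) mulrC ler_wpM2r// indic_ge0'.
Qed.

End outer_operator.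

(** * The limit inequality *)

Section average_levels.
Context {R : realType} {d : nat}.
Local Notation XT d := ('rV[R]_d * measurableTypeR R)%type.
Local Notation E := ('rV[R]_d * R)%type.
Local Notation nu := (lebesgue_xt d).
Variables (LA LF M W : R) (A : R -> R) (f : R -> 'rV[R]_d).
Variables (F : 'I_d -> R -> R -> R) (u : XT d -> R) (D : set (XT d)).
Hypotheses (d0 : (0 < d)%N).
Hypothesis lipA : forall a b, `|A a - A b| <= LA * `|a - b|.
Hypothesis hF : numerical_flux f LF F.
Hypotheses (mu_ : measurable_fun setT u) (uM : forall p, `|u p| <= M).
Hypotheses (mD : measurable D) (nuD : (nu D < +oo)%E).
Variables (a g o : XT d -> R) (b : 'I_d -> XT d -> R) (C : R).
Hypotheses (ma : measurable_fun setT a) (mg : measurable_fun setT g).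
Hypotheses (mo : measurable_fun setT o) (mb : forall l, measurable_fun setT (b l)).
Hypotheses (aC : forall p, `|a p| <= C * \1_D p) (gC : forall p, `|g p| <= C * \1_D p).
Hypotheses (oC : forall p, `|o p| <= C * \1_D p).
Hypothesis bC : forall l p, `|b l p| <= C * \1_D p.

(** The terms that depend continuously on the level; in [level_integrand] only the sign jumps with
    [k]. *)
Definition level_regular k p : R := `|u p - k| * a p
  + \sum_(l < d) qflux f k (u p) l * b l p + `|A (u p) - A k| * g p.

Definition level_integrand k p : R := level_regular k p + Num.sg (u p - k) * o p.

Hypothesis W0 : 0 <= W.
Hypothesis ineq : forall k delta, 0 < delta ->
  0 <= \int[nu]_p level_integrand k p
    + W * \int[nu]_p (\1_D p * (`|u p - k| <= delta)%R%:R).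

(** By consistency the entropy flux is f(max(u, k)) - f(min(u, k)), in which the discontinuous sign
    has disappeared. Two numerical fluxes with two arguments each give the factor 4. *)
Lemma qflux_level_lipschitz k k' x l :
  `|qflux f k x l - qflux f k' x l| <= 4 * LF * `|k - k'|.
Proof.
rewrite -!(num_entropy_flux_consistent _ hF) /num_entropy_flux.
have [lipF _ _ _] := hF l; have LF0 := LF_ge0 d0 hF.
have dmax : `|Num.max x k - Num.max x k'| <= `|k - k'|.
  have h1 := ler_norm (k - k'); have := ler_norm (k' - k); rewrite distrC ler_norml.
  by case: (leP x k); case: (leP x k') => *; apply/andP; split; lra.
have dmin : `|Num.min x k - Num.min x k'| <= `|k - k'|.
  have h1 := ler_norm (k - k'); have := ler_norm (k' - k); rewrite distrC ler_norml.
  by case: (leP x k); case: (leP x k') => *; apply/andP; split; lra.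
have h1 := lipF (Num.max x k) (Num.max x k) (Num.max x k') (Num.max x k').
have h2 := lipF (Num.min x k) (Num.min x k) (Num.min x k') (Num.min x k').
set x1 := F l _ _ in h1 *; set x2 := F l (Num.min x k) _ in h2 *.
set x3 := F l _ _ in h1 *; set x4 := F l (Num.min x k') _ in h2 *.
have -> : x1 - x2 - (x3 - x4) = (x1 - x3) - (x2 - x4) by ring.
rewrite (le_trans (ler_normB _ _))//.
have -> : 4 * LF * `|k - k'| = LF * (`|k - k'| + `|k - k'|) + LF * (`|k - k'| + `|k - k'|) by ring.
by apply: lerD; [apply: le_trans h1 _|apply: le_trans h2 _]; rewrite ler_wpM2l// lerD.
Qed.

Lemma measurable_qflux k l : measurable_fun setT (fun p => qflux f k (u p) l).
Proof.
under eq_fun do rewrite -(num_entropy_flux_consistent k hF).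
exact: (measurable_lipschitz2 (num_entropy_flux_lipschitz k hF l) mu_ mu_).
Qed.

Lemma measurable_level_regular k : measurable_fun setT (level_regular k).
Proof.
have mA : measurable_fun setT A by exact: measurable_lipschitz (LA_ge0 lipA) lipA.
apply: measurable_funD; last first.
  apply: measurable_funM => //; apply: measurableT_comp => //.
  by apply: measurable_funB => //; exact: measurableT_comp mA mu_.
apply: measurable_funD.
  apply: measurable_funM => //; apply: measurableT_comp => //.
  exact: measurable_funB.
apply: measurable_sum => l; apply: measurable_funM => //; exact: measurable_qflux.
Qed.

Lemma measurable_level_integrand k : measurable_fun setT (level_integrand k).
Proof.
apply: measurable_funD; first exact: measurable_level_regular.
apply: measurable_funM => //; apply: measurableT_comp; first exact: measurable_sgr.
exact: measurable_funB.
Qed.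

(** [M + N] bounds |u - k| when |k| <= N, the factor 4 LF comes from [qflux_level_lipschitz], and
    the 1 bounds the sign. *)
Definition level_bound (N : R) : R :=
  ((M + N) + d%:R * (4 * LF * (M + N)) + LA * (M + N) + 1) * C.

Lemma level_integrand_le N k p : `|k| <= N ->
  `|level_integrand k p| <= level_bound N * \1_D p.
Proof.
move=> kN; have LF0 := LF_ge0 d0 hF; have LA0 := LA_ge0 lipA.
have uk : `|u p - k| <= M + N by rewrite (le_trans (ler_normB _ _))// lerD.
have MN0 : 0 <= M + N by exact: le_trans uk.
have -> : level_bound N * \1_D p = (M + N) * (C * \1_D p)
   + \sum_(l < d) (4 * LF * (M + N)) * (C * \1_D p) + LA * (M + N) * (C * \1_D p)
   + 1 * (C * \1_D p).
  by rewrite sumr_const card_ord -[X in _ + X + _ + _]mulr_natl /level_bound; ring.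
rewrite (le_trans (ler_normD _ _))// lerD//; last first.
  by rewrite normrM ler_pM// normr_sg; case: (_ != _).
rewrite (le_trans (ler_normD _ _))// lerD//; last first.
  rewrite normrM normr_id ler_pM// (le_trans (lipA _ _))// ler_wpM2l//.
rewrite (le_trans (ler_normD _ _))// lerD//.
  by rewrite normrM normr_id ler_pM.
rewrite (le_trans (ler_norm_sum _ _ _))//; apply: ler_sum => l _.
rewrite normrM ler_pM//.
have := qflux_level_lipschitz k (u p) (u p) l.
rewrite [qflux f (u p) (u p) l]/qflux /deta subrr sgr0 mul0r subr0 => /le_trans; apply.
by rewrite ler_wpM2l ?mulr_ge0// distrC.
Qed.

Lemma intg_level_integrand k : nu.-integrable setT (EFin \o level_integrand k).
Proof.
apply: (intg_le (measurable_level_integrand k) _ (fun p => level_integrand_le p (lexx _))).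
by apply: intgZ; exact: intg_indic.
Qed.

Lemma cvg_level_regular (s : nat -> R) k p : s n @[n --> \oo] --> k ->
  level_regular (s n) p @[n --> \oo] --> level_regular k p.
Proof.
move=> sk; have LA0 := LA_ge0 lipA; apply: cvgD; last first.
  apply: cvgMl; apply: cvg_norm; apply: cvgB; first exact: cvg_cst.
  exact: (cvg_comp _ A sk (lipschitz_continuous LA0 lipA (x := k))).
apply: cvgD.
  by apply: cvgMl; apply: cvg_norm; apply: cvgB => //; exact: cvg_cst.
apply: cvg_big => [|l _]; first exact: add_continuous.
apply: cvgMl; apply/cvgrPdist_le => eps eps0.
have LF0 := LF_ge0 d0 hF.
have e1 : 0 < eps / (4 * LF + 1) by rewrite divr_gt0// ltr_wpDl// mulr_ge0.
have /cvgrPdist_le/(_ _ e1) := sk; apply: filterS => n kn.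
rewrite (le_trans (qflux_level_lipschitz _ _ _ _))//.
move: kn; rewrite ler_pdivlMr ?ltr_wpDl ?mulr_ge0// mulrC; apply: le_trans.
by rewrite ler_wpM2r// lerDl.
Qed.

(** For x = 0 the two signs cancel. Otherwise 2 s is eventually below |x| / 2, so both shifted
    points keep the sign of x and lie outside the window of radius s. *)
Lemma sgr_average (x : R) (s : nat -> R) : (forall n, 0 < s n) ->
  s n @[n --> \oo] --> 0 ->
  \forall n \near \oo, Num.sg (x - 2 * s n) + Num.sg (x + 2 * s n) = 2 * Num.sg x
    /\ ~~ (`|x - 2 * s n| <= s n) /\ ~~ (`|x + 2 * s n| <= s n).
Proof.
move=> s0 sc; have [->|x0] := eqVneq x 0.
  apply: nearW => n; have sn := s0 n; rewrite !add0r sgrN addNr sgr0 mulr0.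
  rewrite normrN gtr0_norm ?mulr_gt0//; split=> //.
  by rewrite -!ltNge; split; lra.
have x3 : 0 < `|x| / 4 by rewrite divr_gt0 ?normr_gt0.
have /cvgrPdist_lt/(_ _ x3) := sc; apply: filterS => n.
rewrite sub0r normrN (gtr0_norm (s0 n)) => sx; have sn := s0 n.
case: (ltgtP x 0) x0 => // x0 _.
- rewrite (ltr0_norm x0) in sx.
  have x1 : x - 2 * s n < 0 by lra.
  have x2 : x + 2 * s n < 0 by lra.
  rewrite !ltr0_sg// !ltr0_norm// -!ltNge; split; first lra.
  by split; lra.
- rewrite (gtr0_norm x0) in sx.
  have x1 : 0 < x - 2 * s n by lra.
  have x2 : 0 < x + 2 * s n by lra.
  rewrite !gtr0_sg// !gtr0_norm// -!ltNge; split; first lra.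
  by split; lra.
Qed.

(* [sgn 0 = 0] is the mean of the two one-sided limits of the sign, and the
   level [k] stays away from the windows of radius [delta] at [k +- 2 delta]. *)
Lemma average_levels k : 0 <= \int[nu]_p level_integrand k p.
Proof.
pose s n : R := n.+1%:R^-1.
have s0 n : 0 < s n by rewrite invr_gt0.
have sc : s n @[n --> \oo] --> 0 by exact: cvg_harmonic.
have s1 n : s n <= 1 by rewrite invf_le1 ?ler1n.
pose near_ k' del p : R := (`|u p - k'| <= del)%R%:R.
have mnear k' del : measurable_fun setT (near_ k' del).
  apply: measurable_boolR; apply: measurable_fun_ler => //.
  by apply: measurableT_comp => //; exact: measurable_funB.
have near1 k' del p : `|near_ k' del p| <= 1.
  by rewrite /near_; case: (`|u p - k'| <= del); rewrite ?normr1 ?normr0.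
have inear k' del : nu.-integrable setT (EFin \o (fun p => \1_D p * near_ k' del p)).
  exact: (intg_indicM mD nuD (mnear k' del) (near1 k' del)).
pose H n p := level_integrand (k + 2 * s n) p + level_integrand (k - 2 * s n) p
  + W * (\1_D p * near_ (k + 2 * s n) (s n) p + \1_D p * near_ (k - 2 * s n) (s n) p).
have H0 n : 0 <= \int[nu]_p H n p.
  have iI k' := intg_level_integrand k'.
  have i1 := intgD (iI (k + 2 * s n)) (iI (k - 2 * s n)).
  have i2 := intgD (inear (k + 2 * s n) (s n)) (inear (k - 2 * s n) (s n)).
  rewrite /H (RintD i1 (intgZ W i2)) (RintZ W i2) (RintD (iI _) (iI _)).
  rewrite (RintD (inear _ _) (inear _ _)).
  have := ineq (k + 2 * s n) (s0 n); have := ineq (k - 2 * s n) (s0 n).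
  by rewrite /near_; lra.
have Hc : \int[nu]_p H n p @[n --> \oo] --> \int[nu]_p (2 * level_integrand k p).
  apply: (cvg_Rint (g := fun p => (2 * level_bound (`|k| + 2) + 2 * W) * \1_D p)).
  - move=> n; apply: measurable_funD.
      by apply: measurable_funD; exact: measurable_level_integrand.
    apply: measurable_funM => //; apply: measurable_funD; apply: measurable_funM => //;
      exact: measurable_indic.
  - by apply: measurable_funM => //; exact: measurable_level_integrand.
  - apply: aeW => p.
    have -> : 2 * level_integrand k p = level_regular k p + level_regular k p
        + 2 * Num.sg (u p - k) * o p.
      by rewrite /level_integrand; ring.
    pose J n := level_regular (k + 2 * s n) p + level_regular (k - 2 * s n) p.
    have Jc : J n @[n --> \oo] --> level_regular k p + level_regular k p.
      have s2c : 2 * s n @[n --> \oo] --> 0 by rewrite -(mulr0 2); exact: cvgMr.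
      apply: cvgD; apply: cvg_level_regular.
        by rewrite -[X in _ --> X](addr0 k); apply: cvgD => //; exact: cvg_cst.
      by rewrite -[X in _ --> X](subr0 k); apply: cvgB => //; exact: cvg_cst.
    have near_eq : \forall n \near \oo, J n + 2 * Num.sg (u p - k) * o p = H n p.
      apply: filterS (sgr_average (u p - k) s0 sc) => n [sgE [/negbTE n1 /negbTE n2]].
      rewrite /H /near_ /level_integrand.
      have E1 : u p - (k + 2 * s n) = u p - k - 2 * s n by ring.
      have E2 : u p - (k - 2 * s n) = u p - k + 2 * s n by ring.
      have Z : false%:R = 0 :> R by [].
      by rewrite E1 E2 n1 n2 -sgE /J Z; ring.
    apply: (cvg_trans (near_eq_cvg near_eq)).
    by apply: cvgD => //; exact: cvg_cst.
  - by apply: intgZ; exact: intg_indic.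
  - move=> n p; rewrite mulrDl (le_trans (ler_normD _ _))// lerD//.
      have sn := s0 n; have sn1 := s1 n.
      have k1 : `|k + 2 * s n| <= `|k| + 2.
        by rewrite (le_trans (ler_normD _ _))// lerD2l gtr0_norm ?mulr_gt0//; lra.
      have k2 : `|k - 2 * s n| <= `|k| + 2.
        by rewrite (le_trans (ler_normB _ _))// lerD2l gtr0_norm ?mulr_gt0//; lra.
      rewrite (le_trans (ler_normD _ _))//.
      have -> : 2 * level_bound (`|k| + 2) * \1_D p =
          level_bound (`|k| + 2) * \1_D p + level_bound (`|k| + 2) * \1_D p by ring.
      by apply: lerD; exact: level_integrand_le.
    rewrite normrM (ger0_norm W0) mulrAC mulrC ler_wpM2r// -mulrDr normrM.
    rewrite (ger0_norm (indic_ge0' _ _)) mulrC ler_wpM2r ?indic_ge0'//.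
    by rewrite (le_trans (ler_normD _ _))// -[leRHS]/(1 + 1) lerD.
rewrite -(pmulr_rge0 _ (ltr0Sn R 1)) -RintZ; last exact: intg_level_integrand.
by rewrite -(cvg_lim _ Hc)//; apply: limr_ge; [apply/cvg_ex; eexists; exact: Hc|exact: nearW].
Qed.

End average_levels.

(** If |b - k| > delta and |a - b| < delta, then a and b lie on the same side of k. In the remaining
    cases the difference, which is at most 2, is charged to the window or to |a - b| >= delta. *)
Lemma dist_sgr (R : realType) (a b k delta : R) : 0 < delta ->
  `|Num.sg (a - k) - Num.sg (b - k)| <=
  2 * (`|b - k| <= delta)%R%:R + 2 / delta * `|a - b|.
Proof.
move=> delta0; have sg1 (x : R) : `|Num.sg x| <= 1 by rewrite normr_sg; case: (_ != _).
have sg2 : `|Num.sg (a - k) - Num.sg (b - k)| <= 2.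
  by rewrite (le_trans (ler_normB _ _))// -[leRHS]/(1 + 1) lerD.
have nn : 0 <= 2 / delta * `|a - b| by rewrite mulr_ge0// divr_ge0// ltW.
have [bk|kb] := lerP `|b - k| delta; first by rewrite mulr1 (le_trans sg2)// lerDl.
rewrite mulr0 add0r; have [ab|ab] := lerP delta `|a - b|.
  by rewrite (le_trans sg2)// mulrAC ler_pdivlMr// ler_wpM2l.
suff -> : Num.sg (a - k) = Num.sg (b - k) by rewrite subrr normr0.
have ab' := lt_trans ab kb; have : `|a - b| < `|b - k| by [].
rewrite ltr_norml; case: (ltgtP b k) => bk.
- have bk' : b - k < 0 by rewrite subr_lt0.
  rewrite (ltr0_norm bk') => /andP[h1 h2].
  by rewrite !ltr0_sg//; lra.
- have bk' : 0 < b - k by rewrite subr_gt0.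
  rewrite (gtr0_norm bk') => /andP[h1 h2].
  by rewrite !gtr0_sg//; lra.
- by move: kb; rewrite bk subrr normr0 ltNge (ltW delta0).
Qed.

Section limit_inequality.
Context {R : realType} {d : nat}.
Local Notation XT d := ('rV[R]_d * measurableTypeR R)%type.
Local Notation E := ('rV[R]_d * R)%type.
Local Notation nu := (lebesgue_xt d).
Local Notation mu := (@lebesgue_rV R d).
Variables (c lambda T r LA LF M : R) (A : R -> R) (f : R -> 'rV[R]_d).
Variables (F : 'I_d -> R -> R -> R) (v : nat -> E -> R) (u : E -> R).
Variables (h tau : nat -> R).
Hypotheses (hlambda : 0 < lambda < 2) (r0 : 0 < r) (c0 : 0 < c) (d0 : (0 < d)%N).
Hypothesis lipA : forall a b, `|A a - A b| <= LA * `|a - b|.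
Hypothesis hF : numerical_flux f LF F.
Hypotheses (h0 : forall j, 0 < h j) (hcvg : h j @[j --> \oo] --> 0).
Hypotheses (tau0 : forall j, 0 < tau j) (taucvg : tau j @[j --> \oo] --> 0).
Hypothesis mv : forall j, measurable_fun setT (v j : XT d -> R).
Hypothesis mu_ : measurable_fun setT (u : XT d -> R).
Hypothesis vM : forall j p, `|v j p| <= M.
Hypothesis uM : forall p, `|u p| <= M.
Hypothesis vlc : forall j, {ae nu, forall p : XT d,
  \forall q \near (p : E), v j q = v j p}.
Hypothesis ivu : forall j,
  nu.-integrable setT (EFin \o (fun p : XT d => v j p - u p)).
Hypothesis vu : \int[nu]_p `|v j p - u p| @[j --> \oo] --> 0.
Hypothesis dv : forall j, discrete_entropy T c lambda (h j) A F (tau j) (v j).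

Variables (phi : E -> R) (m e C B : R).
Hypotheses (cphi : continuous phi) (phi0 : forall p, 0 <= phi p).
Hypothesis phiC : forall p, `|phi p| <= C.
Hypothesis phi_supp : forall p, phi p != 0 ->
  (forall i, `|p.1 ord0 i| <= m) /\ e <= p.2 <= T - e.
Hypotheses (h1 : forall j, h j <= 1) (taue : forall j, tau j < e) (B0 : 0 <= B).
Hypothesis dphi_t : forall p, derivable phi p (((0 : 'rV[R]_d), 1) : E).
Hypothesis dphi_x : forall l p, derivable phi p (('e_l, 0) : E).
Hypothesis mdt : measurable_fun setT (partial_t phi : XT d -> R).
Hypothesis mdx : forall l, measurable_fun setT (partial_x l phi : XT d -> R).
Hypothesis dtC : forall p, `|partial_t phi p| <= C.
Hypothesis dxC : forall l p, `|partial_x l phi p| <= C.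
Hypothesis sdB : forall p y,
  `|second_difference phi p y| <= B * enorm y ^+ 2.

(** The support of [phi] enlarged by the reach of the translations: 1 for a grid step, as h <= 1,
    and 2 r for the rounding of a point with |z| <= r. *)
Let b : R := m + 2 * r + 1.

Definition support_box : set (XT d) :=
  [set x : 'rV[R]_d | forall i, (`[- b, b]%classic : set R) (x ord0 i)] `*` `[0, T]%classic.

Local Notation D := support_box.

Lemma measurable_support_box : measurable D.
Proof.
apply: measurableX; last exact: measurable_itv.
by apply: (@measurable_box _ _ (fun=> `[- b, b]%classic)) => i; exact: measurable_itv.
Qed.

Lemma support_box_finite : (nu D < +oo)%E.
Proof.
rewrite /D lebesgue_xtX; last 2 first.
- by apply: (@measurable_box _ _ (fun=> `[- b, b]%classic)) => i; exact: measurable_itv.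
- exact: measurable_itv.
rewrite (@lebesgue_rV_box _ _ (fun=> `[- b, b]%classic)); last by move=> i; exact: measurable_itv.
have fin (a a' : R) : lebesgue_measure (`[a, a']%classic : set R) \is a fin_num.
  by rewrite lebesgue_measure_itv/=; case: ifP.
rewrite ltey_eq fin_numM//.
apply: (big_ind (fun x : \bar R => x \is a fin_num)) => // x y.
exact: fin_numM.
Qed.

Lemma phi_off_box p (y : 'rV[R]_d) s : ~ D p -> (forall i, `|y ord0 i| <= 2 * r + 1) ->
  `|s| <= e -> phi (p.1 + y, p.2 + s) = 0.
Proof.
move=> nDp yr se; apply: contra_notP nDp => /eqP/phi_supp[/= ym /andP[e1 e2]].
split=> /=; last first.
  by rewrite in_itv/=; move: se; rewrite ler_norml => /andP[s1 s2]; apply/andP; split; lra.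
move=> i; rewrite in_itv/= -ler_norml /b.
have := ym i; have := yr i; rewrite !mxE.
have := ler_normB (p.1 ord0 i + y ord0 i) (y ord0 i); rewrite addrK.
by move=> h2 h3 h4; rewrite (le_trans h2)//; lra.
Qed.

Let e0 : 0 < e. Proof. exact: lt_trans (taue 0). Qed.

Let mphi : measurable_fun setT (phi : XT d -> R).
Proof. exact: continuous_measurable_xt. Qed.

Let phiD p : ~ D p -> phi p = 0.
Proof.
move=> nDp; have := @phi_off_box p 0 0 nDp; rewrite !addr0 -surjective_pairing; apply.
  by move=> i; rewrite mxE normr0 addr_ge0// mulr_ge0// ltW.
by rewrite normr0 ltW.
Qed.

Let iphi : nu.-integrable setT (EFin \o (phi : XT d -> R)).
Proof.
exact: (intg_bounded_support measurable_support_box support_box_finite mphi phiC phiD).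
Qed.

Let scale_t (p : E) (s : R) : p + s *: ((0 : 'rV[R]_d), 1) = (p.1 + 0, p.2 + s).
Proof.
by case: p => x t; congr (_, _) => /=; rewrite ?scaler0// [s *: 1]mulr1.
Qed.

Let scale_x (p : E) (s : R) (l : 'I_d) : p + s *: (('e_l : 'rV[R]_d), 0) = (p.1 + s *: 'e_l, p.2 + 0).
Proof. by case: p => x t; congr (_, _) => /=; rewrite [s *: 0]mulr0. Qed.

Let e_le (s : R) (l : 'I_d) i : `|s| <= 1 -> `|(s *: 'e_l : 'rV[R]_d) ord0 i| <= 2 * r + 1.
Proof.
move=> s1; rewrite !mxE eqxx/= normrM.
have h2 : `|s| * `|(i == l)%:R| <= 1.
  by case: (i == l); rewrite ?normr1 ?normr0 ?mulr1 ?mulr0.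
by rewrite (le_trans h2)// lerDr mulr_ge0// ltW.
Qed.

Lemma partial_t_off p : ~ D p -> partial_t phi p = 0.
Proof.
move=> nDp; rewrite /partial_t; have tn0 j : tau j != 0 by rewrite gt_eqF.
have := quotient_cvg (@dphi_t p) tn0 taucvg.
have -> : (fun j => (phi (p + tau j *: ((0 : 'rV[R]_d), 1)) - phi p) / tau j) = fun=> 0.
  apply/funext => j; rewrite scale_t (phi_off_box nDp) ?phiD ?subrr ?mul0r//.
    by move=> i; rewrite mxE normr0 addr_ge0// mulr_ge0// ltW.
  by rewrite gtr0_norm// ltW.
by move=> /(cvg_unique _ (cvg_cst 0)) <-.
Qed.

Lemma partial_x_off l p : ~ D p -> partial_x l phi p = 0.
Proof.
move=> nDp; rewrite /partial_x; have hn0 j : h j != 0 by rewrite gt_eqF.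
have := quotient_cvg (@dphi_x l p) hn0 hcvg.
have -> : (fun j => (phi (p + h j *: (('e_l : 'rV[R]_d), 0)) - phi p) / h j) = fun=> 0.
  apply/funext => j; rewrite scale_x (phi_off_box nDp) ?phiD ?subrr ?mul0r//.
    by move=> i; apply: e_le; rewrite gtr0_norm.
  by rewrite normr0 ltW.
by move=> /(cvg_unique _ (cvg_cst 0)) <-.
Qed.

Lemma cvgL1_vu : cvgL1 D v u.
Proof.
have h2 : forall i, (fun=> (0 : 'rV[R]_d)) j ord0 i @[j --> \oo] --> (0 : 'rV[R]_d) ord0 i.
  by move=> i; exact: cvg_cst.
have h3 : (fun=> (0 : R)) j @[j --> \oo] --> 0 by exact: cvg_cst.
have := cvgL1_shift mv vM vlc ivu vu measurable_support_box support_box_finite h2 h3.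
have Esh : xt_shift (0, 0) = @id (XT d).
  by apply/funext => -[x t]; rewrite /xt_shift/= !addr0.
by rewrite Esh.
Qed.

Lemma cvg_time_term k :
  nu.-integrable setT (EFin \o (fun p => `|u p - k| * partial_t phi p)) /\
  \int[nu]_p (`|v j p - k| * ((phi p - phi (xt_shift (0, - tau j) p)) / tau j))
    @[j --> \oo] --> \int[nu]_p (`|u p - k| * partial_t phi p).
Proof.
have tn0 j : - tau j != 0 by rewrite oppr_eq0 gt_eqF.
have tc : - tau j @[j --> \oo] --> 0 by rewrite -oppr0; exact: cvgN.
have Eq j p : (phi p - phi (xt_shift (0, - tau j) p)) / tau j =
    (phi (p + - tau j *: ((0 : 'rV[R]_d), 1)) - phi p) / - tau j.
  by rewrite scale_t /xt_shift/= invrN mulrN -mulNr opprB.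
have mvk (w : E -> R) : measurable_fun setT (w : XT d -> R) ->
    measurable_fun setT (fun p : XT d => `|w p - k|).
  by move=> mw; apply: measurableT_comp => //; exact: measurable_funB.
apply: (cvg_Rint_product measurable_support_box support_box_finite
  (Cf := M + `|k|) (Cg := C)) => //.
- by move=> j; exact: mvk.
- exact: mvk.
- move=> j; apply: measurable_funM => //; apply: measurable_funB => //.
  by apply: measurableT_comp mphi _; exact: measurable_xt_shift.
- by move=> j p; rewrite normr_id (le_trans (ler_normB _ _))// lerD.
- by move=> j p; rewrite Eq; exact: quotient_le.
- move=> j p nDp; rewrite /xt_shift (phi_off_box nDp) ?phiD ?subrr ?mul0r//.
    by move=> i; rewrite mxE normr0 addr_ge0// mulr_ge0// ltW.
  by rewrite normrN gtr0_norm// ltW.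
- by move=> p; under eq_fun do rewrite Eq; exact: quotient_cvg.
- apply: (cvgL1_dom measurable_support_box (L := 1) _ _ _ _ cvgL1_vu) => //.
  + by move=> j; exact: mvk.
  + exact: mvk.
  + move=> j p _; rewrite mul1r; apply: le_trans (ler_dist_dist _ _) _.
    by rewrite opprB addrA subrK.
Qed.

Lemma cvg_flux_term k l :
  nu.-integrable setT (EFin \o (fun p => qflux f k (u p) l * partial_x l phi p)) /\
  \int[nu]_p (num_entropy_flux F k l (v j p) (v j (xt_shift (h j *: 'e_l, 0) p))
        * ((phi (xt_shift (h j *: 'e_l, 0) p) - phi p) / h j))
    @[j --> \oo] --> \int[nu]_p (qflux f k (u p) l * partial_x l phi p).
Proof.
have hn0 j : h j != 0 by rewrite gt_eqF.
have mQ (w1 w2 : XT d -> R) : measurable_fun setT w1 -> measurable_fun setT w2 ->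
    measurable_fun setT (fun p => num_entropy_flux F k l (w1 p) (w2 p)).
  exact: (measurable_lipschitz2 (num_entropy_flux_lipschitz k hF l)).
have mQu : measurable_fun setT (fun p : XT d => qflux f k (u p) l).
  by under eq_fun do rewrite -(num_entropy_flux_consistent k hF); exact: mQ.
have mvs j : measurable_fun setT (fun p : XT d => v j (xt_shift (h j *: 'e_l, 0) p)).
  by apply: measurableT_comp (mv j) _; exact: measurable_xt_shift.
have LF0 := LF_ge0 d0 hF.
apply: (cvg_Rint_product measurable_support_box support_box_finite
  (f_ := fun j p => num_entropy_flux F k l (v j p) (v j (xt_shift (h j *: 'e_l, 0) p)))
  (f := fun p => qflux f k (u p) l)
  (g_ := fun j p => (phi (xt_shift (h j *: 'e_l, 0) p) - phi p) / h j)
  (g := partial_x l phi)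
  (Cf := 2 * LF * ((M + `|k|) + (M + `|k|))) (Cg := C)).
- by move=> j; exact: mQ.
- exact: mQu.
- move=> j; apply: measurable_funM => //; apply: measurable_funB => //.
  by apply: measurableT_comp mphi _; exact: measurable_xt_shift.
- exact: mdx.
- by move=> j p; exact: (num_entropy_flux_le k hF).
- by move=> j p; rewrite /xt_shift -scale_x; exact: (quotient_le (@dphi_x l) (@dxC l)).
- move=> j p nDp; rewrite /xt_shift (phi_off_box nDp) ?phiD ?subrr ?mul0r//.
    by move=> i; apply: e_le; rewrite gtr0_norm.
  by rewrite normr0 ltW.
- move=> p; under eq_fun do rewrite /xt_shift -scale_x.
  exact: (quotient_cvg (@dphi_x l p) hn0 hcvg).
- have hc i : (h j *: 'e_l : 'rV[R]_d) ord0 i @[j --> \oo] --> (0 : 'rV[R]_d) ord0 i.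
    rewrite mxE -[X in _ --> X](mul0r (('e_l : 'rV[R]_d) ord0 i)).
    by under eq_fun do rewrite mxE; exact: cvgMl.
  have h3 : (fun=> (0 : R)) j @[j --> \oo] --> 0 by exact: cvg_cst.
  have shc := cvgL1_shift mv vM vlc ivu vu measurable_support_box support_box_finite hc h3.
  apply: (cvgL1_add measurable_support_box (L := 2 * LF) _ _ _ _ cvgL1_vu shc) => //.
  + by rewrite mulr_ge0.
  + by move=> j; exact: mQ.
  + move=> j p; rewrite -(num_entropy_flux_consistent k hF).
    have -> : xt_shift (0, 0) p = p by case: p => x t; rewrite /xt_shift/= !addr0.
    exact: num_entropy_flux_lipschitz.
Qed.

Let Phi j := nonlocal (fun z => - round (h j) z) (inner_weight lambda (h j) r) (phi : XT d -> R).

Let phib : exists C, forall p, `|phi p| <= C. Proof. by exists C. Qed.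

Let mPhi j : measurable_fun setT (Phi j).
Proof.
apply: (measurable_nonlocal _ (intg_inner_weight r (h0 j) hlambda) mphi).
exact: (measurableT_comp (@measurable_rV_opp _ _) (measurable_round (h0 j))).
Qed.

Let cPhi p : Phi j p @[j --> \oo] --> inner_limit lambda r phi p.
Proof. exact: (cvg_nonlocal_inner hlambda B0). Qed.

Let Phi_off j p : ~ D p -> Phi j p = 0.
Proof.
move=> nDp; rewrite /Phi /nonlocal (@eq_Rintegral _ _ _ mu setT (fun=> 0)).
  by rewrite Rintegral_cst// mul0r.
move=> z _; rewrite /inner_weight; have [zr|zr] := boolP (enorm z <= r); last first.
  by rewrite mul0r mulr0.
have := @phi_off_box p (- round (h j) z) 0 nDp; rewrite addr0 => ->.
+ by rewrite phiD// subrr mul0r.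
+ move=> i; rewrite mxE normrN (le_trans (round_le _ _ (h0 j)))//.
  have := le_trans (coord_le_enorm z i) zr.
  by move: `|_| => x xr; lra.
+ by rewrite normr0 ltW.
Qed.

Let Phi_le j p : `|Phi j p| <= 4 * B * (1 + r ^+ 2) * \int[mu]_z (@levy R d lambda) z.
Proof. exact: nonlocal_inner_le. Qed.

Lemma measurable_inner_limit : measurable_fun setT (inner_limit lambda r phi : XT d -> R).
Proof. by apply: (@measurable_fun_cvg _ _ _ _ Phi) => // p _; exact: cPhi. Qed.

Lemma inner_limit_le p : `|inner_limit lambda r phi p| <=
  4 * B * (1 + r ^+ 2) * \int[mu]_z (@levy R d lambda) z.
Proof.
have cn : `|Phi j p| @[j --> \oo] --> `|inner_limit lambda r phi p| by exact: cvg_norm.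
rewrite -(cvg_lim _ cn)//.
by apply: limr_le; [apply/cvg_ex; eexists; exact: cn|exact: nearW].
Qed.

Lemma inner_limit_off p : ~ D p -> inner_limit lambda r phi p = 0.
Proof.
move=> nDp; have := @cPhi p; under eq_fun do rewrite Phi_off//.
by move=> /(cvg_unique _ (cvg_cst 0)) <-.
Qed.

Lemma cvg_inner_term k :
  nu.-integrable setT (EFin \o (fun p => `|A (u p) - A k| * inner_limit lambda r phi p)) /\
  \int[nu]_p (`|A (v j p) - A k|
        * nonlocal (fun z => - round (h j) z) (inner_weight lambda (h j) r) (phi : XT d -> R) p)
    @[j --> \oo] --> \int[nu]_p (`|A (u p) - A k| * inner_limit lambda r phi p).
Proof.
have LA0 := LA_ge0 lipA.
have mA : measurable_fun setT A by exact: measurable_lipschitz LA0 lipA.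
have mAk (w : E -> R) : measurable_fun setT (w : XT d -> R) ->
    measurable_fun setT (fun p : XT d => `|A (w p) - A k|).
  move=> mw; apply: measurableT_comp => //; apply: measurable_funB => //.
  exact: (measurableT_comp mA mw).
apply: (cvg_Rint_product measurable_support_box support_box_finite
  (Cf := LA * (M + `|k|)) (Cg := 4 * B * (1 + r ^+ 2) * \int[mu]_z levy lambda z)) => //.
- by move=> j; exact: mAk.
- exact: mAk.
- exact: measurable_inner_limit.
- move=> j p; rewrite normr_id (le_trans (lipA _ _))// ler_wpM2l//.
  by rewrite (le_trans (ler_normB _ _))// lerD.
- apply: (cvgL1_dom measurable_support_box (L := LA) _ _ _ _ cvgL1_vu) => //.
  + by move=> j; exact: mAk.
  + exact: mAk.
  + move=> j p _; apply: le_trans (ler_dist_dist _ _) _.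
    by rewrite opprB addrA subrK.
Qed.

Let CO : R := ((LA * M + `|A 0|) + (LA * M + `|A 0|)) * \int[mu]_z (@far_kernel R d lambda r) z.

Let near_level k delta (p : XT d) : R := (`|u p - k| <= delta)%R%:R.

Let mnear k delta : measurable_fun setT (near_level k delta).
Proof.
apply: measurable_boolR; apply: measurable_fun_ler => //.
by apply: measurableT_comp => //; exact: measurable_funB.
Qed.

Let inear k delta : nu.-integrable setT (EFin \o (fun p => \1_D p * near_level k delta p)).
Proof.
apply: (intg_indicM measurable_support_box support_box_finite (C := 1)) => // p.
by rewrite /near_level; case: (`|u p - k| <= delta); rewrite ?normr1 ?normr0.
Qed.

Definition limit_integrand k (p : XT d) : R :=
  `|u p - k| * partial_t phi p
  + \sum_(l < d) qflux f k (u p) l * partial_x l phi p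
  + c * (`|A (u p) - A k| * inner_limit lambda r phi p)
  + c * (phi p * Num.sg (u p - k) * outer_limit lambda r A u p).

Let outer_ j := nonlocal (round (h j)) (outer_weight lambda (h j) r) (A \o v j : XT d -> R).

Let intg_sg_outer (w : XT d -> R) (o : XT d -> R) k : measurable_fun setT w ->
  measurable_fun setT o -> (forall p, `|o p| <= CO) ->
  nu.-integrable setT (EFin \o (fun p => phi p * Num.sg (w p - k) * o p)).
Proof.
move=> mw mo oC; apply: (intg_bounded_support (C := C * CO) measurable_support_box support_box_finite).
- apply: measurable_funM => //; apply: measurable_funM => //.
  by apply: measurableT_comp; [exact: measurable_sgr|exact: measurable_funB].
- move=> p; rewrite normrM ler_pM// normrM.
  rewrite -[leRHS]mulr1 ler_pM// normr_sg; by case: (_ != _).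
- by move=> p nDp; rewrite phiD// !mul0r.
Qed.

Let intg_outer_limit k : nu.-integrable setT (EFin \o (fun p : XT d =>
  phi p * Num.sg (u p - k) * outer_limit lambda r A u p)).
Proof.
apply: intg_sg_outer => //; first exact: (measurable_outer_limit hlambda r0 lipA).
move=> p; exact: (outer_limit_le hlambda r0 lipA).
Qed.

Lemma intg_limit_integrand k : nu.-integrable setT (EFin \o limit_integrand k).
Proof.
apply: intgD; last exact: intgZ (intg_outer_limit k).
apply: intgD; last by apply: intgZ; have [] := cvg_inner_term k.
apply: intgD; first by have [] := cvg_time_term k.
by apply: intg_sum => l; have [] := cvg_flux_term k l.
Qed.

(** The sign taken at time t + tau is compared with that of u - k by [dist_sgr] at fixed delta. As j
    grows, the part proportional to the L^1 distance over delta vanishes, and only the cost of the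
    window |u - k| <= delta survives. *)
Lemma limit_inequality k delta : 0 < delta ->
  0 <= \int[nu]_p limit_integrand k p
    + c * (C * CO * (2 * \int[nu]_p (\1_D p * near_level k delta p))).
Proof.
move=> delta0; have mD := measurable_support_box; have nuD := support_box_finite.
have C0 : 0 <= C by exact: le_trans (phiC point).
have [iO cO] := cvgL1_outer hlambda r0 lipA h0 hcvg mv mu_ vM uM vlc ivu vu mD nuD.
have h2 : forall i, (fun=> (0 : 'rV[R]_d)) j ord0 i @[j --> \oo] --> (0 : 'rV[R]_d) ord0 i.
  by move=> i; exact: cvg_cst.
have [iS cS] := cvgL1_shift mv vM vlc ivu vu mD nuD h2 taucvg.
pose eO j := \int[nu]_p (\1_D p * `|outer_ j p - outer_limit lambda r A u p|).
pose vt j (p : XT d) := v j (xt_shift (0, tau j) p).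
have mvt j : measurable_fun setT (vt j).
  by apply: measurableT_comp (mv j) _; exact: measurable_xt_shift.
have Esh : xt_shift (0, 0) = @id (XT d).
  by apply/funext => -[x t]; rewrite /xt_shift/= !addr0.
rewrite Esh in iS cS.
pose eS j := \int[nu]_p (\1_D p * `|vt j p - u p|).
have CO0 : 0 <= CO := le_trans (normr_ge0 _) (outer_limit_le hlambda r0 lipA mu_ uM point).
have oC j p : `|outer_ j p| <= CO by exact: (nonlocal_outer_le hlambda r0 lipA h0 mv vM).
have mo j : measurable_fun setT (outer_ j) by exact: measurable_nonlocal_outer.
have T4 j : \int[nu]_p (phi p * Num.sg (vt j p - k) * outer_ j p) <=
    \int[nu]_p (phi p * Num.sg (u p - k) * outer_limit lambda r A u p) + C * eO j
    + C * CO * (2 * \int[nu]_p (\1_D p * near_level k delta p) + 2 / delta * eS j).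
  have iOj := intg_indic_norm (iO j); have iSj := intg_indic_norm (iS j).
  have iin := inear k delta; have iou := intg_outer_limit k.
  pose near_ p := \1_D p * near_level k delta p.
  pose do_ p := \1_D p * `|outer_ j p - outer_limit lambda r A u p|.
  pose dv_ p := \1_D p * `|vt j p - u p|.
  pose lo p := phi p * Num.sg (u p - k) * outer_limit lambda r A u p.
  have -> : \int[nu]_p lo p + C * eO j
     + C * CO * (2 * \int[nu]_p near_ p + 2 / delta * eS j) =
     \int[nu]_p (lo p + C * do_ p + C * CO * (2 * near_ p + 2 / delta * dv_ p)).
    rewrite RintD; [|by apply: intgD => //; exact: intgZ|
      by apply: intgZ; apply: intgD; exact: intgZ].
    rewrite RintD//; last exact: intgZ.
    rewrite (RintZ (C * CO)); last by apply: intgD; exact: intgZ.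
    by rewrite RintD ?(RintZ C) ?(RintZ 2) ?(RintZ (2 / delta))//; exact: intgZ.
  apply: le_Rint.
  - exact: intg_sg_outer.
  - apply: intgD; first by apply: intgD => //; exact: intgZ.
    by apply: intgZ; apply: intgD; exact: intgZ.
  move=> p; have [Dp|nDp] := pselect (D p); last first.
    rewrite /lo /near_ /do_ /dv_ phiD// indicE memNset//.
    by rewrite !mul0r !mulr0 !addr0 !mulr0.
  rewrite /lo /near_ /do_ /dv_ indicE mem_set// !mul1r.
  have := dist_sgr (vt j p) (u p) k delta0; rewrite -/(near_level k delta p).
  set X := 2 * near_level _ _ _ + _; set s1 := Num.sg _; set s2 := Num.sg _ => sX.
  set o1 := outer_ j p; set o2 := outer_limit _ _ _ _ _.
  (* The change of operator is multiplied by a bounded factor and is small in L^1; the change of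
     sign is multiplied by [phi] and by the limit operator, bounded by [C] and [CO], and is
     estimated by [sX]. *)
  have -> : phi p * s1 * o1 = phi p * s2 * o2 + (phi p * s1) * (o1 - o2) + phi p * o2 * (s1 - s2).
    by ring.
  apply: lerD; first rewrite lerD2l.
  - rewrite (le_trans (ler_norm _))// normrM ler_wpM2r// normrM.
    rewrite -[leRHS]mulr1 ler_pM// /s1 normr_sg; by case: (_ != _).
  - rewrite (le_trans (ler_norm _))// normrM ler_pM// normrM ler_pM//.
    exact: (outer_limit_le hlambda r0 lipA).
pose g j := \int[nu]_p (`|v j p - k| * ((phi p - phi (xt_shift (0, - tau j) p)) / tau j))
   + \sum_(l < d) \int[nu]_p (num_entropy_flux F k l (v j p) (v j (xt_shift (h j *: 'e_l, 0) p))
        * ((phi (xt_shift (h j *: 'e_l, 0) p) - phi p) / h j))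
   + c * \int[nu]_p (`|A (v j p) - A k|
        * nonlocal (fun z => - round (h j) z) (inner_weight lambda (h j) r) (phi : XT d -> R) p)
   + c * (\int[nu]_p (phi p * Num.sg (u p - k) * outer_limit lambda r A u p) + C * eO j
    + C * CO * (2 * \int[nu]_p (\1_D p * near_level k delta p) + 2 / delta * eS j)).
have ineq j : 0 <= g j.
  have phit p : phi p != 0 -> 0 < p.2 < T - tau j.
    move=> /phi_supp[_ /andP[e1 e2]]; apply/andP; split; first exact: lt_le_trans e1.
    by apply: le_lt_trans e2 _; rewrite ltrD2l ltrN2.
  have W := weak_discrete_entropy k r (h0 j) (tau0 j) hlambda lipA hF (mv j) (vM j)
    (@dv j) iphi phiC phi0 phit.
  apply: (le_trans W).
  by rewrite lerD2l ler_wpM2l ?(ltW c0)//; exact: T4.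
have lim0 : \int[nu]_p limit_integrand k p
    + c * (C * CO * (2 * \int[nu]_p (\1_D p * near_level k delta p))) =
  \int[nu]_p (`|u p - k| * partial_t phi p)
   + \sum_(l < d) \int[nu]_p (qflux f k (u p) l * partial_x l phi p)
   + c * \int[nu]_p (`|A (u p) - A k| * inner_limit lambda r phi p)
   + c * (\int[nu]_p (phi p * Num.sg (u p - k) * outer_limit lambda r A u p) + C * 0
    + C * CO * (2 * \int[nu]_p (\1_D p * near_level k delta p) + 2 / delta * 0)).
  have [it _] := cvg_time_term k; have [ii _] := cvg_inner_term k.
  have ifl l : nu.-integrable setT (EFin \o (fun p => qflux f k (u p) l * partial_x l phi p)).
    by have [] := cvg_flux_term k l.
  have io := intg_outer_limit k; have ifs := intg_sum ifl.
  have i12 := intgD it ifs; have i123 := intgD i12 (intgZ c ii).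
  have E := RintD i123 (intgZ c io).
  rewrite (RintD i12 (intgZ c ii)) (RintD it ifs) (Rint_sum ifl) (RintZ c ii) (RintZ c io) in E.
  by rewrite [X in X + _]E; ring.
rewrite lim0; set L := (X in 0 <= X).
suff gL : g j @[j --> \oo] --> L.
  by rewrite -(cvg_lim _ gL)//; apply: limr_ge; [apply/cvg_ex; exists L|exact: nearW].
apply: cvgD.
  apply: cvgD; last by apply: cvgMr; have [] := cvg_inner_term k.
  apply: cvgD; first by have [] := cvg_time_term k.
  apply: cvg_big => [|l _]; first exact: add_continuous.
  by have [] := cvg_flux_term k l.
apply: cvgMr; apply: cvgD.
  by apply: cvgD; [exact: cvg_cst|exact: cvgMr].
apply: cvgMr; apply: cvgD; first exact: cvg_cst.
exact: cvgMr.
Qed.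

Lemma limit_entropy_inequality k : (0 <= \int[nu]_p (limit_integrand k p)%:E)%E.
Proof.
have fin := integrable_fin_num measurableT (intg_limit_integrand k).
rewrite -[X in (_ <= X)%E](fineK fin) lee_fin -[leRHS]/(\int[nu]_p limit_integrand k p).
have mD := measurable_support_box; have nuD := support_box_finite.
have C0 : 0 <= C by exact: le_trans (phiC point).
have CO0 : 0 <= CO := le_trans (normr_ge0 _) (outer_limit_le hlambda r0 lipA mu_ uM point).
pose IL := 4 * B * (1 + r ^+ 2) * \int[mu]_z (@levy R d lambda) z.
have IL0 : 0 <= IL := le_trans (normr_ge0 _) (inner_limit_le (0, 0)).
(* One constant for all the weights of [level_integrand]: the derivatives of [phi], the inner
   operator and the outer one. *)
pose C' := C + c * IL + c * (C * CO).
have cIL : 0 <= c * IL by rewrite mulr_ge0// ltW.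
have cCO : 0 <= c * (C * CO) := mulr_ge0 (ltW c0) (mulr_ge0 C0 CO0).
have bound (x : XT d -> R) (N : R) : (forall p, ~ D p -> x p = 0) ->
    (forall p, `|x p| <= N) -> N <= C' -> forall p, `|x p| <= C' * \1_D p.
  move=> xD xN NC p; rewrite indicE; have [Dp|nDp] := pselect (D p).
    by rewrite mem_set// mulr1 (le_trans (xN p)).
  by rewrite xD// normr0 memNset// mulr0.
pose g (p : XT d) := c * inner_limit lambda r phi p.
pose o (p : XT d) := c * (phi p * outer_limit lambda r A u p).
have E k' : limit_integrand k' =
    level_integrand A f u (partial_t phi) g o (fun l => partial_x l phi) k'.
  apply/funext => p.
  by rewrite /limit_integrand /level_integrand /level_regular /g /o; ring.
rewrite E; apply: (@average_levels _ _ LA LF M (c * (C * CO * 2)) A f F u D d0 lipA hF mu_ uM mD nuD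
  _ _ _ _ C') => //.
- by apply: measurable_funM => //; exact: measurable_inner_limit.
- apply: measurable_funM => //; apply: measurable_funM => //.
  exact: (measurable_outer_limit hlambda r0 lipA).
- apply: (bound _ C _ (@dtC)); first exact: partial_t_off.
  by rewrite /C' -addrA lerDl addr_ge0.
- apply: (bound g (c * IL)); last by rewrite /C' -addrA addrCA lerDl addr_ge0.
    by move=> p nDp; rewrite /g inner_limit_off// mulr0.
  by move=> p; rewrite normrM (gtr0_norm c0) ler_wpM2l ?(ltW c0)//; exact: inner_limit_le.
- apply: (bound o (c * (C * CO))); last by rewrite /C' lerDr addr_ge0.
    by move=> p nDp; rewrite /o phiD// mul0r mulr0.
  move=> p; rewrite normrM (gtr0_norm c0) ler_wpM2l ?(ltW c0)// normrM ler_pM//.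
  exact: (outer_limit_le hlambda r0 lipA).
- move=> l; apply: (bound _ C _ (@dxC l)); first exact: partial_x_off.
  by rewrite /C' -addrA lerDl addr_ge0.
- exact: (mulr_ge0 (ltW c0) (mulr_ge0 (mulr_ge0 C0 CO0) _)).
- move=> k' delta delta0; rewrite -E.
  have := limit_inequality k' delta0.
  by rewrite !mulrA.
Qed.

End limit_inequality.

(** * The initial datum *)

Section box_integrals.
Context {R : realType} {d : nat}.
Local Notation mu := (@lebesgue_rV R d).

Definition box (A : 'I_d -> set R) : set 'rV[R]_d := [set x | forall i, A i (x ord0 i)].

(** Half-open boxes generate the Borel sets and are stable under intersection. Unlike general
    measurable boxes they have their boundary in finitely many coordinate hyperplanes, so that cell
    averages of their indicators converge almost everywhere. *)
Definition ocboxes : set (set 'rV[R]_d) := [set box A | A in [set A | forall i, ocitv (A i)]].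

Lemma measurable_ocitv (A : set R) : ocitv A -> measurable A.
Proof. by move=> /ocitvP[->//|[[a b] _ ->]]; exact: measurable_itv. Qed.

Lemma measurable_ocbox (B : set 'rV[R]_d) : ocboxes B -> measurable B.
Proof. by move=> [A oA <-]; apply: measurable_box => i; exact: measurable_ocitv. Qed.

Let cube (n : nat) : set R := `]- n.+1%:R, n.+1%:R]%classic.

Let ocitv_cube n : ocitv (cube n).
Proof. exact: is_ocitv. Qed.

Let cube_cover (x : 'rV[R]_d) : exists n, forall i, cube n (x ord0 i).
Proof.
exists (Num.truncn (\sum_i `|x ord0 i|)) => i; rewrite /cube/= in_itv/=.
have h : `|x ord0 i| < (Num.truncn (\sum_i `|x ord0 i|)).+1%:R.
  apply: le_lt_trans (truncnS_gt _).
  by rewrite (bigD1 i)//= lerDl sumr_ge0.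
by move: h; rewrite ltr_norml => /andP[-> /ltW].
Qed.

Lemma ocboxes_generate : measurable `<=` <<s ocboxes >>.
Proof.
apply: smallest_sub; first exact: smallest_sigma_algebra.
rewrite -bigcup_seq/= => _ [i _ [B mB <-]]; rewrite setTI.
pose P := [set Y : set R | <<s ocboxes >> (rV_coord i @^-1` Y)].
suff mP : measurable `<=` P by exact: (mP B mB).
have [S0 SD SU] := @smallest_sigma_algebra _ [set: 'rV[R]_d] ocboxes.
apply: smallest_sub.
  split.
  - by rewrite /P/= preimage_set0.
  - by move=> Y PY; exact: (SD _ PY).
  - by move=> Y PY; rewrite /P/= preimage_bigcup; exact: SU.
move=> Y oY; rewrite /P/=.
(* A constraint on one coordinate is a countable union of half-open boxes, the other sides being
   growing intervals. *)
rewrite (_ : _ @^-1` _ = \bigcup_n box (fun j => if j == i then Y else cube n)).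
  apply: SU => n; apply: sub_sigma_algebra.
  by exists (fun j => if j == i then Y else cube n) => // j; case: ifP.
apply/seteqP; split=> x /=.
  move=> Yx; have [n hn] := cube_cover x; exists n => // j /=.
  by case: eqP => [->|_].
by move=> [n _ /(_ i)] /=; rewrite eqxx.
Qed.

(** The sets on which the two integrals agree form a lambda-system, by dominated convergence for
    increasing unions and linearity for differences. It contains a generating class stable under
    intersection, hence all Borel sets. *)
Lemma ae_eq_ocboxes (w g : 'rV[R]_d -> R) : mu.-integrable setT (EFin \o w) ->
  mu.-integrable setT (EFin \o g) ->
  (forall B, ocboxes B -> \int[mu]_x (\1_B x * w x) = \int[mu]_x (\1_B x * g x)) ->
  {ae mu, forall x, w x = g x}.
Proof.
move=> iw ig wg.
pose H := [set S : set 'rV[R]_d | measurable S /\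
  \int[mu]_x (\1_S x * w x) = \int[mu]_x (\1_S x * g x)].
have iS (f : 'rV[R]_d -> R) S : measurable S -> mu.-integrable setT (EFin \o f) ->
    mu.-integrable setT (EFin \o (fun x => \1_S x * f x)).
  move=> mS fi; apply: (intg_bddMl (C := 1) _ _ fi); first exact: measurable_indic.
  by move=> x; rewrite indicE; case: (_ \in _); rewrite ?normr1 ?normr0.
have ndH : ndseq_closed H.
  move=> S ndS HS; split; first by apply: bigcup_measurable => k _; have [] := HS k.
  have cv (f : 'rV[R]_d -> R) : mu.-integrable setT (EFin \o f) ->
      \int[mu]_x (\1_(S n) x * f x) @[n --> \oo] --> \int[mu]_x (\1_(\bigcup_n S n) x * f x).
    move=> fi; apply: (cvg_Rint (g := fun x => `|f x|)).
    - by move=> n; apply: intg_measurable; apply: iS => //; have [] := HS n.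
    - apply: intg_measurable; apply: iS => //.
      by apply: bigcup_measurable => k _; have [] := HS k.
    - apply: aeW => x; apply: cvgMl.
      have [[N _ SN]|nS] := pselect ((\bigcup_n S n) x).
        apply: (@cvg_near_cst _ _ _ _ \oo); exists N => // n /= Nn.
        have Snx : S n x by move/subsetPset : (ndS _ _ Nn); exact.
        have Ux : (\bigcup_n S n) x by exists N.
        by rewrite !indicE (mem_set Snx) (mem_set Ux).
      rewrite indicE memNset//; under eq_fun => n.
        rewrite indicE memNset; last by move=> Sn; apply: nS; exists n.
        over.
      exact: cvg_cst.
    - exact: intg_norm.
    - move=> n x; rewrite normrM indicE; case: (_ \in _); rewrite ?normr1 ?mul1r//.
      by rewrite normr0 mul0r.
  have HS2 n : \int[mu]_x (\1_(S n) x * w x) = \int[mu]_x (\1_(S n) x * g x).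
    by have [] := HS n.
  have := cv _ iw; under eq_fun do rewrite HS2.
  by move=> /(cvg_unique _ (cv _ ig)) ->.
have GH : ocboxes `<=` H.
  by move=> B oB; split; [exact: measurable_ocbox|exact: wg].
have HT : H setT.
  rewrite (_ : setT = \bigcup_n box (fun=> cube n)).
    apply: ndH; last by move=> n; apply: GH; exists (fun=> cube n).
    move=> n k nk; apply/subsetPset => x h i; have := h i; rewrite /cube/= !in_itv/=.
    move=> /andP[h1 h2]; have nk' : n.+1%:R <= k.+1%:R :> R by rewrite ler_nat.
    by rewrite (le_trans h2)// andbT (le_lt_trans _ h1)// lerN2.
  apply/seteqP; split=> // x _.
  by have [n hn] := cube_cover x; exists n.
have lH : lambda_system setT H.
  split => //.
  move=> S S' sub [mS ES] [mS' ES']; split; first exact: measurableD.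
  have cv (f : 'rV[R]_d -> R) : mu.-integrable setT (EFin \o f) ->
      \int[mu]_x (\1_(S `\` S') x * f x) =
      \int[mu]_x (\1_S x * f x) - \int[mu]_x (\1_S' x * f x).
    move=> fi; rewrite -(RintB (iS _ _ mS fi) (iS _ _ mS' fi)).
    apply: eq_Rintegral => x _; rewrite -mulrBl; congr (_ * _).
    rewrite !indicE; have [S'x|nS'x] := pselect (S' x).
      have nSD : ~ (S `\` S') x by move=> -[].
      by rewrite (mem_set S'x) (mem_set (sub _ S'x)) (memNset nSD) subrr.
    rewrite (memNset nS'x) subr0; have [Sx|nSx] := pselect (S x).
      have SD : (S `\` S') x by [].
      by rewrite (mem_set Sx) (mem_set SD).
    have nSD : ~ (S `\` S') x by move=> -[].
    by rewrite (memNset nSx) (memNset nSD).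
  by rewrite (cv _ iw) (cv _ ig) ES ES'.
have IG : setI_closed ocboxes.
  move=> _ _ [A oA <-] [A' oA' <-]; exists (fun i => A i `&` A' i).
    by move=> i; exact: ocitvI.
  by apply/seteqP; split=> x /= => [h|[h h'] i]; [split=> i; case: (h i)|split].
have mH : measurable `<=` H.
  move=> S mS; apply: (lambda_system_subset IG lH GH) => //.
  exact: ocboxes_generate.
have : ae_eq mu setT (EFin \o w) (EFin \o g).
  apply: integral_ae_eq => //; first exact: measurable_int ig.
  move=> S _ mS.
  have E (f : 'rV[R]_d -> R) : mu.-integrable setT (EFin \o f) ->
      (\int[mu]_(x in S) (EFin \o f) x = (\int[mu]_x (\1_S x * f x))%:E)%E.
    move=> fi; rewrite integral_mkcond /Rintegral fineK; last first.
      exact: integrable_fin_num (iS _ _ mS fi).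
    apply: eq_integral => x _; rewrite patchE indicE.
    by case: (_ \in _); rewrite ?mul1r ?mul0r.
  by have [_ ES] := mH _ mS; rewrite !E// ES.
by apply: filterS => x /(_ I) [].
Qed.

End box_integrals.

Section cell_averages.
Context {R : realType} {d : nat}.
Local Notation mu := (@lebesgue_rV R d).

Lemma cellE (h : R) (a : 'rV[int]_d) (x : 'rV[R]_d) : 0 < h ->
  cell h a x <-> cell_index h x = a.
Proof.
move=> h0; split=> [xa|<- i].
  apply/rowP => i; rewrite mxE; apply: floor_def.
  have := xa i; rewrite !mxE subr_ge0 ltrBlDr => /andP[h1 h2].
  rewrite ler_pdivlMr// ltr_pdivrMr// mulrC h1/= intrD mulrDl mul1r mulrC addrC.
  by rewrite mulrC [X in _ + X]mulrC.
have /andP[h1 h2] := floor_itv (x ord0 i / h).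
move: h1 h2; rewrite ler_pdivlMr// ltr_pdivrMr// => h1 h2.
rewrite !mxE subr_ge0 mulrC h1/= ltrBlDr (lt_le_trans h2)//.
by rewrite intrD mulrDl mul1r addrC.
Qed.

Lemma dist_cell (h : R) (x y : 'rV[R]_d) i : 0 < h ->
  cell_index h x = cell_index h y -> `|x ord0 i - y ord0 i| < h.
Proof.
move=> h0 /(congr1 (fun a : 'rV[int]_d => a ord0 i)); rewrite !mxE => E.
have /andP[x1 x2] := floor_itv (x ord0 i / h).
have /andP[y1 y2] := floor_itv (y ord0 i / h).
move: x1 x2 y1 y2; rewrite E intrD !ler_pdivlMr// !ltr_pdivrMr// mulrDl mul1r.
by move=> *; rewrite ltr_norml; apply/andP; split; lra.
Qed.

(** The kernel of the cell averaging operator. It is symmetric with unit mass, so that averaging can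
    be moved from [u0] to the indicator of a box. *)
Definition cell_kernel (h : R) (x y : 'rV[R]_d) : R :=
  (h ^+ d)^-1 * (cell_index h x == cell_index h y)%:R.

Lemma measurable_cell_kernel (h : R) : 0 < h ->
  measurable_fun setT (fun xy : 'rV[R]_d * 'rV[R]_d => cell_kernel h xy.1 xy.2).
Proof.
move=> h0; apply: measurable_funM => //.
pose q (xy : 'rV[R]_d * 'rV[R]_d) : 'rV[int]_d * 'rV[int]_d :=
  (cell_index h xy.1, cell_index h xy.2).
pose G (ab : 'rV[int]_d * 'rV[int]_d) : R := (ab.1 == ab.2)%:R.
apply: (@measurable_countable_fibers _ _ _ q _ _ G) => -[a b].
rewrite (_ : _ @^-1` _ = (cell_index h @^-1` [set a]) `*` (cell_index h @^-1` [set b])).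
  by apply: measurableX; exact: measurable_cell_index.
by apply/seteqP; split=> -[x y] /= => [[<- <-]|[<- <-]].
Qed.

Lemma Rint_cell_kernel (h : R) (y : 'rV[R]_d) : 0 < h ->
  mu.-integrable setT (EFin \o (fun x => cell_kernel h x y)) /\
  \int[mu]_x cell_kernel h x y = 1.
Proof.
move=> h0; pose S := cell_index h @^-1` [set cell_index h y] : set 'rV[R]_d.
have mS : measurable S by exact: measurable_cell_index.
have SE : mu S = (h ^+ d)%:E by exact: lebesgue_cell.
have iS : mu.-integrable setT (EFin \o (\1_S : 'rV[R]_d -> R)).
  by apply: intg_indic => //; have := ltry (h ^+ d); rewrite -SE.
have E : (fun x => cell_kernel h x y) = fun x => (h ^+ d)^-1 * \1_S x.
  apply/funext => x; rewrite /cell_kernel indicE; congr (_ * (nat_of_bool _)%:R).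
  by apply/idP/idP => [/eqP xy|]; [rewrite inE|rewrite inE => /eqP].
have hd : h ^+ d != 0 by rewrite expf_neq0// gt_eqF.
rewrite E; split; first exact: intgZ.
rewrite RintZ// /Rintegral (eq_integral (fun x => (\1_S x)%:E))//.
rewrite integral_indic// setIT -[_ * _]/((h ^+ d)^-1 * fine (mu S)).
by rewrite [X in fine X]SE/= mulVf.
Qed.

Variables (u0 w : 'rV[R]_d -> R) (h : nat -> R).
Hypotheses (iu0 : mu.-integrable setT (EFin \o u0)) (iw : mu.-integrable setT (EFin \o w)).
Hypotheses (h0 : forall j, 0 < h j) (hcvg : h j @[j --> \oo] --> 0).

Definition cell_average j (x : 'rV[R]_d) : R :=
  (h j ^+ d)^-1 * \int[mu]_(y in cell (h j) (cell_index (h j) x)) u0 y.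

Hypothesis avg_cvg :
  (\int[mu]_x `|cell_average j x - w x|%:E)%E @[j --> \oo] --> 0%E.

Let k0 j x y : 0 <= cell_kernel (h j) x y.
Proof. by rewrite mulr_ge0// invr_ge0 exprn_ge0// ltW. Qed.

Let f j (xy : 'rV[R]_d * 'rV[R]_d) : R := u0 xy.2 * cell_kernel (h j) xy.1 xy.2.

Let mf j : measurable_fun setT (f j).
Proof.
apply: measurable_funM; last exact: measurable_cell_kernel.
exact: (measurableT_comp (intg_measurable iu0) (@measurable_snd _ _ _ _)).
Qed.

Let if_ j : (mu \x mu)%E.-integrable setT (EFin \o f j).
Proof.
have [ik Ek] := (fun y => (Rint_cell_kernel y (h0 j)).1, fun y => (Rint_cell_kernel y (h0 j)).2).
apply: (intg_prod_dom (mf j) (g := fun y => `|u0 y|)).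
- by move=> y; exact: (intgZ (u0 y) (ik y)).
- exact: intg_norm.
- move=> y; rewrite le_eqVlt; apply/orP; left; apply/eqP.
  transitivity (\int[mu]_x (`|u0 y| * cell_kernel (h j) x y)).
    by apply: eq_Rintegral => x _; rewrite /f/= normrM (ger0_norm (k0 _ _ _)).
  by rewrite RintZ// Ek mulr1.
Qed.

Let averageE j x : cell_average j x = \int[mu]_y f j (x, y).
Proof.
rewrite /cell_average Rintegral_mkcond.
set g := patch _ _ _.
have gE y : f j (x, y) = (h j ^+ d)^-1 * g y.
  rewrite /f /g /cell_kernel/= patchE; case: ifPn.
    by rewrite inE => /(cellE _ _ (h0 j)) ->; rewrite eqxx mulr1 mulrC.
  rewrite notin_setE => nxy; case: eqP => [xy|_]; last by rewrite !mulr0.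
  by case: nxy; apply/(cellE _ _ (h0 j)).
transitivity (\int[mu]_y ((h j ^+ d)^-1 * g y)); last by apply: eq_Rintegral => y _; rewrite gE.
rewrite RintZ//; rewrite /g.
have mc : measurable (cell (h j) (cell_index (h j) x)).
  rewrite (_ : cell _ _ = cell_index (h j) @^-1` [set cell_index (h j) x]).
    exact: measurable_cell_index.
  by apply/seteqP; split=> y /(cellE _ _ (h0 j)).
have := integrableS measurableT mc (@subsetT _ _) iu0.
by rewrite integrable_mkcond// restrict_EFin.
Qed.

Let iavg j : mu.-integrable setT (EFin \o cell_average j).
Proof.
rewrite (_ : cell_average j = fun x => \int[mu]_y f j (x, y)); last exact/funext/averageE.
exact: intg_prod1.
Qed.

Lemma ocitv_locally_constant (A : set R) : ocitv A -> exists C : set R, countable C /\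
  forall a, ~ C a -> exists e : R, 0 < e /\ forall b, `|b - a| < e -> A b <-> A a.
Proof.
move=> /ocitvP[->|[[a b] /= ab ->]].
  exists set0; split; first exact: countable0.
  by move=> a _; exists 1; split.
exists [set a; b]; split; first exact/finite_set_countable/finite_set2.
move=> x nx; have xa : x != a by apply/eqP => xa; apply: nx; left.
have xb : x != b by apply/eqP => xb; apply: nx; right.
exists (Num.min `|x - a| `|x - b|); split.
  by rewrite lt_min !normr_gt0 !subr_eq0 xa xb.
move=> y; rewrite lt_min => /andP[ya yb] /=; rewrite !in_itv/=.
case: (ltgtP x a) xa => // xa _.
  move: ya; rewrite [X in _ < X]ltr0_norm ?subr_lt0// opprB => /(le_lt_trans (ler_norm _)) ya.
  by split=> /andP[h1 _]; exfalso; lra.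
case: (ltgtP x b) xb => // xb _.
  move: ya; rewrite [X in _ < X]gtr0_norm ?subr_gt0// distrC => /(le_lt_trans (ler_norm _)) ya.
  move: yb; rewrite [X in _ < X]ltr0_norm ?subr_lt0// opprB => /(le_lt_trans (ler_norm _)) yb.
  by split=> // _; apply/andP; split; lra.
move: yb; rewrite [X in _ < X]gtr0_norm ?subr_gt0// distrC => /(le_lt_trans (ler_norm _)) yb.
by split=> /andP[_ h1]; exfalso; lra.
Qed.

(** Integrated over a box, the averaging falls on the indicator of the box. At a point off the
    boundary hyperplanes the averaged indicator is eventually exact, the whole cell then lying
    inside or outside the box. Hence [w] and [u0] have the same integrals over boxes. *)
Lemma ae_eq_cell_averages : {ae mu, forall x, w x = u0 x}.
Proof.
apply: ae_eq_ocboxes => // B oB; have mB := measurable_ocbox oB.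
have B1 x : `|\1_B x| <= 1 :> R by rewrite indicE; case: (_ \in _); rewrite ?normr1 ?normr0.
have m1 : measurable_fun setT (\1_B : 'rV[R]_d -> R) by exact: measurable_indic.
have iB (g : 'rV[R]_d -> R) : mu.-integrable setT (EFin \o g) ->
    mu.-integrable setT (EFin \o (fun x => \1_B x * g x)).
  by move=> ig; exact: (intg_bddMl m1 B1 ig).
have c1 : \int[mu]_x (\1_B x * cell_average j x) @[j --> \oo] --> \int[mu]_x (\1_B x * w x).
  apply/cvgrPdist_le => eps eps0.
  have ed j : mu.-integrable setT (EFin \o (fun x => cell_average j x - w x)) by exact: intgB.
  have ec : \int[mu]_x `|cell_average j x - w x| @[j --> \oo] --> 0.
    by apply: fine_cvg; exact: avg_cvg.
  have /cvgrPdist_le/(_ _ eps0) := ec; apply: filterS => j.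
  rewrite sub0r normrN ger0_norm; last exact: Rintegral_ge0.
  apply: le_trans; rewrite -(RintB (iB _ iw) (iB _ (iavg j))).
  apply: ler_norm_Rint.
  - by apply: intgB; exact: iB.
  - exact: intg_norm.
  - move=> x; rewrite -mulrBr normrM distrC -[leRHS]mul1r ler_wpM2r//.
pose beta j y := \int[mu]_x (\1_B x * cell_kernel (h j) x y).
have iBk j y : mu.-integrable setT (EFin \o (fun x => \1_B x * cell_kernel (h j) x y)).
  by apply: iB; have [] := Rint_cell_kernel y (h0 j).
have E j : \int[mu]_x (\1_B x * cell_average j x) = \int[mu]_y (beta j y * u0 y).
  pose G (xy : 'rV[R]_d * 'rV[R]_d) : R := \1_B xy.1 * f j xy.
  have mG : measurable_fun setT G.
    by apply: measurable_funM => //; exact: (measurableT_comp m1 (@measurable_fst _ _ _ _)).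
  have iG : (mu \x mu)%E.-integrable setT (EFin \o G).
    apply: (intg_bddMl (C := 1) _ _ (if_ j)) => //.
    exact: (measurableT_comp m1 (@measurable_fst _ _ _ _)).
  transitivity (\int[mu]_x \int[mu]_y G (x, y)).
    apply: eq_Rintegral => x _; have [Bx|nBx] := boolP (x \in B).
      by rewrite averageE indicE Bx mul1r; apply: eq_Rintegral => y _; rewrite /G/= indicE Bx mul1r.
    rewrite indicE (negbTE nBx) mul0r (@eq_Rintegral _ _ _ mu setT (fun=> 0)).
      by rewrite Rintegral_cst// mul0r.
    by move=> y _; rewrite /G/= indicE (negbTE nBx) mul0r.
  rewrite (Rint_fubini iG); apply: eq_Rintegral => y _.
  rewrite mulrC -RintZ//; apply: eq_Rintegral => x _; rewrite /G /f/=; ring.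
have c2 : \int[mu]_y (beta j y * u0 y) @[j --> \oo] --> \int[mu]_y (\1_B y * u0 y).
  apply: (cvg_Rint (g := fun y => `|u0 y|)).
  - move=> j; apply: measurable_funM; last exact: intg_measurable iu0.
    pose G (xy : 'rV[R]_d * 'rV[R]_d) : R := \1_B xy.1 * cell_kernel (h j) xy.1 xy.2.
    apply: (@measurable_Rint2 _ _ _ _ _ mu G); apply: measurable_funM.
      exact: (measurableT_comp m1 (@measurable_fst _ _ _ _)).
    exact: measurable_cell_kernel.
  - by apply: measurable_funM => //; exact: intg_measurable iu0.
  - have [A oA BE] := oB.
    have [Cs hCs] := choice (fun i => ocitv_locally_constant (oA i)).
    have : {ae mu, forall y : 'rV[R]_d, forall i, ~ Cs i (y ord0 i)}.
      apply: filter_forall => i.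
      by apply: filterS (ae_coord_notin d (hCs i).1) => y /(_ i).
    apply: filterS => y hy; apply: cvgMl.
    have [es hes] := choice (fun i => (hCs i).2 _ (hy i)).
    have hs : \forall j \near \oo, forall i, h j < es i.
      apply: (@filter_forall _ 'I_d (fun i => [set j | h j < es i]) \oo _) => i.
      have /cvgrPdist_lt/(_ _ (hes i).1) := hcvg; apply: filterS => j.
      by rewrite sub0r normrN gtr0_norm.
    apply: (@cvg_near_cst _ _ _ _ \oo); apply: filterS hs => j hj.
    have [ik Ek] := Rint_cell_kernel y (h0 j).
    rewrite /beta -[RHS]mulr1 -Ek -RintZ//; apply: eq_Rintegral => x _.
    rewrite /cell_kernel; case: eqP => [xy|_]; last by rewrite !mulr0.
    suff BB : B x <-> B y.
      by rewrite !indicE; congr ((nat_of_bool _)%:R * _); apply/idP/idP; rewrite !inE; tauto.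
    have xyA i : A i (x ord0 i) <-> A i (y ord0 i).
      apply: (hes i).2; exact: lt_trans (dist_cell _ (h0 j) xy) (hj i).
    by rewrite -BE; split=> Bx i; apply/xyA.
  - exact: intg_norm.
  - move=> j y; rewrite normrM -[leRHS]mul1r ler_wpM2r//.
    have [ik Ek] := Rint_cell_kernel y (h0 j).
    rewrite -Ek; apply: ler_norm_Rint => // x.
    rewrite normrM (ger0_norm (k0 _ _ _)) -[leRHS]mul1r ler_wpM2r//.
move: c1; under eq_fun do rewrite E.
by move=> c1; exact: (cvg_unique _ c1 c2).
Qed.

End cell_averages.

(** * Convergence of the scheme *)

Section time_step.
Context {R : realType} {d : nat}.
Local Notation mu := (@lebesgue_rV R d).
Variables (c lambda LF LA : R) (Dx Dt : nat -> R).
Hypotheses (d0 : (0 < d)%N) (hlambda : 0 < lambda < 2) (c0 : 0 < c).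
Hypotheses (Dx0 : forall j, 0 < Dx j) (Dt0 : forall j, 0 < Dt j).
Hypotheses (LF0 : 0 <= LF) (LA0 : 0 <= LA).
Hypothesis Dx_cvg : Dx j @[j --> \oo] --> 0.
Hypothesis cfl : forall j, CFL d (Dx j) c lambda LF LA (Dt j).

(** Positivity makes the nonlocal half of the CFL condition a bound on the time step. The cube
    [2, 3]^d has measure 1 and lies in |z| > 1, and |z| <= 3 d on it. *)
Lemma kernel_mass_gt0 : 0 < @kernel_mass R d lambda.
Proof.
pose I : set R := `[2, 3]%classic.
pose S : set 'rV[R]_d := [set x | forall i, I (x ord0 i)].
have mS : measurable S by apply: (@measurable_box _ _ (fun=> I)) => i; exact: measurable_itv.
have SE : mu S = 1%E.
  rewrite (@lebesgue_rV_box _ _ (fun=> I)); last by move=> i; exact: measurable_itv.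
  rewrite big1// => i _; rewrite /I lebesgue_measure_itv/= lte_fin ifT ?ltr_nat//.
  by rewrite -EFinB; congr EFin; lra.
pose s : R := ((3 * d%:R) `^ (d%:R + lambda))^-1.
have s0 : 0 < s by rewrite invr_gt0 powR_gt0// mulr_gt0// ltr0n.
have iS : mu.-integrable setT (EFin \o (\1_S : 'rV[R]_d -> R)).
  by apply: intg_indic => //; have := ltry (1 : R); rewrite -SE.
have : \int[mu]_z (s * \1_S z) <= @kernel_mass R d lambda.
  rewrite kernel_massE; apply: le_Rint.
  - exact: intgZ.
  - apply: (intg_bool_kernel hlambda ltr01); first exact: measurable_fun_ltr_enorm.
    by move=> z; exact: ltW.
  - move=> z; rewrite indicE; have [Sz|nSz] := pselect (S z); last first.
      by rewrite memNset// mulr0 mulr_ge0// kernel_ge0.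
    rewrite mem_set// mulr1.
    have z1 : 1 < enorm z.
      apply: lt_le_trans (coord_le_enorm z (Ordinal d0)).
      have := Sz (Ordinal d0); rewrite /I/= in_itv/= => /andP[z2 _].
      by rewrite (lt_le_trans _ (ler_norm _))// (lt_le_trans _ z2)// ltr1n.
    rewrite z1 mul1r /s /Defs.kernel lef_pV2 ?posrE ?powR_gt0//.
    + apply: ge0_ler_powR; rewrite ?nnegrE ?enorm_ge0 ?mulr_ge0//.
        by rewrite addr_ge0// ltW//; case/andP : hlambda.
      apply: le_trans (enorm_le_sum z) _.
      rewrite (le_trans (ler_sum _ (G := fun=> 3) _))//; last first.
        by rewrite sumr_const card_ord -[leLHS]mulr_natr.
      move=> i _; have := Sz i; rewrite /I/= in_itv/= => /andP[z2 z3].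
      by rewrite ger0_norm// (le_trans _ z2).
    + by rewrite mulr_gt0// ltr0n.
    + exact: lt_trans ltr01 z1.
apply: lt_le_trans; rewrite RintZ// mulr_gt0// /Rintegral.
rewrite (eq_integral (fun x => (\1_S x)%:E))// integral_indic// setIT.
by rewrite -[fine _]/(fine (mu S)) SE.
Qed.

Lemma cvg_powR0 : Dx j `^ lambda @[j --> \oo] --> 0.
Proof.
have l0 : 0 < lambda by case/andP : hlambda.
apply/cvgrPdist_le => e e0.
have e1 : 0 < e `^ lambda^-1 by rewrite powR_gt0.
have /cvgrPdist_lt/(_ _ e1) := Dx_cvg; apply: filterS => j.
rewrite !sub0r !normrN (gtr0_norm (Dx0 j)) ger0_norm ?powR_ge0// => xe.
rewrite -[leRHS]powRr1 ?(ltW e0)// -[X in _ <= _ `^ X](mulVf (lt0r_neq0 l0)) powRrM.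
by rewrite ge0_ler_powR ?nnegrE ?powR_ge0// ltW.
Qed.

(** Both summands of the CFL condition are nonnegative, so each is at most 1: a positive LF gives Dt
    = O(Dx), a positive LA gives Dt = O(Dx^lambda). *)
Lemma cvg_time_step : 0 < LF \/ 0 < LA -> Dt j @[j --> \oo] --> 0.
Proof.
have Km := kernel_mass_gt0; have l0 : 0 < lambda by case/andP : hlambda.
have t1 j : 0 <= 2 * d%:R * LF * (Dt j / Dx j).
  by rewrite !mulr_ge0// ?invr_ge0 ltW.
have t2 j : 0 <= c * 2 `^ lambda * LA * @kernel_mass R d lambda * (Dt j / Dx j `^ lambda).
  by rewrite !mulr_ge0// ?invr_ge0 ?powR_ge0// ltW.
have sq (a : R) (g : nat -> R) : 0 < a -> g j @[j --> \oo] --> 0 ->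
    (forall j, a * Dt j <= g j) -> Dt j @[j --> \oo] --> 0.
  move=> a0 gc h; apply: (@squeeze_cvgr _ _ _ _ (cst 0) (fun j => a^-1 * g j)).
  - by apply: nearW => j; rewrite /= (ltW (Dt0 j))/= ler_pdivlMl.
  - exact: cvg_cst.
  - by rewrite -(mulr0 a^-1); exact: cvgMr.
have cflj j := cfl j; rewrite /CFL -/(@kernel_mass R d lambda) in cflj.
case=> [LF1|LA1].
- apply: (sq (2 * d%:R * LF) _ _ Dx_cvg); first by rewrite !mulr_gt0// ltr0n.
  move=> j; rewrite -[leRHS]mul1r -ler_pdivrMr// -[leLHS]mulrA; have := t2 j; have := cflj j; lra.
- have a0 : 0 < c * 2 `^ lambda * LA * @kernel_mass R d lambda.
    by rewrite !mulr_gt0// powR_gt0.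
  apply: (sq _ _ a0 cvg_powR0) => j.
  rewrite -[leRHS]mul1r -ler_pdivrMr ?powR_gt0// -[leLHS]mulrA; have := t1 j; have := cflj j; lra.
Qed.

End time_step.

Section slices.
Context {R : realType} {d : nat}.
Local Notation XT d := ('rV[R]_d * measurableTypeR R)%type.
Local Notation nu := (lebesgue_xt d).
Local Notation mu := (@lebesgue_rV R d).

Lemma integral_slices_le (T : R) (w : XT d -> R) (S : \bar R) : 0 < T ->
  measurable_fun setT w -> (0 <= S)%E ->
  (forall x t, ~ (0 < (t : R) < T) -> w (x, t) = 0) ->
  (forall t, 0 < t < T -> (\int[mu]_x `|w (x, t)|%:E <= S)%E) ->
  (\int[nu]_p `|w p|%:E <= T%:E * S)%E.
Proof.
move=> T0 mw S0 wout wS.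
have mn : measurable_fun setT (fun p => `|w p|%:E).
  by apply/measurable_EFinP; exact: measurableT_comp.
rewrite (fubini_tonelli2 (fun p => `|w p|%:E) mn)//.
apply: (@le_trans _ _ (\int[lebesgue_measure]_(t in `]0%R, T[) S)%E).
  rewrite [leRHS]integral_mkcond; apply: ge0_le_integral => //.
  - by move=> t _; exact: integral_ge0.
  - exact: measurable_fun_fubini_tonelli_G.
  - apply/(measurable_restrictT _ _).1 => //; exact: measurable_cst.
  - move=> t _; rewrite patchE /fubini_G; case: ifPn.
      by rewrite inE/= in_itv/=; exact: wS.
    rewrite notin_setE/= in_itv/= => nt.
    by rewrite integral0_eq// => x _; rewrite wout ?normr0.
rewrite integral_cst//.
have TE : lebesgue_measure (`]0%R, T[%classic : set R) = T%:E.
  by rewrite lebesgue_measure_itv/= lte_fin T0 sube0.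
by rewrite [X in (_ * X <= _)%E]TE muleC.
Qed.

End slices.

Section test_function_bounds.
Context {R : realType} {d : nat}.
Local Notation XT d := ('rV[R]_d * measurableTypeR R)%type.
Local Notation E := ('rV[R]_d * R)%type.
Variables (T : R) (phi : E -> R).
Hypothesis tphi : test_fun T phi.

Lemma test_fun_derivable (w : E) p : derivable phi p w.
Proof. by have [/(_ 1%N)[_ /(_ w)[]]] := tphi. Qed.

Lemma test_fun_derivable2 (w1 w2 : E) p : derivable ('D_w1 phi) p w2.
Proof. by have [/(_ 2%N)[_ /(_ w1)[_ [_ /(_ w2)[]]]]] := tphi. Qed.

Lemma test_fun_continuous : continuous phi.
Proof. by have [/(_ 0%N)] := tphi. Qed.

Lemma test_fun_continuous_derive (w : E) : continuous ('D_w phi).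
Proof. by have [/(_ 1%N)[_ /(_ w)[]]] := tphi. Qed.

Lemma test_fun_continuous_derive2 (w1 w2 : E) : continuous ('D_w2 ('D_w1 phi)).
Proof. by have [/(_ 2%N)[_ /(_ w1)[_ [_ /(_ w2)[]]]]] := tphi. Qed.

Lemma test_fun_off (w : E) p : ~ QT T p -> phi p = 0 /\ 'D_w phi p = 0.
Proof.
have [_ [K [cK KQ K0]]] := tphi => nQ; have nK : ~ K p by move=> /KQ.
by split; [exact: K0|exact: (derive_off_support w cK K0)].
Qed.

Lemma test_fun_bounds : exists C B : R, [/\ 0 <= B, forall p, `|phi p| <= C,
  forall p, `|partial_t phi p| <= C, forall l p, `|partial_x l phi p| <= C &
  forall p y, `|second_difference phi p y| <= B * enorm y ^+ 2].
Proof.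
have [_ [K [cK KQ K0]]] := tphi.
have [C1 hC1] := continuous_support_bounded test_fun_continuous cK K0.
have [C2 hC2] := continuous_support_bounded
  (@test_fun_continuous_derive (0, 1)) cK (derive_off_support (0, 1) cK K0).
have [C3 hC3] := choice (fun l : 'I_d => continuous_support_bounded
  (@test_fun_continuous_derive ('e_l, 0)) cK (derive_off_support ('e_l, 0) cK K0)).
have [C4 hC4] := choice (fun lk : 'I_d * 'I_d => continuous_support_bounded
  (@test_fun_continuous_derive2 ('e_lk.1, 0) ('e_lk.2, 0)) cK
  (derive_off_support ('e_lk.2, 0) cK (derive_off_support ('e_lk.1, 0) cK K0))).
pose C := `|C1| + `|C2| + \sum_l `|C3 l|; pose B := \sum_lk `|C4 lk|.
have B0 : 0 <= B by apply: sumr_ge0.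
have S0 : 0 <= \sum_l `|C3 l| by apply: sumr_ge0.
have n1 := normr_ge0 C1; have n2 := normr_ge0 C2.
exists C, (2 * B * d%:R ^+ 2); split.
- by rewrite mulr_ge0 ?mulr_ge0// exprn_ge0.
- by move=> p; rewrite (le_trans (hC1 p))// (le_trans (ler_norm _))// /C; lra.
- by move=> p; rewrite (le_trans (hC2 p))// (le_trans (ler_norm _))// /C; lra.
- move=> l p; rewrite (le_trans (hC3 l p))// (le_trans (ler_norm _))//.
  rewrite /C (bigD1 l)//= addrCA lerDl addr_ge0// ?addr_ge0//.
  exact: sumr_ge0.
- move=> [x t] y; rewrite /second_difference/=; apply: second_difference_le => //.
  + by move=> l p; exact: test_fun_derivable.
  + by move=> l k p; exact: test_fun_derivable2.
  + move=> l k p; rewrite (le_trans (hC4 (l, k) p))// (le_trans (ler_norm _))//.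
    by rewrite /B (bigD1 (l, k))//= lerDl sumr_ge0.
Qed.

Lemma test_fun_support : exists m : nat, forall p, phi p != 0 ->
  (forall i, `|p.1 ord0 i| <= m.+1%:R) /\ m.+1%:R^-1 <= p.2 <= T - m.+1%:R^-1.
Proof.
have [_ [K [cK KQ K0]]] := tphi; have [m hm] := compact_subset_box cK KQ.
exists m => p /eqP p0; apply: hm; exact: contra_notP (K0 p) p0.
Qed.

(** The inner operator acts in space only, and at a time outside (0, T) [phi] vanishes on the whole
    slice. *)
Lemma inner_limit_off_QT (lambda r : R) p : ~ QT T p -> inner_limit lambda r phi p = 0.
Proof.
move=> nQ; have h y : phi (y, p.2) = 0.
  by have [] := @test_fun_off 0 (y, p.2) (fun Q => nQ (conj I Q.2)).
rewrite /inner_limit (@eq_Rintegral _ _ _ _ setT (fun=> 0)); last first.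
  move=> z _; rewrite /second_difference !h {1}(surjective_pairing p) h.
  by rewrite mulr0 subr0 addr0 mul0r.
by rewrite Rintegral_cst// mul0r mulr0.
Qed.

End test_function_bounds.

(** * From a bounded representative to the given limit *)

Section clamp.
Context {R : realType}.
Implicit Types (M x y : R).

Definition clamp M x : R := Num.max (- M) (Num.min M x).

Lemma clamp_le M x : 0 <= M -> `|clamp M x| <= M.
Proof.
move=> M0; rewrite ler_norml /clamp le_max lexx/= ge_max ge_min lexx andbT.
by rewrite (le_trans _ M0)// oppr_le0.
Qed.

Lemma clampE M x : `|x| <= M -> clamp M x = x.
Proof. by rewrite ler_norml /clamp => /andP[x1 x2]; rewrite (min_r x2) (max_r x1). Qed.

Lemma dist_clamp M x y : `|y| <= M -> `|y - clamp M x| <= `|y - x|.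
Proof.
rewrite ler_norml /clamp => /andP[y1 y2].
have h1 := ler_norm (y - x); have := ler_norm (x - y); rewrite distrC => h2.
rewrite ler_norml; case: (leP M x) => ?.
  by case: (leP (- M) M) => ?; apply/andP; split; lra.
by case: (leP (- M) x) => ?; apply/andP; split; lra.
Qed.

(** Truncation moves [x] by no more than its distance to any point of the interval. Taking a value
    of the scheme for [y] shows that truncation leaves the limit unchanged almost everywhere. *)
Lemma dist_clamp_id M x y : `|y| <= M -> `|clamp M x - x| <= `|y - x|.
Proof.
rewrite ler_norml /clamp => /andP[y1 y2].
have h1 := ler_norm (y - x); have := ler_norm (x - y); rewrite distrC => h2.
rewrite ler_norml; case: (leP M x) => ?.
  by case: (leP (- M) M) => ?; apply/andP; split; lra.
by case: (leP (- M) x) => ?; apply/andP; split; lra.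
Qed.

Lemma measurable_clamp M : measurable_fun setT (clamp M).
Proof. by apply: measurable_maxr => //; exact: measurable_minr. Qed.

End clamp.

Section convergence_of_scheme.
Context {R : realType} {d : nat}.
Local Notation XT d := ('rV[R]_d * measurableTypeR R)%type.
Local Notation E := ('rV[R]_d * R)%type.
Local Notation nu := (lebesgue_xt d).
Local Notation mu := (@lebesgue_rV R d).
Variables (T lambda c : R) (f : R -> 'rV[R]_d) (A : R -> R) (LA : R).
Variables (u0 : 'rV[R]_d -> R) (F : 'I_d -> R -> R -> R) (LF : R).
Variables (Dx Dt : nat -> R) (N : nat -> nat) (U : nat -> nat -> 'rV[int]_d -> R).
Variables (M : R) (u : E -> R).
Hypotheses (d0 : (0 < d)%N) (T0 : 0 < T) (hlambda : 0 < lambda < 2) (c0 : 0 < c).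
Hypothesis lipA : forall a b, `|A a - A b| <= LA * `|a - b|.
Hypothesis homoA : {homo A : a b / a <= b}.
Hypothesis iu0 : mu.-integrable setT (EFin \o u0).
Hypothesis hF : numerical_flux f LF F.
Hypotheses (hDx : forall j, 0 < Dx j) (hDt : forall j, 0 < Dt j).
Hypothesis hN : forall j, (N j)%:R * Dt j = T.
Hypothesis hDx0 : Dx j @[j --> \oo] --> 0.
Hypothesis hCFL : forall j, CFL d (Dx j) c lambda LF LA (Dt j).
Hypothesis hU : forall j, scheme_solution (Dx j) c lambda (Dt j) (N j) A F u0 (U j).
Hypothesis hM : forall j, {ae nu, forall p : XT d, QT T p ->
  `|interpolation (Dx j) (Dt j) (U j) p| <= M}.
Hypothesis mu_ : measurable_fun (QT T : set (XT d)) (u : XT d -> R).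
Hypothesis huC : CL1 T u.

Let S j : \bar R := ereal_sup [set (\int[mu]_x
  `|interpolation (Dx j) (Dt j) (U j) (x, t) - u (x, t)|%:E)%E | t in `[0, T]].

Hypothesis hconv : S j @[j --> \oo] --> 0%E.

Let v j := interp0 T (Dx j) (Dt j) (U j).

Let UM j n a : (n < N j)%N -> `|U j n a| <= M.
Proof. exact: (interpolation_bounded (hDx j) (hDt j) (hN j) (hM j)). Qed.

Let vM j p : `|v j p| <= `|M|.
Proof. exact: (interp0_le (Dx j) (hDt j) (hN j) (@UM j)). Qed.

Let mv j : measurable_fun setT (v j : XT d -> R).
Proof. exact: measurable_interp0. Qed.

(* u is only known on Q_T *)
Definition cut_time (p : E) : R := if (0 < p.2) && (p.2 < T) then u p else 0.

(** A representative of the limit that is measurable and bounded at every point, as the limit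
    inequality expects. *)
Definition truncation (p : E) : R := clamp `|M| (cut_time p).

Lemma measurable_cut_time : measurable_fun setT (cut_time : XT d -> R).
Proof.
have mQ : measurable (QT T : set (XT d)) by apply: measurableX => //; exact: measurable_itv.
have := (measurable_restrictT (u : XT d -> R) mQ).1 mu_.
congr measurable_fun; apply/funext => -[x t]; rewrite patchE /cut_time/=.
case: ifPn; first by rewrite inE /QT => -[_ /=]; rewrite in_itv/= => ->.
by rewrite notin_setE /QT => nQ; case: ifP => // tT; case: nQ; split=> //=.
Qed.

Lemma measurable_truncation : measurable_fun setT (truncation : XT d -> R).
Proof. exact: (measurableT_comp (measurable_clamp _) measurable_cut_time). Qed.

Lemma truncation_le p : `|truncation p| <= `|M|.
Proof. exact: clamp_le. Qed.

Let S0 j : (0 <= S j)%E.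
Proof.
apply: (@le_trans _ _ (\int[mu]_x
  `|interpolation (Dx j) (Dt j) (U j) (x, 0) - u (x, 0)|%:E)%E).
  exact: integral_ge0.
by apply: ereal_sup_ubound; exists 0 => //=; rewrite in_itv/= lexx ltW.
Qed.

Let slice (g : XT d -> R) t : measurable_fun setT g -> measurable_fun setT (fun x => g (x, t)).
Proof. by move=> mg; apply: (measurableT_comp mg); exact: pair2_measurable. Qed.

Let slice_le (g : XT d -> R) j t : measurable_fun setT g -> 0 < t < T ->
  (forall x, `|g (x, t)| <= `|v j (x, t) - cut_time (x, t)|) ->
  (\int[mu]_x `|g (x, t)|%:E <= S j)%E.
Proof.
move=> mg tT gv; have /andP[t0 t1] := tT.
apply: (@le_trans _ _ (\int[mu]_x
  `|interpolation (Dx j) (Dt j) (U j) (x, t) - u (x, t)|%:E)%E); last first.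
  by apply: ereal_sup_ubound; exists t => //=; rewrite in_itv/= !ltW.
rewrite [leRHS](eq_integral (fun x => `|v j (x, t) - cut_time (x, t)|%:E)); last first.
  by move=> x _; rewrite /v /interp0 /cut_time/= tT.
apply: ge0_le_integral => //.
- by apply/measurable_EFinP; apply: measurableT_comp => //; exact: (slice t mg).
- apply/measurable_EFinP; apply: measurableT_comp => //.
  by apply: measurable_funB; [exact: (slice t (mv j))|exact: (slice t measurable_cut_time)].
- by move=> x _; rewrite lee_fin.
Qed.

Let le_S0 (a : \bar R) (b : R) : 0 < b -> (forall j, a <= b%:E * S j)%E -> (a <= 0)%E.
Proof.
move=> b0 aS; have bS : (b%:E * S j)%E @[j --> \oo] --> (b%:E * 0)%E.
  by apply: cvgeMl.
by rewrite -(mule0 b%:E); apply: cvge_ge bS; exact: nearW.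
Qed.

(** This holds for every t and not just for almost every one, because the convergence of the scheme
    is uniform in t. The outer operator, reading a whole slice, relies on it. *)
Lemma truncation_slice t : 0 < t < T -> {ae mu, forall x, truncation (x, t) = cut_time (x, t)}.
Proof.
move=> tT; pose g (p : XT d) := truncation p - cut_time p.
have mg : measurable_fun setT g.
  by apply: measurable_funB; [exact: measurable_truncation|exact: measurable_cut_time].
have : (\int[mu]_x `|g (x, t)|%:E <= 0)%E.
  apply: (le_S0 ltr01) => j; rewrite mul1e; apply: slice_le => // x.
  exact: dist_clamp_id.
move=> gt0; have : ae_eq mu setT (EFin \o (fun x => g (x, t))) (cst 0%E).
  apply/ae_eq_integral_abs => //; first by apply/measurable_EFinP; exact: (slice t mg).
  by apply/eqP; rewrite eq_le gt0 integral_ge0.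
by apply: filterS => x /(_ I) [] /eqP; rewrite subr_eq0 => /eqP.
Qed.

Lemma ae_truncation : {ae nu, forall p : XT d, truncation p = cut_time p}.
Proof.
pose g (p : XT d) := truncation p - cut_time p.
have mg : measurable_fun setT g.
  by apply: measurable_funB; [exact: measurable_truncation|exact: measurable_cut_time].
have : (\int[nu]_p `|g p|%:E <= 0)%E.
  apply: (le_S0 T0) => j; apply: integral_slices_le => //.
    move=> x t nt; rewrite /g /truncation /cut_time /= ifF; last exact/negP.
    by rewrite clampE ?subr0 ?normr0.
  by move=> t tT; apply: slice_le => // x; exact: dist_clamp_id.
move=> gt0; have : ae_eq nu setT (EFin \o g) (cst 0%E).
  apply/ae_eq_integral_abs => //; first by apply/measurable_EFinP.
  by apply/eqP; rewrite eq_le gt0 integral_ge0.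
by apply: filterS => x /(_ I) [] /eqP; rewrite subr_eq0 => /eqP.
Qed.

Let vu_le j : (\int[nu]_p `|v j p - truncation p|%:E <= T%:E * S j)%E.
Proof.
apply: (integral_slices_le (w := fun p => v j p - truncation p)) => //.
- by apply: measurable_funB => //; exact: measurable_truncation.
- move=> x t /negP/negbTE nt; rewrite /v /interp0 /truncation /cut_time/= nt.
  by rewrite clampE ?subr0 ?normr0.
- move=> t tT; apply: (slice_le (g := fun p => v j p - truncation p)) => // [|x].
    by apply: measurable_funB => //; exact: measurable_truncation.
  by apply: dist_clamp; exact: vM.
Qed.

Let intg_vu j : S j \is a fin_num ->
  nu.-integrable setT (EFin \o (fun p : XT d => v j p - truncation p)).
Proof.
move=> Sj; apply/integrableP; split.
  by apply/measurable_EFinP; apply: measurable_funB => //; exact: measurable_truncation.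
apply: le_lt_trans (vu_le j) _; by rewrite -(fineK Sj) -EFinM ltry.
Qed.

Let near_fin : \forall j \near \oo, S j \is a fin_num.
Proof. by have /fine_cvgP[] := hconv. Qed.

Let cvg_vu : \int[nu]_p `|v j p - truncation p| @[j --> \oo] --> 0.
Proof.
have /fine_cvgP[_ fS] := hconv.
apply: (@squeeze_cvgr _ _ _ _ (cst 0) (fun j => T * fine (S j))).
- apply: filterS near_fin => j Sj /=; apply/andP; split; first exact: Rintegral_ge0.
  rewrite /Rintegral -lee_fin EFinM fineK; last first.
    exact: (integrable_fin_num _ (intg_norm (intg_vu Sj))).
  by rewrite fineK//; exact: vu_le.
- exact: cvg_cst.
- by rewrite -(mulr0 T); exact: cvgMr.
Qed.

Lemma exists_time_steps : exists tau : nat -> R, [/\ forall j, 0 < tau j,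
  tau j @[j --> \oo] --> 0 &
  forall j, discrete_entropy T c lambda (Dx j) A F (tau j) (v j)].
Proof.
have LA0 := LA_ge0 lipA; have LF0 := LF_ge0 d0 hF.
have [LL|] := pselect (0 < LF \/ 0 < LA).
  exists Dt; split => //.
    exact: (cvg_time_step d0 hlambda c0 hDx hDt LF0 LA0 hDx0 hCFL LL).
  move=> j; exact: (scheme_discrete_entropy (hDx j) c0 hlambda (hDt j) (hN j) lipA
    homoA hF (hCFL j) (hU j) (@UM j)).
move=> nLL; have LAe : LA = 0.
  by apply/eqP; rewrite eq_le LA0 andbT leNgt; apply/negP => ?; apply: nLL; right.
have LFe : LF = 0.
  by apply/eqP; rewrite eq_le LF0 andbT leNgt; apply/negP => ?; apply: nLL; left.
exists (fun j => j.+1%:R^-1); split => [j||j]; first by rewrite invr_gt0.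
  exact: cvg_harmonic.
apply: (degenerate_discrete_entropy (hDx j) c0 hlambda (hDt j) (hN j) lipA hF (hU j)) => //.
Qed.

Section fixed_test_function.
Variables (k r : R) (phi : E -> R).
Hypotheses (r0 : 0 < r) (tphi : test_fun T phi) (phi0 : forall p, 0 <= phi p).
Local Notation limit_of w := (limit_integrand c lambda r A f w phi k).

Let mdt : measurable_fun setT (partial_t phi : XT d -> R).
Proof. apply: continuous_measurable_xt; exact: test_fun_continuous_derive tphi _. Qed.

Let mdx l : measurable_fun setT (partial_x l phi : XT d -> R).
Proof. apply: continuous_measurable_xt; exact: test_fun_continuous_derive tphi _. Qed.

Lemma truncation_entropy : (0 <= \int[nu]_p (limit_of truncation p)%:E)%E.
Proof.
have [tau [tau0 tauc dv]] := exists_time_steps.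
have [C [B [B0 phiC dtC dxC sdB]]] := test_fun_bounds tphi.
have [m hm] := test_fun_support tphi.
have e0 : 0 < m.+1%:R^-1 :> R by rewrite invr_gt0.
(* Finitely many indices are dropped so that integrability, Dx <= 1 and the bound on the time step
   hold along the whole sequence. *)
have [J _ hJ] : \forall j \near \oo, S j \is a fin_num /\ (Dx j <= 1 /\ tau j < m.+1%:R^-1).
  have n1 : \forall j \near \oo, Dx j <= 1.
    have /cvgrPdist_le/(_ _ ltr01) := hDx0; apply: filterS => j.
    by rewrite sub0r normrN gtr0_norm.
  have n2 : \forall j \near \oo, tau j < m.+1%:R^-1.
    have /cvgrPdist_lt/(_ _ e0) := tauc; apply: filterS => j.
    by rewrite sub0r normrN gtr0_norm.
  by apply: filterS3 near_fin n1 n2.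
have hJ' j : S (j + J)%N \is a fin_num /\ (Dx (j + J)%N <= 1 /\ tau (j + J)%N < m.+1%:R^-1).
  by apply: hJ => /=; rewrite leq_addl.
have shift (s : nat -> R) (l : R) : s j @[j --> \oo] --> l -> s (j + J)%N @[j --> \oo] --> l.
  by rewrite -(cvg_shiftn J s).
apply: (@limit_entropy_inequality _ _ c lambda T r LA LF `|M| A f F
  (fun j => v (j + J)%N) truncation (fun j => Dx (j + J)%N) (fun j => tau (j + J)%N)
  hlambda r0 c0 d0 lipA hF _ _ _ _ _ _ _ _ _ _ _ _ phi m.+1%:R m.+1%:R^-1 C B) => //.
- exact: (shift Dx).
- exact: (shift tau).
- exact: measurable_truncation.
- exact: truncation_le.
- by move=> j; exact: ae_interp0_locally_constant.
- by move=> j; apply: intg_vu; have [] := hJ' j.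
- exact: (shift (fun j => \int[nu]_p `|v j p - truncation p|)).
- exact: test_fun_continuous tphi.
- by move=> j; have [_ []] := hJ' j.
- by move=> j; have [_ []] := hJ' j.
- by move=> p; exact: test_fun_derivable tphi _ _.
- by move=> l p; exact: test_fun_derivable tphi _ _.
Qed.

Lemma entropy_integrandE p : QT T p ->
  entropy_integrand c lambda f A u k r phi p = limit_of cut_time p.
Proof.
have [C [B [B0 phiC dtC dxC sdB]]] := test_fun_bounds tphi.
case: p => x t [_ /=]; rewrite in_itv/= => tT.
have cE y : cut_time (y, t) = u (y, t) by rewrite /cut_time/= tT.
rewrite /entropy_integrand /limit_integrand/= cE.
rewrite (g_innerE c r hlambda d0 B0 (test_fun_continuous tphi) sdB); last by exists C.
have -> : g_outer c lambda r (fun y => A (u (y, t))) x = c * outer_limit lambda r A cut_time (x, t).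
  rewrite /g_outer /g_on Rintegral_mkcond; congr (_ * _).
  apply: eq_Rintegral => z _; rewrite patchE /= !cE /far_kernel -ltNge.
  case: ifPn; first by rewrite inE/= => ->; rewrite mul1r.
  by rewrite notin_setE/= => /negP/negbTE ->; rewrite mul0r mulr0.
by rewrite /Defs.eta /deta; ring.
Qed.

(** Equality at (x, t) settles the subtracted value only. The values at x + z agree for almost every
    z, since the exceptional set of the slice stays null under translation. *)
Lemma outer_limit_cut_time x t : 0 < t < T -> truncation (x, t) = cut_time (x, t) ->
  outer_limit lambda r A truncation (x, t) = outer_limit lambda r A cut_time (x, t).
Proof.
move=> tT xt.
have mA : measurable_fun setT A by exact: measurable_lipschitz (LA_ge0 lipA) lipA.
have mi (w : XT d -> R) : measurable_fun setT w -> measurable_fun setT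
    (fun z => ((A \o w) ((x, t).1 + z, (x, t).2) - (A \o w) (x, t)) * far_kernel lambda r z).
  move=> mw; apply: measurable_funM; last exact: intg_measurable (intg_far_kernel hlambda r0).
  apply: (@measurable_increment_at _ _ (A \o w) (x, t) id) => //.
  exact: measurableT_comp mA mw.
apply: eq_Rint_ae.
- exact: mi measurable_truncation.
- exact: mi measurable_cut_time.
- have [Z [mZ Z0 hZ]] := truncation_slice tT.
  exists ((fun z => z + x) @^-1` Z); split.
  + by rewrite -[X in measurable X]setTI; exact: measurable_rV_shift.
  + exact: etrans (lebesgue_rV_shift x mZ) Z0.
  + move=> z /= nz; apply: hZ => /= xz; apply: nz.
    by rewrite (addrC x) xz xt.
Qed.

Lemma measurable_limit_integrand (w : XT d -> R) : measurable_fun setT w ->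
  measurable_fun setT (limit_of w).
Proof.
move=> mw; have [C [B [B0 phiC dtC dxC sdB]]] := test_fun_bounds tphi.
have mphi : measurable_fun setT (phi : XT d -> R).
  exact: continuous_measurable_xt (test_fun_continuous tphi).
have -> : limit_of w = level_integrand A f w (partial_t phi)
    (fun p => c * inner_limit lambda r phi p)
    (fun p => c * (phi p * outer_limit lambda r A w p)) (fun l => partial_x l phi) k.
  by apply/funext => p; rewrite /limit_integrand /level_integrand /level_regular; ring.
apply: (measurable_level_integrand lipA hF mw) => //.
- apply: measurable_funM => //.
  exact: (measurable_inner_limit r hlambda hDx hDx0 (test_fun_continuous tphi) phiC B0 sdB).
- apply: measurable_funM => //; apply: measurable_funM => //.
  exact: (measurable_outer_limit hlambda r0 lipA mw).
Qed.

Lemma ae_limit_integrand : {ae nu, forall p : XT d, QT T p ->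
  limit_of cut_time p = limit_of truncation p}.
Proof.
apply: filterS ae_truncation => -[x t] xt [_ /=]; rewrite in_itv/= => tT.
by rewrite /limit_integrand xt (outer_limit_cut_time tT xt).
Qed.

Lemma limit_integrand_off (w : XT d -> R) p : ~ QT T p -> limit_of w p = 0.
Proof.
move=> nQ; have [p0 dt0] := test_fun_off tphi (0, 1) nQ.
rewrite /limit_integrand p0 /partial_t dt0 (inner_limit_off_QT tphi)// big1.
  by rewrite !mulr0 !mul0r !mulr0 !addr0.
by move=> l _; have [_ dx0] := test_fun_off tphi ('e_l, 0) nQ; rewrite /partial_x dx0 mulr0.
Qed.

Lemma limit_satisfies_entropy :
  (0 <= \int[nu]_(p in QT T) (entropy_integrand c lambda f A u k r phi p)%:E)%E.
Proof.
have mQ : measurable (QT T : set (XT d)) by apply: measurableX => //; exact: measurable_itv.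
rewrite (eq_integral (fun p => (limit_of cut_time p)%:E)); last first.
  by move=> p; rewrite inE => Qp; rewrite entropy_integrandE.
rewrite (ae_eq_integral (fun p => (limit_of truncation p)%:E)) //; last 3 first.
- apply/measurable_EFinP; apply: measurable_funS (measurable_limit_integrand _) => //.
  exact: measurable_cut_time.
- apply/measurable_EFinP; apply: measurable_funS (measurable_limit_integrand _) => //.
  exact: measurable_truncation.
- by apply: filterS ae_limit_integrand => p h Qp; rewrite h.
rewrite integral_mkcond (eq_integral (fun p => (limit_of truncation p)%:E)).
  exact: truncation_entropy.
move=> p _; rewrite patchE; case: ifPn => //; rewrite notin_setE => nQ.
by rewrite limit_integrand_off.
Qed.

End fixed_test_function.

(** At t = 0 the interpolation is exactly the cell average of [u0], and the supremum over [0, T] in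
    the convergence includes that time. *)
Lemma limit_initial_datum : {ae mu, forall x, u (x, 0) = u0 x}.
Proof.
have iw : mu.-integrable setT (EFin \o (fun x => u (x, 0))).
  by have [h _] := huC; apply: h; rewrite in_itv/= lexx ltW.
apply: (ae_eq_cell_averages iu0 iw hDx hDx0).
apply: (@squeeze_cvge _ _ _ _ (cst 0%E) _ S) => //; last exact: cvg_cst.
apply: nearW => j /=; apply/andP; split; first exact: integral_ge0.
apply: (@le_trans _ _ (\int[mu]_x
  `|interpolation (Dx j) (Dt j) (U j) (x, 0) - u (x, 0)|%:E)%E); last first.
  by apply: ereal_sup_ubound; exists 0 => //=; rewrite in_itv/= lexx ltW.
rewrite le_eqVlt; apply/orP; left; apply/eqP; apply: eq_integral => x _.
rewrite interpolation_index/= mul0r truncn0 /cell_average.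
by have [-> _] := hU j.
Qed.

End convergence_of_scheme.

Theorem theorem4p4 (R : realType) (d : nat) (hd : (1 <= d)%N)
  (T lambda c : R) (hT : 0 < T) (hlambda : 0 < lambda < 2) (hc : 0 < c)
  (f : R -> 'rV[R]_d) (hf : lipschitz f)
  (A : R -> R) (LA : R) (hLA : LA.-lipschitz A)
  (hA : {homo A : a b / a <= b}) (hA0 : A 0 = 0)
  (u0 : 'rV[R]_d -> R)
  (hu0oo : Linfty (lebesgue_rV d) setT u0)
  (hu01 : (lebesgue_rV d).-integrable setT (EFin \o u0))
  (F : 'I_d -> R -> R -> R) (LF : R) (hF : numerical_flux f LF F)
  (Dx Dt : nat -> R) (N : nat -> nat)
  (hDx : forall j, 0 < Dx j) (hDt : forall j, 0 < Dt j)
  (hN : forall j, (N j)%:R * Dt j = T)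
  (hDx0 : Dx j @[j --> \oo] --> 0)
  (hCFL : forall j, CFL d (Dx j) c lambda LF LA (Dt j))
  (U : nat -> nat -> 'rV[int]_d -> R)
  (hU : forall j, scheme_solution (Dx j) c lambda (Dt j) (N j) A F u0 (U j))
  (hbounded : exists M : R, forall j,
     {ae lebesgue_xt d, forall p, QT T p ->
        `|interpolation (Dx j) (Dt j) (U j) p| <= M})
  (u : 'rV[R]_d * R -> R)
  (huoo : Linfty (lebesgue_xt d) (QT T) u) (huC : CL1 T u)
  (hconv :
     ereal_sup [set (\int[lebesgue_rV d]_x
          `|interpolation (Dx j) (Dt j) (U j) (x, t) - u (x, t)|%:E)%E
        | t in `[0, T]] @[j --> \oo] --> 0%E) :
  entropy_solution c lambda T f A u0 u.
Proof.
have [M hM] := hbounded; have [mu_ _] := huoo.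
have lipA a b : `|A a - A b| <= LA * `|a - b| by exact: (hLA (a, b)).
split; first by split.
- move=> k r phi r0 tphi phi0.
  exact: (limit_satisfies_entropy hd hT hlambda hc lipA hA hF hDx hDt hN hDx0
    hCFL hU hM mu_ hconv k r0 tphi phi0).
- exact: (limit_initial_datum hT hu01 hDx hDx0 hU huC hconv).
Qed.
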